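(* Let $a_1,a_2,a_3$ be free parameters and $\boldsymbol a=(a_1,a_2,a_3)$. (i) Let $$u := I(x)=\int_{0}^{\sqrt{x}}\frac{dt}{\sqrt{1+a_1t^2+a_2t^4+a_3t^6}},$$ $$g_2 = 4\left(\frac{a_1^2}{3}-a_2\right),\qquad g_3=4\left(\frac{a_1a_2}{3}-\frac{2a_1^3}{27}-a_3\right).$$ Then $$x(u)=\frac{1}{\wp(u;g_2,g_3)-a_1/3}.$$ (If $g_2^3-27g_3^2=0$, then the function $\wp(u;g_2,g_3)=-\frac{d^2}{du^2}\log\sigma(u;g_2,g_3)$ corresponds to a degeneration of the Weierstrass $\sigma$-function.) (ii) The logarithm and exponential of the two-valued formal group $\mathbb G_{\boldsymbol a}$ are given by the following formal series over the algebra $\mathbb Q[a_1,a_2,a_3]$: $$B(x)=I^2(x)=\left(\int_{0}^{\sqrt{x}}\frac{dt}{\sqrt{1+a_1t^2+a_2t^4+a_3t^6}}\right)^2,\qquad B^{-1}(x)=\frac{1}{\wp(\sqrt{x};g_2,g_3)-a_1/3}.$$ (iii) Let $Q(t):=1-a_1t^2+a_2t^4-a_3t^6$. Then, over $\mathbb Q[a_1,a_2,a_3]$, the formal group law $F_{\mathrm{Bc}}(u,v)$, its exponential $f_{\mathrm{Bc}}(u)$, and its logarithm $g_{\mathrm{Bc}}(u)$ have the form $$F_{\mathrm{Bc}}(u,v)=\left[\left(\frac{u\sqrt{Q(v)}-v\sqrt{Q(u)}}{u^2-v^2}\right)^2+a_3u^2v^2\right]^{-1/2},$$ $$f_{\mathrm{Bc}}(u)=\frac{1}{\sqrt{\wp(u;g_2,-g_3)+\frac{a_1}{3}}},\qquad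 g_{\mathrm{Bc}}(u)=\int_{0}^{u}\frac{dt}{\sqrt{1-a_1t^2+a_2t^4-a_3t^6}}.$$ (iv) The formal group law $F_{\mathrm{Bc}}(u,v)$ is universal, over commutative $\mathbb Q$-algebras, among single-valued formal group laws with formal inverse $\bar u=-u$ whose modulus square construction yields the two-valued formal group $\mathbb G_{\boldsymbol a}$. (v) The intersection of the class $\mathcal F(u,v)$ of formal group laws and the class $F_{\mathrm{Bc}}(u,v)$ coincides with the Ochanine genus. This is characterized by the conditions $\lambda_1(u)\equiv 1$ for $\mathcal F(u,v)$ and $a_3=0$ for $F_{\mathrm{Bc}}(u,v)$.
   Context: $\wp(u;g_2,g_3)=u^{-2}+O(u^2)$ is the Weierstrass function, satisfying $(\wp')^2=4\wp^3-g_2\wp-g_3$, and $\sigma(u;g_2,g_3)=u+O(u^5)$ is the Weierstrass sigma-function, $\wp=-(\log\sigma)''$. Square roots of series with constant term $1$ are taken with constant term $1$; the branch of $F_{\mathrm{Bc}}(u,v)$ is the one with leading term $u+v$, and $f_{\mathrm{Bc}}(u)=u+\cdots$. For a one-dimensional commutative formal group law $F$ over a $\mathbb Q$-algebra, the logarithm $g(u)=u+\cdots$ satisfies $g(F(u,v))=g(u)+g(v)$, and the exponential is $f=g^{-1}$. The formal inverse $\bar u$ is defined by $F(u,\bar u)=0$. Modulus square construction: for $F$ over a ring $S$, put $x=u\bar u$, $y=v\bar v$, $z_1=F(u,v)F(\bar u,\bar v)$, $z_2=F(u,\bar v)F(\bar u,v)$. Then $\Psi_1=z_1+z_2$ and $\Psi_2=z_1z_2$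 lie in $S[[x,y]]$, and the two-valued formal group obtained from $F$ is the law $x*y=[z_1,z_2]$ given by the roots of $z^2-\Psi_1(x,y)z+\Psi_2(x,y)=0$. $\mathbb G_{\boldsymbol a}$ is the two-valued formal group $x*y=[z_1,z_2]$, where $z_1,z_2$ are the roots in $z$ of the Buchstaber polynomial $$\mathcal B_{\boldsymbol a}(z;x,y)=(x+y+z-a_2xyz)^2-4(1+a_3xyz)(xy+yz+xz+a_1xyz),$$ which is quadratic in $z$ with leading coefficient invertible as a power series in $x,y$ (dividing by it gives $\Psi_1,\Psi_2$). The logarithm of a two-valued formal group with $\Psi_2\equiv(x-y)^2$ modulo degree $3$ is the unique series $B(x)=x+O(x^2)$ with $B(z_{1,2})=\left(\sqrt{B(x)}\pm\sqrt{B(y)}\right)^2$, where $z_1,z_2$ are the two values of $x*y$; its exponential is the compositional inverse $B^{-1}$. Universality in (iv) means: $F_{\mathrm{Bc}}$ has formal inverse $-u$ and modulus square $\mathbb G_{\boldsymbol a}$, and every (one-dimensional commutative) formal group law $F$ over a commutative $\mathbb Q$-algebra $S$ with formal inverse $-u$ whose modulus square is a specialization $\mathbb G_{\boldsymbol\alpha}$, $\boldsymbol\alpha\in S^3$, is obtained by applying coefficientwise to $F_{\mathrm{Bc}}$ a unique $\mathbb Q$-algebra homomorphism $\mathbb Q[a_1,a_2,a_3]\to S$. In (v), the class $\mathcal F(u,v)$ is the class of formal group laws of the form $$\mathcal F(u,v)=\frac{u^2\lambda_1(v)-v^2\lambda_1(u)}{u\lambda_2(v)-v\lambda_2(u)},$$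 where $\lambda_1,\lambda_2\in A[[u]]$ and $A$ is the graded ring of coefficients of these series, with $A\otimes\mathbb Q\cong\mathbb Q[\alpha,\wp(z),\wp'(z),g_2]$. This class realizes the Krichever formal groups, i.e. those with exponential $f_{\mathrm{Kr}}(x)=e^{\alpha x}/\Phi(x,z)$, where $\Phi(x,z)=\frac{\sigma(z-x)}{\sigma(z)\sigma(x)}e^{\zeta(z)x}$ is the Baker–Akhiezer function and $\zeta=(\log\sigma)'$ (here $g_2,g_3$ are the invariants of the elliptic curve of the Krichever law). The class $F_{\mathrm{Bc}}(u,v)$ is the family of formal group laws of (iii) with parameters $a_1,a_2,a_3$. The Ochanine (elliptic) genus is the Hirzebruch genus whose formal group law has logarithm of the form $\int_0^u dt/\sqrt{1-a_1t^2+a_2t^4}$ with parameters $a_1,a_2$ (the usual $2\delta,\varepsilon$). *)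

(* Defs.v *)
From HB Require Import structures.
From mathcomp Require Import all_boot all_order all_algebra.
From mathcomp Require Import boolp classical_sets.
From mathcomp Require Import mpoly.
From mathcomp Require Import ring.

Set Implicit Arguments.
Unset Strict Implicit.
Unset Printing Implicit Defensive.

Import GRing.Theory Num.Theory.
Local Open Scope ring_scope.

(* Formal power series in n variables, as families of coefficients indexed by *)
(* the monomials 'X_{1..n}.                                                   *)
Record fps (n : nat) (R : Type) := FPS { fcoef :> 'X_{1..n} -> R }.

HB.instance Definition _ n R := gen_eqMixin (fps n R).
HB.instance Definition _ n R := gen_choiceMixin (fps n R).

Lemma fpsP n R (f g : fps n R) : f =1 g -> f = g.
Proof. by case: f g => f [g] /= /funext ->. Qed.

Section FpsZmod.
Variables (n : nat) (R : zmodType).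
Implicit Types f g h : fps n R.

Definition fzero : fps n R := FPS (fun=> 0).
Definition fadd f g : fps n R := FPS (fun m => f m + g m).
Definition fopp f : fps n R := FPS (fun m => - f m).

Fact faddA : associative fadd.
Proof. by move=> f g h; apply: fpsP => m /=; rewrite addrA. Qed.
Fact faddC : commutative fadd.
Proof. by move=> f g; apply: fpsP => m /=; rewrite addrC. Qed.
Fact fadd0 : left_id fzero fadd.
Proof. by move=> f; apply: fpsP => m /=; rewrite add0r. Qed.
Fact faddN : left_inverse fzero fopp fadd.
Proof. by move=> f; apply: fpsP => m /=; rewrite addNr. Qed.

HB.instance Definition _ :=
  GRing.isZmodule.Build (fps n R) faddA faddC fadd0 faddN.

Lemma fcoef0 m : (0 : fps n R) m = 0. Proof. by []. Qed.
Lemma fcoefD f g m : (f + g) m = f m + g m. Proof. by []. Qed.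
Lemma fcoefN f m : (- f) m = - f m. Proof. by []. Qed.
Lemma fcoefB f g m : (f - g) m = f m - g m. Proof. by []. Qed.
End FpsZmod.

Section FpsRing.
Variables (n : nat) (R : comNzRingType).
Implicit Types f g h : fps n R.

Definition fmul f g : fps n R :=
  FPS (fun m => \sum_(k : 'X_{1..n < (mdeg m).+1} | (k <= m)%MM)
                   f k * g (m - k)%MM).
Definition fC (c : R) : fps n R := FPS (fun m => c *+ (m == 0%MM)).

Let trunc d f : {mpoly R[n]} := \sum_(m : 'X_{1..n < d}) f m *: 'X_[m].

Let truncE d f m : (mdeg m < d)%N -> (trunc d f)@_m = f m.
Proof. exact: mcoeff_mpoly. Qed.

Let fmulE d f g m : (mdeg m < d)%N ->
  fmul f g m = (trunc d f * trunc d g)@_m.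
Proof.
move=> md; rewrite -[RHS]/((mpoly_mul (trunc d f) (trunc d g))@_m).
rewrite (mcoeff_poly_mul_lin _ _ (ltnSn _)) /=; apply: eq_bigr => k _.
rewrite !truncE //; first exact: leq_ltn_trans (mdegB _ _) md.
exact: leq_trans (bmdeg k) md.
Qed.

Let mulE d f g (p q : {mpoly R[n]}) m : (mdeg m < d)%N ->
    (forall k, (mdeg k < d)%N -> f k = p@_k) ->
    (forall k, (mdeg k < d)%N -> g k = q@_k) ->
  fmul f g m = (p * q)@_m.
Proof.
move=> md fp gq; rewrite -[RHS]/((mpoly_mul p q)@_m).
rewrite (mcoeff_poly_mul_lin _ _ (ltnSn _)) /=; apply: eq_bigr => k _.
rewrite fp ?gq //; first exact: leq_ltn_trans (mdegB _ _) md.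
exact: leq_trans (bmdeg k) md.
Qed.

Fact fmulA : associative fmul.
Proof.
move=> f g h; apply: fpsP => m; pose d := (mdeg m).+1.
rewrite (@mulE d _ _ (trunc d f) (trunc d g * trunc d h)) ?ltnSn //.
- rewrite mulrA; symmetry; apply: (@mulE d); rewrite ?ltnSn // => k kd.
  + exact: fmulE.
  + by rewrite truncE.
- by move=> k kd; rewrite truncE.
- by move=> k kd; apply: fmulE.
Qed.

Fact fmulC : commutative fmul.
Proof.
move=> f g; apply: fpsP => m.
by rewrite !(@fmulE (mdeg m).+1) ?ltnSn // mulrC.
Qed.

Fact fmul1 : left_id (fC 1) fmul.
Proof.
move=> f; apply: fpsP => m; pose d := (mdeg m).+1.
rewrite (@mulE d _ _ 1 (trunc d f)) ?ltnSn // ?mul1r ?truncE ?ltnSn //.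
  by move=> k _; rewrite mcoeff1.
by move=> k kd; rewrite truncE.
Qed.

Fact fmulDl : left_distributive fmul +%R.
Proof.
move=> f g h; apply: fpsP => m; rewrite fcoefD /= -big_split /=.
by apply: eq_bigr => k _; rewrite mulrDl.
Qed.

Fact fone_neq0 : fC 1 != 0.
Proof.
apply/eqP => /(congr1 (fun f : fps n R => f 0%MM)) /= /eqP.
by rewrite eqxx mulr1n oner_eq0.
Qed.

HB.instance Definition _ :=
  GRing.Zmodule_isComNzRing.Build (fps n R) fmulA fmulC fmul1 fmulDl fone_neq0.

Lemma fcoefM f g m : (f * g) m =
  \sum_(k : 'X_{1..n < (mdeg m).+1} | (k <= m)%MM) f k * g (m - k)%MM.
Proof. by []. Qed.

Lemma fcoef1 m : (1 : fps n R) m = (m == 0%MM)%:R. Proof. by []. Qed.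

Definition fX (i : 'I_n) : fps n R := FPS (fun m => (m == U_(i)%MM)%:R).

(* congruence modulo total degree d *)
Definition eqdeg d f g := forall m, (mdeg m < d)%N -> f m = g m.

End FpsRing.

(* f(g_0, .., g_(n-1)), meaningful when the g_i have zero constant term: only *)
(* monomials of degree at most mdeg m then contribute to the coefficient m.   *)
Definition fsubst (R : comNzRingType) (n k : nat) (f : fps n R)
    (g : 'I_n -> fps k R) : fps k R :=
  FPS (fun m => \sum_(d : 'X_{1..n < (mdeg m).+1})
                   f d * (\prod_(i < n) g i ^+ d i) m).

Definition fcomp (R : comNzRingType) k (f : fps 1 R) (g : fps k R) : fps k R :=
  fsubst f (fun=> g).

Definition fsubst2 (R : comNzRingType) k (f : fps 2 R) (g h : fps k R) :
    fps k R :=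
  fsubst f (fun i => [:: g; h]`_i).

Definition fmap (R S : Type) n (phi : R -> S) (f : fps n R) : fps n S :=
  FPS (fun m => phi (f m)).

Definition mon (k : nat) : 'X_{1..1} := (U_(ord0) *+ k)%MM.
Definition ser (R : Type) (c : nat -> R) : fps 1 R :=
  FPS (fun m => c (m ord0)).

Definition fderiv (R : comNzRingType) (f : fps 1 R) : fps 1 R :=
  ser (fun k => f (mon k.+1) *+ k.+1).

Definition fint (S : comAlgType rat) (f : fps 1 S) : fps 1 S :=
  ser (fun k => if k is j.+1 then (j.+1%:R^-1 : rat) *: f (mon j) else 0).

(* Inverse of a series with constant term 1. *)
Definition finv (R : comNzRingType) n (f : fps n R) : fps n R :=
  xget 0 [set g : fps n R | f * g = 1].

(* Square root, with constant term 1, of a series with constant term 1. *)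
Definition fsqrt (S : comAlgType rat) n (f : fps n S) : fps n S :=
  xget 0 [set g : fps n S | g 0%MM = 1 /\ g ^+ 2 = f].

Definition comp_inverse (R : comNzRingType) (f g : fps 1 R) : Prop :=
  [/\ f 0%MM = 0, g 0%MM = 0, fcomp f g = fX R ord0 & fcomp g f = fX R ord0].

Section Weierstrass.
Variable S : comAlgType rat.
Local Notation u := (fX S (ord0 : 'I_1)).

(* The Weierstrass function is the Laurent series wp(u) = W(u) / u ^ 2, so    *)
(* that u ^ 3 wp'(u) = u W'(u) - 2 W(u); the last clause is the differential  *)
(* equation (wp')^2 = 4 wp^3 - g2 wp - g3 multiplied by u ^ 6.                *)
Definition is_wp (g2 g3 : S) (W : fps 1 S) : Prop :=
  eqdeg 4 W 1 /\
  (u * fderiv W - 2%:R * W) ^+ 2 =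
    4%:R * W ^+ 3 - fC 1 g2 * u ^+ 4 * W - fC 1 g3 * u ^+ 6.

Definition u2wp (g2 g3 : S) : fps 1 S := xget 0 [set W | is_wp g2 g3 W].

(* wp = - (log s)'' = (s' ^ 2 - s s'') / s ^ 2, with denominators cleared. *)
Definition wp_is_dlog2 (W s : fps 1 S) : Prop :=
  W * s ^+ 2 = u ^+ 2 * (fderiv s ^+ 2 - s * fderiv (fderiv s)).

Definition sigma (g2 g3 : S) : fps 1 S :=
  xget 0 [set s : fps 1 S | eqdeg 5 s u /\ wp_is_dlog2 (u2wp g2 g3) s].

(* 1 / (wp(u; g2, g3) + c) *)
Definition inv_wp (g2 g3 c : S) : fps 1 S :=
  u ^+ 2 * finv (u2wp g2 g3 + fC 1 c * u ^+ 2).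

(* 1 / sqrt (wp(u; g2, g3) + c) *)
Definition inv_sqrt_wp (g2 g3 c : S) : fps 1 S :=
  u * finv (fsqrt (u2wp g2 g3 + fC 1 c * u ^+ 2)).

End Weierstrass.

Section Curve.
Variables (S : comAlgType rat) (a1 a2 a3 : S).
Local Notation t := (fX S (ord0 : 'I_1)).
Local Notation u := (fX S (ord0 : 'I_2)).
Local Notation v := (fX S (ord_max : 'I_2)).

Definition inv_g2 : S := 4%:R * ((1 / 3%:R : rat) *: a1 ^+ 2 - a2).
Definition inv_g3 : S :=
  4%:R * ((1 / 3%:R : rat) *: (a1 * a2) - (2%:R / 27%:R : rat) *: a1 ^+ 3 - a3).

Definition serP : fps 1 S :=
  1 + fC 1 a1 * t ^+ 2 + fC 1 a2 * t ^+ 4 + fC 1 a3 * t ^+ 6.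
Definition serQ : fps 1 S :=
  1 - fC 1 a1 * t ^+ 2 + fC 1 a2 * t ^+ 4 - fC 1 a3 * t ^+ 6.

(* The integral I, as a series in the upper bound s = sqrt x. *)
Definition serI : fps 1 S := fint (finv (fsqrt serP)).

Definition g_Bc : fps 1 S := fint (finv (fsqrt serQ)).
Definition f_Bc : fps 1 S :=
  inv_sqrt_wp inv_g2 (- inv_g3) ((1 / 3%:R : rat) *: a1).

(* F = [(D / (u^2 - v^2))^2 + a3 u^2 v^2]^(-1/2) on the branch u + v + ..,    *)
(* where D = u sqrt(Q(v)) - v sqrt(Q(u)).                                     *)
Definition is_F_Bc (F : fps 2 S) : Prop :=
  let D := u * fcomp (fsqrt serQ) v - v * fcomp (fsqrt serQ) u in
  eqdeg 2 F (u + v) /\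
  F ^+ 2 * (D ^+ 2 + fC 2 a3 * u ^+ 2 * v ^+ 2 * (u ^+ 2 - v ^+ 2) ^+ 2) =
    (u ^+ 2 - v ^+ 2) ^+ 2.

Definition F_Bc : fps 2 S := xget 0 [set F | is_F_Bc F].

End Curve.

Definition buchstaber (T : comNzRingType) (a1 a2 a3 z x y : T) : T :=
  (x + y + z - a2 * x * y * z) ^+ 2
  - 4%:R * (1 + a3 * x * y * z) * (x * y + y * z + x * z + a1 * x * y * z).

(* A two-valued law x * y = [z1, z2] is given by the pair (z1 + z2, z1 z2) of *)
(* series in x, y.                                                            *)
Definition tvlaw (S : comNzRingType) : Type := (fps 2 S * fps 2 S)%type.

Definition Gbuch (S : comNzRingType) (a1 a2 a3 : S) : tvlaw S :=
  let x := fX S (ord0 : 'I_2) in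
  let y := fX S (ord_max : 'I_2) in
  let b : {poly fps 2 S} :=
    buchstaber (fC 2 a1)%:P (fC 2 a2)%:P (fC 2 a3)%:P 'X x%:P y%:P in
  (- (finv b`_2 * b`_1), finv b`_2 * b`_0).

(* Over S[[s, t]] with x = s^2, y = t^2 the law has roots z1, z2 such that    *)
(* B(z1) and B(z2) are the squares of sqrt B(x) +- sqrt B(y), the series r(s) *)
(* = s + .. being sqrt B(s^2).                                                *)
Definition tv_log (S : comNzRingType) (P : tvlaw S) (B : fps 1 S) : Prop :=
  let x := fX S (ord0 : 'I_1) in
  let s := fX S (ord0 : 'I_2) in
  let t := fX S (ord_max : 'I_2) in
  [/\ eqdeg 3 P.2 ((s - t) ^+ 2), eqdeg 2 B x &
   exists (r : fps 1 S) (z1 z2 : fps 2 S),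
    [/\ eqdeg 2 r x /\ r ^+ 2 = fcomp B (x ^+ 2),
        z1 0%MM = 0 /\ z2 0%MM = 0,
        z1 + z2 = fsubst2 P.1 (s ^+ 2) (t ^+ 2) /\
        z1 * z2 = fsubst2 P.2 (s ^+ 2) (t ^+ 2),
        fcomp B z1 = (fcomp r s + fcomp r t) ^+ 2 &
        fcomp B z2 = (fcomp r s - fcomp r t) ^+ 2]].

Section FormalGroupLaws.
Variable S : comNzRingType.
Implicit Types (F : fps 2 S) (g f : fps 1 S).

Definition is_fgl F : Prop :=
  let u := fX S (ord0 : 'I_1) in
  let x := fX S (ord0 : 'I_2) in
  let y := fX S (ord_max : 'I_2) in
  let a := fX S (@Ordinal 3 0 isT) in
  let b := fX S (@Ordinal 3 1 isT) in
  let c := fX S (@Ordinal 3 2 isT) in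
  [/\ fsubst2 F u 0 = u, fsubst2 F 0 u = u, fsubst2 F y x = F &
      fsubst2 F (fsubst2 F a b) c = fsubst2 F a (fsubst2 F b c)].

Definition fgl_log F g : Prop :=
  eqdeg 2 g (fX S ord0) /\
  fcomp g F = fcomp g (fX S (ord0 : 'I_2)) + fcomp g (fX S (ord_max : 'I_2)).

Definition fgl_exp F f : Prop := exists2 g, fgl_log F g & comp_inverse g f.

Definition fgl_inverse F (ub : fps 1 S) : Prop :=
  ub 0%MM = 0 /\ fsubst2 F (fX S ord0) ub = 0.

Definition modulus_square F (P : tvlaw S) : Prop :=
  let u := fX S (ord0 : 'I_2) in
  let v := fX S (ord_max : 'I_2) in
  exists2 i : fps 1 S, fgl_inverse F i &
    let ub := fcomp i u in
    let vb := fcomp i v in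
    let z1 := F * fsubst2 F ub vb in
    let z2 := fsubst2 F u vb * fsubst2 F ub v in
    fsubst2 P.1 (u * ub) (v * vb) = z1 + z2 /\
    fsubst2 P.2 (u * ub) (v * vb) = z1 * z2.

(* The denominator (u - v)(1 + ..) of the fraction, which is not a zero       *)
(* divisor, is cleared. The coefficient of u^2 in l1 and that of u in l2      *)
(* cancel out, so these two coefficients are not determined by F.             *)
Definition calF_form (l1 l2 : fps 1 S) F : Prop :=
  let u := fX S (ord0 : 'I_2) in
  let v := fX S (ord_max : 'I_2) in
  [/\ l1 0%MM = 1, l2 0%MM = 1 &
      F * (u * fcomp l2 v - v * fcomp l2 u)
      = u ^+ 2 * fcomp l1 v - v ^+ 2 * fcomp l1 u].

Definition in_calF F : Prop := exists l1 l2, calF_form l1 l2 F.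

End FormalGroupLaws.

Definition in_Bc (S : comAlgType rat) (F : fps 2 S) : Prop :=
  exists a1 a2 a3 : S, F = F_Bc a1 a2 a3.

Definition is_ochanine (S : comAlgType rat) (F : fps 2 S) : Prop :=
  let t := fX S (ord0 : 'I_1) in
  exists a1 a2 : S,
    fgl_log F (fint (finv (fsqrt (1 - fC 1 a1 * t ^+ 2 + fC 1 a2 * t ^+ 4)))).

Definition Qa : comAlgType rat := {mpoly rat[3]}.
Definition pa1 : Qa := 'X_(@Ordinal 3 0 isT).
Definition pa2 : Qa := 'X_(@Ordinal 3 1 isT).
Definition pa3 : Qa := 'X_(@Ordinal 3 2 isT).

(* The series selected by xget above exist: each is a fixed point of an       *)
(* operator that is contracting for the degree filtration.                    *)
Section Contraction.
Variables (n : nat) (R : comNzRingType).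
Implicit Types f g h : fps n R.

Let V d f := eqdeg d f 0.

Lemma eqdegW d e f g : (d <= e)%N -> eqdeg e f g -> eqdeg d f g.
Proof. by move=> de H m md; apply: H; apply: leq_trans de. Qed.

Lemma eqdegB d f g : eqdeg d (f - g) 0 <-> eqdeg d f g.
Proof.
split=> H m /H; rewrite fcoefB ?fcoef0; first by move/eqP; rewrite subr_eq0 => /eqP.
by move=> ->; rewrite subrr.
Qed.

Lemma eqdeg0D d f g : V d f -> V d g -> V d (f + g).
Proof. by move=> Hf Hg m md; rewrite fcoefD Hf ?Hg ?addr0. Qed.

Lemma eqdeg0N d f : V d f -> V d (- f).
Proof. by move=> Hf m md; rewrite fcoefN Hf ?oppr0. Qed.

Lemma eqdeg0M d e f g : V d f -> V e g -> V (d + e)%N (f * g).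
Proof.
move=> Hf Hg m md; rewrite fcoefM big1 // => k km.
have: (mdeg k + mdeg (m - k)%MM < d + e)%N by rewrite -mdegD addmC submK.
have [kd _|dk lt] := ltnP (mdeg k) d; first by rewrite Hf ?mul0r.
by rewrite Hg ?mulr0 // -(ltn_add2l d); apply: leq_ltn_trans lt; rewrite leq_add2r.
Qed.

Lemma eqdeg0Ml d f g : V d g -> V d (f * g).
Proof. by move=> Hg; apply: (@eqdeg0M 0 d). Qed.

Lemma eqdeg0Mr d f g : V d f -> V d (f * g).
Proof. by rewrite mulrC; apply: eqdeg0Ml. Qed.

Lemma eqdeg01 f : V 1 f <-> f 0%MM = 0.
Proof.
split=> [|f0 m]; first by apply; rewrite mdeg0.
by rewrite ltnS leqn0 mdeg_eq0 => /eqP ->.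
Qed.

Lemma contraction_fix (Phi : fps n R -> fps n R) :
  (forall d g h, eqdeg d g h -> eqdeg d.+1 (Phi g) (Phi h)) ->
  exists g, Phi g = g.
Proof.
move=> ctr; pose a i := iter i Phi 0.
have aS i : eqdeg i (a i) (a i.+1) by elim: i => // i IH; apply: ctr.
have aD i j : eqdeg i (a i) (a (i + j)%N).
  elim: j => [|j IH] m mi; first by rewrite addn0.
  by rewrite IH // addnS aS // (leq_trans mi) ?leq_addr.
pose g := FPS (fun m => a (mdeg m).+1 m).
have ga i : eqdeg i g (a i).
  move=> m mi; rewrite -[i in RHS](subnKC mi).
  by rewrite -(aD (mdeg m).+1).
exists g; apply: fpsP => m.
rewrite (ctr (mdeg m).+1 _ _ (ga _)) //.
exact/esym/(ga (mdeg m).+2)/ltnW.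
Qed.

Lemma coef0M f g : (f * g) 0%MM = f 0%MM * g 0%MM.
Proof.
pose z : 'X_{1..n < (mdeg (0 : 'X_{1..n})%MM).+1} := BMultinom (ltnSn (mdeg 0)).
have z0 : (0 - 0)%MM = 0%MM :> 'X_{1..n} by apply/mnmP=> i; rewrite mnmBE subnn mnm0E.
rewrite fcoefM (bigD1 z) /= ?z0; last by apply/mnm_lepP.
rewrite big1 ?addr0 // => k /andP[_]; rewrite bmeqP /= -mdeg_eq0.
by have := bmdeg k; rewrite {2}mdeg0 ltnS leqn0 => ->.
Qed.

Lemma coef0X f i : (f ^+ i) 0%MM = f 0%MM ^+ i.
Proof.
by elim: i => [|i IH]; rewrite ?expr0 ?fcoef1 ?eqxx // !exprS coef0M IH.
Qed.

Lemma finvP f : f 0%MM = 1 -> f * finv f = 1.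
Proof.
move=> f1; apply: (@xgetPex _ 0 [set g : fps n R | f * g = 1]).
pose Phi g := 1 - (f - 1) * g.
have ctr d g h : eqdeg d g h -> eqdeg d.+1 (Phi g) (Phi h).
  move=> gh;  apply/eqdegB; rewrite -add1n.
  have -> : Phi g - Phi h = (1 - f) * (g - h) by rewrite /Phi; ring.
  apply: eqdeg0M; last exact/eqdegB.
  by apply/eqdeg01; rewrite fcoefB f1 fcoef1 eqxx subrr.
have [g Eg] := contraction_fix ctr; exists g.
have E : f * g = 1 - (Phi g - g) by rewrite /Phi; ring.
by rewrite /= E Eg subrr subr0.
Qed.

Lemma finv0 f : f 0%MM = 1 -> finv f 0%MM = 1.
Proof.
move=> f1; have /(congr1 (fun h : fps n R => h 0%MM)) := finvP f1.
by rewrite coef0M f1 mul1r fcoef1 eqxx.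
Qed.

Lemma coef_fXM i f m :
  (fX R i * f) m = if (0 < m i)%N then f (m - U_(i))%MM else 0.
Proof.
rewrite fcoefM; case: ifPn => [mi|]; last first.
  rewrite -eqn0Ngt => /eqP mi; apply: big1 => k /mnm_lepP /(_ i) km /=.
  case: eqP => [Ek|_]; last by rewrite mul0r.
  by move: km; rewrite mi Ek mnm1E eqxx.
have le : (U_(i) <= m)%MM.
  by apply/mnm_lepP => j; rewrite mnm1E; case: eqP => [<-|].
have lt : (mdeg U_(i)%MM < (mdeg m).+1)%N.
  by rewrite ltnS -(submK le) mdegD leq_addl.
rewrite (bigD1 (BMultinom lt)) //= eqxx mul1r big1 ?addr0 // => k.
by rewrite bmeqP /= => /andP[_ /negPf ->]; rewrite mul0r.
Qed.

Lemma coef_fXn (i : 'I_n) k m : (fX R i ^+ k) m = (m == (U_(i) *+ k)%MM)%:R.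
Proof.
elim: k m => [|k IH] m; first by rewrite expr0 fcoef1 mulm0n.
rewrite exprS coef_fXM; case: ifPn => [mi|].
  rewrite IH; congr (_%:R); congr nat_of_bool.
  have le : (U_(i) <= m)%MM.
    by apply/mnm_lepP => j; rewrite mnm1E; case: eqP => [<-|].
  apply/eqP/eqP => [E|->]; last by rewrite mulmS addmC addmK.
  by rewrite -(submK le) E mulmSr.
by case: eqP => // ->; rewrite mulmnE mnm1E eqxx mul1n.
Qed.

End Contraction.

Section SquareRoot.
Variables (S : comAlgType rat) (n : nat).
Implicit Types f g h : fps n S.

Lemma coef_fCM c f m : (fC n c * f) m = c * f m.
Proof.
have lt : (mdeg (0 : 'X_{1..n})%MM < (mdeg m).+1)%N by rewrite mdeg0.
rewrite fcoefM (bigD1 (BMultinom lt)) /=; last first.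
  by apply/mnm_lepP => j; rewrite mnm0E.
rewrite eqxx mulr1n (_ : (m - 0)%MM = m) ?big1 ?addr0 //.
  by move=> k; rewrite bmeqP /= => /andP[_ /negPf ->]; rewrite mulr0n mul0r.
by apply/mnmP => j; rewrite mnmBE mnm0E subn0.
Qed.

Lemma fC_eq0 d : fC n (0 : S) = 0 /\ eqdeg d (fC n (0 : S)) 0.
Proof. by split; [apply: fpsP|] => m * /=; rewrite mul0rn. Qed.

Let hf : fps n S := fC n ((2%:R^-1 : rat)%:A).

Let hf2 : 2%:R * hf = 1.
Proof.
apply: fpsP => m; rewrite mulr_natl mulr2n fcoefD /= -mulrnDl -scalerDl.
have -> : 2%:R^-1 + 2%:R^-1 = 1 :> rat by apply/eqP.
by rewrite scale1r.
Qed.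

Lemma fsqrtP f : f 0%MM = 1 -> fsqrt f 0%MM = 1 /\ fsqrt f ^+ 2 = f.
Proof.
move=> f1; apply: (@xgetPex _ 0 [set g : fps n S | g 0%MM = 1 /\ g ^+ 2 = f]).
pose c g := g - fC n (g 0%MM).
have c0 g : c g 0%MM = 0 by rewrite fcoefB /= eqxx mulr1n subrr.
have cB d g h : eqdeg d g h -> eqdeg d (c g - c h) 0.
  move=> gh m md; rewrite /c !fcoefB /= gh // gh ?subrr //.
  by rewrite mdeg0; apply: leq_ltn_trans md.
pose Phi g := hf * (f - 1 - c g ^+ 2).
have ctr d g h : eqdeg d g h -> eqdeg d.+1 (Phi g) (Phi h).
  move=> gh; apply/eqdegB; rewrite -addn1.
  have -> : Phi g - Phi h = (c g - c h) * (- (hf * (c g + c h))).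
    by rewrite /Phi; ring.
  apply: eqdeg0M; first exact: cB.
  apply/eqdeg0N/eqdeg0Ml/eqdeg01.
  by rewrite fcoefD !c0 addr0.
have [h Eh] := contraction_fix ctr.
have h0 : h 0%MM = 0.
  rewrite -Eh coef0M !fcoefB coef0X c0 expr0n /= f1 eqxx.
  by rewrite mulr1n subrr subr0 mulr0.
have ch : c h = h by rewrite /c h0 (fC_eq0 0).1 subr0.
exists (1 + h); split; first by rewrite fcoefD h0 addr0 fcoef1 eqxx.
have E : 2%:R * h = f - 1 - h ^+ 2 by rewrite -{1}Eh /Phi ch mulrA hf2 mul1r.
have -> : (1 + h) ^+ 2 = 1 + 2%:R * h + h ^+ 2 by ring.
by rewrite E; ring.
Qed.

End SquareRoot.
Section WeierstrassExistence.
Variables (S : comAlgType rat) (g2 g3 : S).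
Implicit Types f g h : fps 1 S.
Local Notation u := (fX S (ord0 : 'I_1)).

Let theta f : fps 1 S := FPS (fun m => f m *+ mdeg m).
Let scl (c : nat -> rat) f : fps 1 S := FPS (fun m => c (mdeg m) *: f m).
Let cut f := f - fC 1 (f 0%MM).

Lemma monE (m : 'X_{1..1}) : m = mon (m ord0).
Proof. by apply/mnmP => i; rewrite (ord1 i) mulmnE mnm1E mul1n. Qed.

Lemma mdeg_mon k : mdeg (mon k) = k.
Proof. by rewrite mdegMn mdeg1 mul1n. Qed.

Lemma mdeg_ord0 (m : 'X_{1..1}) : mdeg m = m ord0.
Proof. by rewrite {1}(monE m) mdeg_mon. Qed.

Let fcoefMn f k m : (f *+ k) m = f m *+ k.
Proof. by elim: k => [|k IH]; rewrite ?mulr0n // !mulrS fcoefD IH. Qed.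

Let uderiv f : u * fderiv f = theta f.
Proof.
apply: fpsP => m; rewrite coef_fXM /= mdeg_ord0; case: ifPn => [m0|]; last first.
  by rewrite -eqn0Ngt => /eqP ->.
by rewrite mnmBE mnm1E /= subn1 prednK // -monE.
Qed.

Let thetaB f g : theta (f - g) = theta f - theta g.
Proof. by apply: fpsP => m; rewrite fcoefB /= mulrnBl. Qed.

Let thetaD f g : theta (f + g) = theta f + theta g.
Proof. by apply: fpsP => m; rewrite fcoefD /= mulrnDl. Qed.

Let theta_1 : theta 1 = 0.
Proof.
apply: fpsP => m; rewrite /= -mdeg_eq0.
by case: (mdeg m) => [|k]; rewrite ?mulr0n ?mul0rn.
Qed.

Let theta_ord d f : eqdeg d f 0 -> eqdeg d (theta f) 0.
Proof. by move=> H m md; rewrite /= H // mul0rn. Qed.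

Let scl_ord c d f : eqdeg d f 0 -> eqdeg d (scl c f) 0.
Proof. by move=> H m md; rewrite /= H // scaler0. Qed.

Let sclB c f g : scl c (f - g) = scl c f - scl c g.
Proof. by apply: fpsP => m; rewrite fcoefB /= scalerBr. Qed.

Let cut0 f : cut f 0%MM = 0.
Proof. by rewrite fcoefB /= eqxx mulr1n subrr. Qed.

Let cutB d g h : eqdeg d g h -> eqdeg d (cut g - cut h) 0.
Proof.
move=> gh m md; rewrite /cut !fcoefB /= gh // gh ?subrr //.
by rewrite mdeg0; apply: leq_ltn_trans md.
Qed.

Let cut_id f : f 0%MM = 0 -> cut f = f.
Proof.
move=> f0; rewrite /cut f0; apply: fpsP => m.
by rewrite fcoefB /= mul0rn subr0.
Qed.

Let eqdeg_fX : eqdeg 1 u 0.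
Proof. by apply/eqdeg01; rewrite /= eq_sym mnm1_eq0. Qed.

Let eqdeg_fXn k : eqdeg k (u ^+ k) 0.
Proof.
elim: k => [|k IH]; first by move=> m; rewrite ltn0.
by rewrite exprS -[k.+1]add1n; apply: eqdeg0M.
Qed.

(* With W = 1 + Y and theta = u d/du the equation reads                       *)
(* 4 (theta + 1) Y = RW Y.                                                    *)
Let RW Y := fC 1 g2 * u ^+ 4 * (1 + Y) + fC 1 g3 * u ^+ 6 + theta Y ^+ 2
  - 4%:R * (Y * theta Y) - 8%:R * Y ^+ 2 - 4%:R * Y ^+ 3.

Lemma u2wpP : is_wp g2 g3 (u2wp g2 g3).
Proof.
apply: (@xgetPex _ 0 [set W : fps 1 S | is_wp g2 g3 W]).
pose c (k : nat) : rat := (4%:R * k.+1%:R)^-1.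
pose Phi Y := scl c (RW (cut Y)).
have ord0_4 k (Y : fps 1 S) : (k <= 4)%N -> eqdeg k (fC 1 g2 * u ^+ 4 * Y) 0.
  by move=> k4; apply/eqdeg0Mr/eqdeg0Ml; apply: eqdegW k4 _.
have RW_ord k Y : (0 < k)%N -> eqdeg k Y 0 ->
    eqdeg (minn 4 (k + k)) (RW Y) 0.
  move=> k0 HY; have HT := theta_ord HY.
  have HYY : eqdeg (minn 4 (k + k)) (Y ^+ 2) 0.
    by rewrite expr2; apply: eqdegW (geq_minr _ _) _; apply: eqdeg0M.
  have HYT : eqdeg (minn 4 (k + k)) (Y * theta Y) 0.
    by apply: eqdegW (geq_minr _ _) _; apply: eqdeg0M.
  have HTT : eqdeg (minn 4 (k + k)) (theta Y ^+ 2) 0.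
    by rewrite expr2; apply: eqdegW (geq_minr _ _) _; apply: eqdeg0M.
  rewrite /RW; apply: eqdeg0D; last by apply/eqdeg0N/eqdeg0Ml; rewrite exprS; apply: eqdeg0Ml.
  apply: eqdeg0D; last exact/eqdeg0N/eqdeg0Ml.
  apply: eqdeg0D; last exact/eqdeg0N/eqdeg0Ml.
  apply: eqdeg0D => //; apply: eqdeg0D; first exact: ord0_4 (geq_minl _ _).
  apply: eqdeg0Ml; apply: eqdegW (@eqdeg_fXn 6).
  by apply: leq_trans (geq_minl _ _) _.
have ctr d g h : eqdeg d g h -> eqdeg d.+1 (Phi g) (Phi h).
  move=> /cutB gh; apply/eqdegB; rewrite /Phi -sclB; apply: scl_ord.
  move: (cut g) (cut h) (cut0 g) (cut0 h) gh.
  move=> Y Z /eqdeg01 Y0 /eqdeg01 Z0 YZ.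
  have T0 := theta_ord YZ; have TY := theta_ord Y0; have TZ := theta_ord Z0.
  have -> : RW Y - RW Z = (Y - Z) * (fC 1 g2 * u ^+ 4 - 4%:R * theta Y
        - 8%:R * (Y + Z) - 4%:R * (Y ^+ 2 + Y * Z + Z ^+ 2))
      + theta (Y - Z) * (theta Y + theta Z - 4%:R * Z).
    by rewrite thetaB /RW; ring.
  rewrite -[d.+1]addn1; apply: eqdeg0D; apply: eqdeg0M => //.
    apply: eqdeg0D; last first.
      apply/eqdeg0N/eqdeg0Ml; rewrite !expr2.
      by apply: eqdeg0D; [apply: eqdeg0D|]; apply: eqdeg0Ml.
    apply: eqdeg0D; last by apply/eqdeg0N/eqdeg0Ml/eqdeg0D.
    apply: eqdeg0D; last exact/eqdeg0N/eqdeg0Ml.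
    by apply: eqdeg0Ml; apply: eqdegW (@eqdeg_fXn 4).
  by apply: eqdeg0D; [apply: eqdeg0D|exact/eqdeg0N/eqdeg0Ml].
have [Y EY] := contraction_fix ctr.
have cY0 : Y 0%MM = 0.
  have /eqdeg01 -> // : eqdeg 1 Y 0.
  rewrite -EY; apply: scl_ord; apply: eqdegW (RW_ord 1%N _ _ _) => //.
  exact/eqdeg01.
have {}EY : Y = scl c (RW Y) by rewrite -{1}EY /Phi cut_id.
have Y2 : eqdeg 2 Y 0.
  rewrite EY; apply: scl_ord; apply: (RW_ord 1%N) => //; exact/eqdeg01.
have Y4 : eqdeg 4 Y 0.
  by rewrite EY; apply: scl_ord; apply: (RW_ord 2%N).
have E : 4%:R * (theta Y + Y) = RW Y.
  apply: fpsP => m; have -> : RW Y m = (4%:R * (mdeg m).+1%:R : rat) *: Y m.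
    by rewrite {2}EY /= scalerA divff ?scale1r // mulf_neq0 // pnatr_eq0.
  rewrite mulr_natl -scalerA !scaler_nat fcoefMn.
  by congr (_ *+ _); rewrite mulrSr fcoefD.
exists (1 + Y); split.
  by move=> m md; rewrite fcoefD Y4 // addr0.
rewrite uderiv thetaD theta_1 add0r.
transitivity (4%:R * (1 + Y) ^+ 3
    - (4%:R * (theta Y + Y) - theta Y ^+ 2 + 4%:R * (Y * theta Y)
       + 8%:R * Y ^+ 2 + 4%:R * Y ^+ 3)); first by ring.
by rewrite E /RW; ring.
Qed.

Let theta_fXM f : theta (u * f) = u * (f + theta f).
Proof.
apply: fpsP => m; rewrite [in RHS]coef_fXM -[LHS]/((u * f) m *+ mdeg m) coef_fXM.
case: ifPn => [m0|]; last by rewrite mul0rn.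
have lt : (U_(ord0) <= m)%MM.
  by apply/mnm_lepP => j; rewrite mnm1E; case: eqP => [<-|].
by rewrite -{2}(submK lt) mdegD mdeg1 addn1 mulrS fcoefD.
Qed.

(* With s = u (1 + T) and theta = u d/du the equation reads                   *)
(* (theta^2 - theta) T = RS T.                                                *)
Lemma sigmaP : eqdeg 5 (sigma g2 g3) u /\
  wp_is_dlog2 (u2wp g2 g3) (sigma g2 g3).
Proof.
apply: (@xgetPex _ 0 [set s : fps 1 S | eqdeg 5 s u /\
  wp_is_dlog2 (u2wp g2 g3) s]).
have [W4 _] := u2wpP; move: (u2wp g2 g3) W4 => W /eqdegB W4.
pose D2 T := theta (theta T) - theta T.
pose RS T := theta T ^+ 2 - T * D2 T - (W - 1) * (1 + T) ^+ 2.
pose c (k : nat) : rat := if k is k'.+2 then (k'.+2%:R * k'.+1%:R)^-1 else 0.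
pose Phi T := scl c (RS (cut T)).
have D2_ord d T : eqdeg d T 0 -> eqdeg d (D2 T) 0.
  move=> HT; have HT1 := theta_ord HT; have HT2 := theta_ord HT1.
  by apply: eqdeg0D => //; apply: eqdeg0N.
have ctr d g h : eqdeg d g h -> eqdeg d.+1 (Phi g) (Phi h).
  move=> /cutB gh; apply/eqdegB; rewrite /Phi -sclB; apply: scl_ord.
  move: (cut g) (cut h) (cut0 g) (cut0 h) gh.
  move=> Y Z /eqdeg01 Y0 /eqdeg01 Z0 YZ.
  have T0 := theta_ord YZ; have TY := theta_ord Y0; have TZ := theta_ord Z0.
  have -> : RS Y - RS Z = (Y - Z) * (- (D2 Y + (W - 1) * (2%:R + Y + Z)))
      + theta (Y - Z) * (theta Y + theta Z) - D2 (Y - Z) * Z.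
    by rewrite /RS /D2 !thetaB; ring.
  rewrite -[d.+1]addn1; apply: eqdeg0D; last first.
    by apply/eqdeg0N; apply: eqdeg0M => //; apply: D2_ord.
  apply: eqdeg0D; apply: eqdeg0M => //; last by apply: eqdeg0D.
  apply/eqdeg0N/eqdeg0D; first exact: D2_ord.
  by apply: eqdeg0Mr; apply: eqdegW W4.
have [T ET] := contraction_fix ctr.
have scl2 f : eqdeg 2 (scl c f) 0.
  by move=> m; rewrite /= /c; case: (mdeg m) => [|[|k]] // _; rewrite scale0r.
have T2 : eqdeg 2 T 0 by rewrite -ET; apply: scl2.
have T0 : T 0%MM = 0 by apply: T2; rewrite mdeg0.
have {}ET : T = scl c (RS T) by rewrite -{1}ET /Phi cut_id.
have RS4 : eqdeg 4 (RS T) 0.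
  have TT := theta_ord T2.
  apply: eqdeg0D; last by apply/eqdeg0N/eqdeg0Mr.
  apply: eqdeg0D; first by rewrite expr2; apply: (@eqdeg0M _ _ 2 2).
  by apply/eqdeg0N/(@eqdeg0M _ _ 2 2) => //; apply: D2_ord.
have T4 : eqdeg 4 T 0 by rewrite ET; apply: scl_ord.
have E : D2 T = RS T.
  apply: fpsP => m; rewrite fcoefB.
  have -> : theta (theta T) m - theta T m
          = ((mdeg m)%:R * ((mdeg m)%:R - 1) : rat) *: T m.
    by rewrite /= mulrBr mulr1 scalerBl -scalerA !scaler_nat.
  have := RS4 m; have := congr1 (fun f : fps 1 S => f m) ET; rewrite /= /c.
  case: (mdeg m) => [|[|k]].
  - by move=> _ ->; rewrite // mul0r scale0r.
  - by move=> _ ->; rewrite // subrr mulr0 scale0r.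
  - move=> -> _; rewrite scalerA.
    have -> : k.+2%:R - 1 = k.+1%:R :> rat by rewrite -[k.+2]addn1 natrD addrK.
    by rewrite divff ?scale1r // mulf_neq0 // pnatr_eq0.
exists (u * (1 + T)); split.
  apply/eqdegB; have -> : u * (1 + T) - u = u * T by ring.
  exact: (@eqdeg0M _ _ 1 4).
have U2 f : u ^+ 2 * fderiv (fderiv f) = theta (theta f) - theta f.
  have -> : theta (theta f) = theta (u * fderiv f) by rewrite uderiv.
  by rewrite theta_fXM -[theta (fderiv f)]uderiv -uderiv; ring.
set s := u * (1 + T).
have Hs : theta s = u * (1 + T + theta T).
  by rewrite theta_fXM thetaD theta_1 add0r.
have Hss : theta (theta s) = u * (1 + T + theta T + (theta T + theta (theta T))).
  by rewrite Hs theta_fXM !thetaD theta_1 add0r.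
rewrite /wp_is_dlog2; symmetry.
transitivity ((u * fderiv s) ^+ 2 - s * (u ^+ 2 * fderiv (fderiv s))); first by ring.
rewrite uderiv U2 Hss Hs -[RHS]addr0 -[X in _ = _ + X](mulr0 (u ^+ 2)).
rewrite -(subrr (RS T)) -{2}E /RS /D2 /s; ring.
Qed.

End WeierstrassExistence.
Section BcExistence.
Variables (S : comAlgType rat) (a1 a2 a3 : S).
Local Notation u := (fX S (ord0 : 'I_2)).
Local Notation v := (fX S (ord_max : 'I_2)).

Lemma coef_fcompX n (q : fps 1 S) (i : 'I_n) m :
  fcomp q (fX S i) m = if m == (U_(i) *+ m i)%MM then q (mon (m i)) else 0.
Proof.
rewrite /fcomp /fsubst /=.
under eq_bigr => d _ do rewrite big_ord1 coef_fXn.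
case: eqP => [Em|nE]; last first.
  apply: big1 => d _; case: eqP => [E|_]; last by rewrite mulr0.
  by case: nE; rewrite {2}E mulmnE mnm1E eqxx mul1n.
have lt : (mdeg (mon (m i)) < (mdeg m).+1)%N.
  by rewrite mdeg_mon {2}Em mdegMn mdeg1 mul1n.
rewrite (bigD1 (BMultinom lt)) //= mulmnE mnm1E eqxx mul1n -Em eqxx mulr1.
rewrite big1 ?addr0 // => d; rewrite bmeqP /= => dm.
case: eqP => [E|_]; last by rewrite mulr0.
by case/eqP: dm; rewrite {2}E (monE d) !mulmnE !mnm1E !eqxx !mul1n.
Qed.

Let quot (q : fps 1 S) : fps 2 S := FPS (fun m =>
  (m == 0%MM)%:R -
  (if (0 < m ord0)%N && (0 < m ord_max)%N then q (mon (mdeg m)) else 0)).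

Let quotP (q : fps 1 S) : q 0%MM = 1 ->
  (u - v) * quot q = u * fcomp q v - v * fcomp q u.
Proof.
move=> q1; have q0 : q (mon 0) = 1 by rewrite /mon mulm0n.
have ord2 (i : 'I_2) : i = ord0 \/ i = ord_max.
  by case: i => [[|[|]]] // p; [left|right]; apply: val_inj.
have mP (m m' : 'X_{1..2}) :
    (m == m') = (m ord0 == m' ord0) && (m ord_max == m' ord_max).
  apply/eqP/andP => [->//|[/eqP E0 /eqP E1]].
  by apply/mnmP => i; case: (ord2 i) => ->.
apply: fpsP => m; rewrite mulrBl !fcoefB !coef_fXM !coef_fcompX /=.
rewrite !mP !mdegE !big_ord_recl !big_ord0 /= !mulmnE !mnmBE !mnm1E !mnm0E /=.
rewrite (_ : lift ord0 ord0 = ord_max :> 'I_2); last exact: val_inj.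
rewrite /= !addn0 !subn0 ?mul0n ?mul1n ?eqxx ?muln1 ?muln0.
case: (m ord0) => [|[|i]]; case: (m ord_max) => [|[|j]] //=;
  rewrite ?subn1 ?subn0 /= ?addn0 ?add0n ?addn1 ?add1n ?q0 ?subrr ?subr0 ?sub0r ?add0r //.
all: rewrite ?oppr0 ?opprK ?addSn ?addnS ?addr0 ?subrr //.
by rewrite addNr.
Qed.

Lemma fX0 n (i : 'I_n) : fX S i 0%MM = 0.
Proof. by rewrite /= eq_sym mnm1_eq0. Qed.

Lemma serQ0 : serQ a1 a2 a3 0%MM = 1.
Proof.
rewrite /serQ !(fcoefD, fcoefN) !(coef0X, coef0M) fX0 fcoef1 eqxx.
by rewrite !expr0n /= !mulr0 !subr0 !addr0.
Qed.

Lemma F_BcP : is_F_Bc a1 a2 a3 (F_Bc a1 a2 a3).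
Proof.
apply: (@xgetPex _ 0 [set F : fps 2 S | is_F_Bc a1 a2 a3 F]).
have [q1 _] := fsqrtP serQ0; have := quotP q1.
set D := _ * _ - _ * _; set E := quot _ => DE.
have E0 : E 0%MM = 1 by rewrite /= eqxx mnm0E /= subr0.
pose H := E ^+ 2 + fC 2 a3 * u ^+ 2 * v ^+ 2 * (u + v) ^+ 2.
have H0 : H 0%MM = 1.
  rewrite !(coef0X, fcoefD, coef0M) !fX0 E0 expr1n.
  by rewrite addr0 !expr0n /= !mulr0 addr0.
have [G0 G2] := fsqrtP (finv0 H0).
exists ((u + v) * fsqrt (finv H)).
rewrite /= /is_F_Bc -/D; split.
  apply/eqdegB; set G := fsqrt _ in G0 *.
  have -> : (u + v) * G - (u + v) = (u + v) * (G - 1) by ring.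
  apply: (@eqdeg0M _ _ 1 1); apply/eqdeg01; first by rewrite fcoefD !fX0 addr0.
  by rewrite fcoefB G0 fcoef1 eqxx subrr.
rewrite exprMn G2 -DE; move: (finv H) (finvP H0) => K HK.
transitivity ((u ^+ 2 - v ^+ 2) ^+ 2 * (H * K)); last by rewrite HK mulr1.
by rewrite /H; ring.
Qed.

End BcExistence.
Section Buchstaber.
Variables (S : comAlgType rat) (a1 a2 a3 : S).
Local Notation x := (fX S (ord0 : 'I_2)).
Local Notation y := (fX S (ord_max : 'I_2)).

Lemma GbuchP : exists2 L : fps 2 S, L 0%MM = 1 &
  buchstaber (fC 2 a1)%:P (fC 2 a2)%:P (fC 2 a3)%:P 'X x%:P y%:P =
    L%:P * ('X^2 - (Gbuch a1 a2 a3).1%:P * 'X + (Gbuch a1 a2 a3).2%:P).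
Proof.
rewrite /Gbuch; set A1 := fC 2 a1; set A2 := fC 2 a2; set A3 := fC 2 a3.
set b := buchstaber _ _ _ _ _ _.
pose c2 := (1 - A2 * x * y) ^+ 2 - 4%:R * A3 * x * y * (x + y + A1 * x * y).
pose c1 := 2%:R * (x + y) * (1 - A2 * x * y)
  - 4%:R * (x + y + A1 * x * y + A3 * x ^+ 2 * y ^+ 2).
pose c0 := (x + y) ^+ 2 - 4%:R * x * y.
have bE : b = c2%:P * 'X^2 + c1%:P * 'X + c0%:P.
  rewrite /b /buchstaber /c2 /c1 /c0.
  rewrite !(polyCD, polyCN, polyCM, rmorphXn, polyCMn) /= !polyC1; ring.
have b2 : b`_2 = c2 by rewrite bE !coefE /= mulr1 !mulr0 !addr0.
have b1 : b`_1 = c1 by rewrite bE !coefE /= mulr1 !mulr0 addr0 add0r.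
have b0 : b`_0 = c0 by rewrite bE !coefE /= !mulr0 !add0r.
have c20 : c2 0%MM = 1.
  rewrite /c2 !(fcoefD, fcoefN, coef0X, coef0M) !fX0 fcoef1 eqxx.
  by rewrite !(mulr0, mul0r) oppr0 !addr0 expr1n.
exists c2 => //=; rewrite b2 b1 b0 bE.
have K : c2%:P * (finv c2)%:P = 1 by rewrite -polyCM finvP // polyC1.
rewrite polyCN !polyCM mulNr opprK !mulrDr -mulrA (mulrA _ _ (c1%:P * 'X)) K mul1r.
by rewrite (mulrA _ _ c0%:P) K mul1r.
Qed.

End Buchstaber.

(* Main.v *)
Require Import Defs.
From HB Require Import structures.
From mathcomp Require Import all_boot all_order all_algebra.
From mathcomp Require Import boolp classical_sets.
From mathcomp Require Import mpoly.
From mathcomp Require Import ring.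
Require Import Defs.


Set Implicit Arguments.
Unset Strict Implicit.
Unset Printing Implicit Defensive.

Import GRing.Theory Num.Theory.
Local Open Scope ring_scope.

(* Everything rests on one logarithm. The integral I has derivative           *)
(* 1 / sqrt P, and s = (wp - a1/3)^(-1/2) satisfies s'^2 = P(s), so s inverts *)
(* I. The derivation sqrt(Q(u)) d/du - sqrt(Q(v)) d/dv kills the explicit     *)
(* series F_Bc (Euler), and a series that it kills is determined by its       *)
(* restriction to v = 0; hence g_Bc is the logarithm of F_Bc, and the group   *)
(* axioms follow because composition with a logarithm is injective. The       *)
(* squares of F(u, v) and F(u, -v) are the roots of the Buchstaber polynomial *)
(* at (u^2, v^2), and their difference 4 u v + .. is not a zero divisor; so   *)
(* the two-valued group determines F(u, v)^2, which gives the uniqueness of   *)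
(* its logarithm and the universality of F_Bc. For (v), the Taylor            *)
(* coefficients in v at v = 0 of the equation defining the class express      *)
(* lambda_2 and lambda_1 through w(u) = dF/dv(u, 0), and the antidiagonal     *)
(* v = -u then forces a3 = 0; conversely lambda_1 = 1 makes w^2 an even       *)
(* quartic.                                                                   *)
(*                                                                            *)
(* The base ring may have zero divisors, so all cancellations are by series   *)
(* that raise the order of every series by exactly a fixed number (sreg).     *)

(** * Series and substitution *)

(** The series s = (wp - a1/3)^(-1/2) solves s'^2 = P(s) ([fpd_inv_sqrt]), so I(s) has derivative 1;
    this is (i), in [comp_inverse_serI]. Since Q is P with a1 and a3 negated ([serQ_serP]), the same
    fact gives the exponential in (iii), once Euler's argument ([fder2_euler]) has shown that g_Bc
    is the logarithm of the explicit series ([fgl_log_F_Bc]).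

    The two-valued group enters through [F_Bc_roots]: changing v into -v conjugates the denominator
    of F^2, so the sum and product of F(u, v)^2 and F(u, -v)^2 are rational in u^2 and v^2, and they
    come from the Buchstaber polynomial with a1 and a3 negated. Read at (u^2, v^2), this says that
    the law with logarithm I gives the two values in (ii) ([Gbuch_F_Bc], [tv_log_serI]); read at
    (-u^2, -v^2), it computes the modulus square in (iv) ([modulus_square_F_Bc]). Conversely
    [root_uniq] recovers F^2 from the sum and the product, whence [tv_log_uniq] and
    [modulus_square_eq_F_Bc]; the parameters are recovered from the logarithm ([F_Bc_inj]).

    For (v), [calF_den] and [calF_num] solve for lambda_2 and lambda_1, up to the coefficients that
    cancel. [calF_F_Bc] deduces a3 = 0 on the side of F_Bc, and [calF_ochanine] starts from lambda_1
    = 1 and obtains a differential equation for w^2 whose solutions are even quartics. *)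

Section Monomials.
Variables (n : nat) (R : comNzRingType).
Implicit Types f g h : fps n R.

Definition fmon (c : R) (m : 'X_{1..n}) : fps n R := FPS (fun k => c *+ (k == m)).

Lemma fmon0 c : fmon c 0%MM = fC n c. Proof. by []. Qed.

Lemma coef_fC_mul c f m : (fC n c * f) m = c * f m.
Proof.
have lt : (mdeg (0 : 'X_{1..n})%MM < (mdeg m).+1)%N by rewrite mdeg0.
rewrite fcoefM (bigD1 (BMultinom lt)) /=; last first.
  by apply/mnm_lepP => j; rewrite mnm0E.
rewrite eqxx mulr1n subm0 big1 ?addr0 // => l.
by move=> /andP[_]; rewrite bmeqP /= => /negPf ->; rewrite mul0r.
Qed.

Lemma mul_fX_fmon i c m : fX R i * fmon c m = fmon c (U_(i) + m)%MM.
Proof.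
apply: fpsP => k; rewrite coef_fXM /=; case: ifPn => [ki|].
  have le : (U_(i) <= k)%MM by rewrite lep1mP -lt0n.
  congr (_ *+ nat_of_bool _); apply/eqP/eqP => [<-|->].
    by rewrite addmC submK.
  by rewrite addmC addmK.
rewrite -eqn0Ngt => /eqP k0; case: eqP => // E.
by move: k0; rewrite E mnmDE mnm1E eqxx.
Qed.

Lemma eqdeg_sym d f g : eqdeg d f g -> eqdeg d g f.
Proof. by move=> H m /H ->. Qed.

Lemma eqdeg_trans d f g h : eqdeg d f g -> eqdeg d g h -> eqdeg d f h.
Proof. by move=> H K m md; rewrite H // K. Qed.

Lemma eqdeg_eq f g : (forall d, eqdeg d f g) -> f = g.
Proof. by move=> H; apply: fpsP => m; apply: (H (mdeg m).+1). Qed.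

Lemma eqdegD d f g f' g' : eqdeg d f f' -> eqdeg d g g' ->
  eqdeg d (f + g) (f' + g').
Proof. by move=> H K m md; rewrite !fcoefD H ?K. Qed.

Lemma eqdegN d f g : eqdeg d f g -> eqdeg d (- f) (- g).
Proof. by move=> H m md; rewrite !fcoefN H. Qed.

Lemma eqdegM d f g f' g' : eqdeg d f f' -> eqdeg d g g' ->
  eqdeg d (f * g) (f' * g').
Proof.
move=> /eqdegB H /eqdegB K; apply/eqdegB.
have -> : f * g - f' * g' = (f - f') * g + f' * (g - g') by ring.
by apply: eqdeg0D; [apply: eqdeg0Mr | apply: eqdeg0Ml].
Qed.

Definition cut d f : fps n R := FPS (fun m => f m *+ (mdeg m < d)).

Lemma eqdeg_cut d f : eqdeg d f (cut d f).
Proof. by move=> m md; rewrite /= md. Qed.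

Lemma cutE d f : cut d f = \sum_(m : 'X_{1..n < d}) fmon (f m) m.
Proof.
apply: fpsP => m.
have coef_sum (I : Type) (r : seq I) (F : I -> fps n R) :
    (\sum_(i <- r) F i) m = \sum_(i <- r) F i m.
  by elim/big_rec2: _ => //= i x y _ <-.
rewrite coef_sum /=; case: (ltnP (mdeg m) d) => [md|dm].
  rewrite (bigD1 (BMultinom md)) //= eqxx big1 ?addr0 // => k.
  by rewrite bmeqP /= eq_sym => /negPf ->.
rewrite big1 ?mulr0n // => k _; case: eqP => // E.
by have := bmdeg k; rewrite -E ltnNge dm.
Qed.

End Monomials.

Section Density.
Variables (n : nat) (R : comNzRingType).
Implicit Types f g h : fps n R.

(** Both maps are compared on truncations, which are finite sums of monomials. The shift [e] admits
    maps that lose precision, such as derivatives, which lose one degree. *)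
Lemma fmon_ext k e (Phi Psi : fps n R -> fps k R) :
  (forall f g, Phi (f + g) = Phi f + Phi g) ->
  (forall f g, Psi (f + g) = Psi f + Psi g) ->
  (forall d f g, eqdeg (d + e) f g -> eqdeg d (Phi f) (Phi g)) ->
  (forall d f g, eqdeg (d + e) f g -> eqdeg d (Psi f) (Psi g)) ->
  (forall c m, Phi (fmon c m) = Psi (fmon c m)) ->
  Phi =1 Psi.
Proof.
move=> PhiD PsiD Phic Psic H f; apply: eqdeg_eq => d.
have C := @eqdeg_cut _ _ (d + e) f.
apply: eqdeg_trans (Phic _ _ _ C) _; apply: eqdeg_sym.
apply: eqdeg_trans (Psic _ _ _ C) _; rewrite cutE.
suff -> : Psi (\sum_(m : 'X_{1..n < d + e}) fmon (f m) m)
        = Phi (\sum_(m : 'X_{1..n < d + e}) fmon (f m) m) by [].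
have z (T : fps n R -> fps k R) (TD : forall f g, T (f + g) = T f + T g) : T 0 = 0.
  by apply: (addrI (T 0)); rewrite -TD !addr0.
elim: (index_enum _) => [|m r IH]; first by rewrite big_nil !z.
by rewrite big_cons PhiD PsiD IH H.
Qed.

(* A series is determined by its polynomial truncations: additive maps that   *)
(* are continuous for the degree filtration agree as soon as they agree on    *)
(* constants and this propagates along multiplication by a variable.          *)
Lemma fps_ext k e (Phi Psi : fps n R -> fps k R) :
  (forall f g, Phi (f + g) = Phi f + Phi g) ->
  (forall f g, Psi (f + g) = Psi f + Psi g) ->
  (forall d f g, eqdeg (d + e) f g -> eqdeg d (Phi f) (Phi g)) ->
  (forall d f g, eqdeg (d + e) f g -> eqdeg d (Psi f) (Psi g)) ->
  (forall c, Phi (fC n c) = Psi (fC n c)) ->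
  (forall i f, Phi f = Psi f -> Phi (fX R i * f) = Psi (fX R i * f)) ->
  Phi =1 Psi.
Proof.
move=> PhiD PsiD Phic Psic HC HX; apply: (fmon_ext (e := e)) => // c m.
elim: {m}(mdeg m) {-2}m (leqnn (mdeg m)) => [|d IH] m.
  by rewrite leqn0 mdeg_eq0 => /eqP ->; rewrite fmon0 HC.
case: (eqVneq m 0%MM) => [->|]; first by rewrite fmon0 HC.
move=> m0 md; have [i mi] : exists i, (0 < m i)%N.
  case: (pickP (fun i => 0 < m i)%N) => [i|no]; first by exists i.
  case/eqP: m0; apply/mnmP => i; rewrite mnm0E.
  by have := no i; rewrite lt0n => /negbFE /eqP.
have le : (U_(i) <= m)%MM by rewrite lep1mP -lt0n.
rewrite -(submK le) addmC -mul_fX_fmon; apply/HX/IH.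
by move: md; rewrite -{1}(submK le) mdegD mdeg1 addn1.
Qed.

End Density.

(** * Substitution as a ring morphism *)

Section Substitution.
Variables (R : comNzRingType) (n k : nat) (g : 'I_n -> fps k R).
Implicit Types f h : fps n R.

Lemma fsubstE f m : fsubst f g m =
  \sum_(d : 'X_{1..n < (mdeg m).+1}) f d * (\prod_(i < n) g i ^+ d i) m.
Proof. by []. Qed.

Lemma fsubstD f h : fsubst (f + h) g = fsubst f g + fsubst h g.
Proof.
apply: fpsP => m; rewrite fcoefD /= -big_split /=.
by apply: eq_bigr => d _; rewrite mulrDl.
Qed.

Lemma fsubst0 : fsubst 0 g = 0.
Proof. by apply: (addrI (fsubst 0 g)); rewrite -fsubstD !addr0. Qed.

Lemma fsubstN f : fsubst (- f) g = - fsubst f g.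
Proof. by apply: (addrI (fsubst f g)); rewrite -fsubstD !subrr fsubst0. Qed.

Lemma eqdeg_fsubst d f h : eqdeg d f h -> eqdeg d (fsubst f g) (fsubst h g).
Proof.
move=> fh m md; apply: eq_bigr => l _; rewrite fh //.
exact: leq_trans (bmdeg l) md.
Qed.

Hypothesis g0 : forall i, g i 0%MM = 0.

Lemma eqdeg0X (p : fps k R) d e : eqdeg d p 0 -> eqdeg (e * d) (p ^+ e) 0.
Proof.
move=> p0; elim: e => [|e IH]; first by move=> m; rewrite mul0n ltn0.
by rewrite mulSn exprS; apply: eqdeg0M.
Qed.

(** This justifies the finite sum in [fsubst]: monomials of degree above [mdeg m] cannot reach the
    coefficient [m]. *)
Lemma eqdeg_prodX (l : 'X_{1..n}) : eqdeg (mdeg l) (\prod_i g i ^+ l i) 0.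
Proof.
rewrite mdegE; elim/big_ind2: _ => [m|d p e q|i _].
- by rewrite ltn0.
- exact: eqdeg0M.
- by have /eqdeg01 /(@eqdeg0X _ 1 (l i)) := g0 i; rewrite muln1.
Qed.

Lemma fsubst_fmon c (l : 'X_{1..n}) :
  fsubst (fmon c l) g = fC k c * \prod_i g i ^+ l i.
Proof.
apply: fpsP => m; rewrite coef_fC_mul /=.
case: (ltnP (mdeg l) (mdeg m).+1) => [lm|ml].
  rewrite (bigD1 (BMultinom lm)) //= eqxx mulr1n [X in _ + X]big1 ?addr0 // => d.
  by rewrite bmeqP /= => /negPf ->; rewrite mul0r.
rewrite (eqdeg_prodX ml) mulr0 big1 // => d _.
case: eqP => E; last by rewrite mul0r.
by have := bmdeg d; rewrite E ltnNge ml.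
Qed.


Lemma fsubstC c : fsubst (fC n c) g = fC k c.
Proof.
rewrite -fmon0 fsubst_fmon big1 ?mulr1 // => i _.
by rewrite mnm0E expr0.
Qed.

Lemma fsubst1 : fsubst 1 g = 1.
Proof. exact: fsubstC. Qed.

Lemma fsubst_fXM i f : fsubst (fX R i * f) g = g i * fsubst f g.
Proof.
pose Phi h := fsubst (fX R i * h) g; pose Psi h := g i * fsubst h g.
rewrite -[LHS]/(Phi f) -[RHS]/(Psi f).
apply: (fmon_ext (e := 0)) => [f' h|f' h|d f' h|d f' h|c m]; rewrite /Phi /Psi.
- by rewrite mulrDr fsubstD.
- by rewrite fsubstD mulrDr.
- rewrite addn0 => E; apply: eqdeg_fsubst; exact: eqdegM.
- rewrite addn0 => E; apply: eqdegM => //; exact: eqdeg_fsubst.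
rewrite mul_fX_fmon !fsubst_fmon mulrCA (bigD1 i) //= [in RHS](bigD1 i) //=.
rewrite mnmDE mnm1E eqxx add1n exprS -!mulrA; do 3 congr (_ * _).
by apply: eq_bigr => j ji; rewrite mnmDE mnm1E eq_sym (negPf ji).
Qed.

Lemma fsubstX i : fsubst (fX R i) g = g i.
Proof. by rewrite -[fX R i]mulr1 fsubst_fXM fsubst1 mulr1. Qed.

Lemma fsubstM f h : fsubst (f * h) g = fsubst f g * fsubst h g.
Proof.
pose Phi f := fsubst (f * h) g; pose Psi f := fsubst f g * fsubst h g.
rewrite -[LHS]/(Phi f) -[RHS]/(Psi f).
apply: (fps_ext (e := 0)) => [f' h'|f' h'|d f' h'|d f' h'|c|i f'];
  rewrite /Phi /Psi.
- by rewrite mulrDl fsubstD.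
- by rewrite fsubstD mulrDl.
- by rewrite addn0 => E; apply: eqdeg_fsubst; apply: eqdegM.
- by rewrite addn0 => E; apply: eqdegM => //; apply: eqdeg_fsubst.
- rewrite fsubstC; apply: fpsP => m; rewrite coef_fC_mul !fsubstE mulr_sumr.
  by apply: eq_bigr => d _; rewrite coef_fC_mul mulrA.
- by move=> E; rewrite -mulrA !fsubst_fXM E mulrA.
Qed.

Lemma fsubstXn f e : fsubst (f ^+ e) g = fsubst f g ^+ e.
Proof. by elim: e => [|e IH]; rewrite ?fsubst1 // !exprS fsubstM IH. Qed.

Lemma fsubst_nat e : fsubst e%:R g = e%:R.
Proof. by elim: e => [|e IH]; rewrite ?fsubst0 // !mulrS fsubstD IH fsubst1. Qed.

Lemma fsubst_at0 f : fsubst f g 0%MM = f 0%MM.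
Proof.
have lt : (mdeg (0 : 'X_{1..n})%MM < (mdeg (0 : 'X_{1..k})%MM).+1)%N by rewrite !mdeg0.
have E : \prod_i g i ^+ (0 : 'X_{1..n})%MM i = 1.
  by rewrite big1 // => i _; rewrite mnm0E expr0.
rewrite fsubstE (bigD1 (BMultinom lt)) //= E fcoef1 eqxx mulr1.
rewrite [X in _ + X]big1 ?addr0 // => d.
rewrite bmeqP /= -mdeg_eq0 => d0; have := bmdeg d.
by rewrite {2}mdeg0 ltnS leqn0 (negPf d0).
Qed.

End Substitution.

Lemma eq_fsubst (R : comNzRingType) n k (f : fps n R) (g h : 'I_n -> fps k R) :
  g =1 h -> fsubst f g = fsubst f h.
Proof.
move=> gh; apply: fpsP => m /=; apply: eq_bigr => d _.
by congr (_ * fcoef _ _); apply: eq_bigr => i _; rewrite gh.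
Qed.

Lemma fsubst_fsubst (R : comNzRingType) n k l (f : fps n R)
    (g : 'I_n -> fps k R) (h : 'I_k -> fps l R) :
    (forall i, g i 0%MM = 0) -> (forall i, h i 0%MM = 0) ->
  fsubst (fsubst f g) h = fsubst f (fun i => fsubst (g i) h).
Proof.
move=> g0 h0; have gh0 i : fsubst (g i) h 0%MM = 0 by rewrite fsubst_at0 ?g0.
pose Phi f := fsubst (fsubst f g) h.
rewrite -[LHS]/(Phi f); move: f.
apply: (fps_ext (e := 0)) => [f' h'|f' h'|d f' h'|d f' h'|c|i f'];
  rewrite /Phi ?addn0.
- by rewrite !fsubstD.
- by rewrite !fsubstD.
- by move=> E; do 2!apply: eqdeg_fsubst.
- exact: eqdeg_fsubst.
- by rewrite !fsubstC.
- by move=> E; rewrite fsubst_fXM // fsubstM // E -fsubst_fXM.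
Qed.

Lemma fsubst_id (R : comNzRingType) n (f : fps n R) : fsubst f (fX R) = f.
Proof.
have X0 i : fX R i 0%MM = 0 by rewrite /= eq_sym mnm1_eq0.
move: f; apply: (fps_ext (e := 0)) => [f' h'|//|d f' h'|d f' h'|c|i f'];
  rewrite ?addn0 //.
- exact: fsubstD.
- exact: eqdeg_fsubst.
- exact: fsubstC.
- by move=> E; rewrite fsubst_fXM ?E.
Qed.

(** * Formal partial derivatives and the chain rule *)

Section PartialDerivative.
Variables (R : comNzRingType) (n : nat).
Implicit Types f h : fps n R.

Definition fpd (i : 'I_n) f : fps n R :=
  FPS (fun m => f (U_(i) + m)%MM *+ (m i).+1).

Lemma fpdE i f m : fpd i f m = f (U_(i) + m)%MM *+ (m i).+1.
Proof. by []. Qed.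

Lemma fpdD i f h : fpd i (f + h) = fpd i f + fpd i h.
Proof. by apply: fpsP => m; rewrite /= -mulrnDl. Qed.

Lemma fpd0 i : fpd i 0 = 0.
Proof. by apply: (addrI (fpd i 0)); rewrite -fpdD !addr0. Qed.

Lemma fpdN i f : fpd i (- f) = - fpd i f.
Proof. by apply: (addrI (fpd i f)); rewrite -fpdD !subrr fpd0. Qed.

Lemma fpdB i f h : fpd i (f - h) = fpd i f - fpd i h.
Proof. by rewrite fpdD fpdN. Qed.

Lemma eqdeg_fpd i d f h : eqdeg d.+1 f h -> eqdeg d (fpd i f) (fpd i h).
Proof. by move=> E m md; rewrite /= E // mdegD mdeg1. Qed.

Lemma fpdC i c : fpd i (fC n c) = 0.
Proof.
apply: fpsP => m /=; case: eqP => [/(congr1 (fun m : 'X_{1..n} => m i))|_].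
  by rewrite mnmDE mnm1E eqxx mnm0E.
by rewrite mulr0n mul0rn.
Qed.

Lemma fpd1 i : fpd i 1 = 0. Proof. exact: fpdC. Qed.

Lemma fpd_fXM i j f : fpd i (fX R j * f) = (i == j)%:R * f + fX R j * fpd i f.
Proof.
apply: fpsP => m; rewrite fcoefD mulr_natl.
rewrite fpdE !coef_fXM fpdE mnmDE mnm1E.
have fn (e : bool) : (f *+ e) m = f m *+ e by case: e.
rewrite fn; case: eqP => [<-|ij] /=.
  rewrite ?add1n /= addmC addmK; case: ifPn => [mi|].
    have le : (U_(i) <= m)%MM by rewrite lep1mP -lt0n.
    by rewrite addmC submK // mnmBE mnm1E eqxx subn1 prednK // mulrS.
  by rewrite -eqn0Ngt => /eqP ->; rewrite addr0.
rewrite add0n mulr0n add0r; case: ifPn => [mj|_]; last by rewrite mul0rn.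
have le : (U_(j) <= m)%MM by rewrite lep1mP -lt0n.
rewrite addmBA // mnmBE mnm1E (_ : (j == i) = false) ?subn0 //.
by apply/eqP => ji; apply: ij.
Qed.

Lemma fpdX i j : fpd i (fX R j) = (i == j)%:R.
Proof. by rewrite -[fX R j]mulr1 fpd_fXM fpd1 mulr0 addr0 mulr1. Qed.

Lemma fpdM i f h : fpd i (f * h) = fpd i f * h + f * fpd i h.
Proof.
pose Phi f := fpd i (f * h); pose Psi f := fpd i f * h + f * fpd i h.
rewrite -[LHS]/(Phi f) -[RHS]/(Psi f).
(* A derivative modulo degree d needs its argument modulo degree d + 1. *)
apply: (fps_ext (e := 1)) => [f' h'|f' h'|d f' h'|d f' h'|c|j f'];
  rewrite /Phi /Psi.
- by rewrite mulrDl fpdD.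
- by rewrite fpdD; ring.
- by rewrite addn1 => E; apply: eqdeg_fpd; apply: eqdegM.
- rewrite addn1 => E; apply: eqdegD; apply: eqdegM => //.
    exact: eqdeg_fpd.
  by apply: eqdegW E.
- rewrite fpdC mul0r add0r; apply: fpsP => m.
  by rewrite coef_fC_mul !fpdE coef_fC_mul mulrnAr.
- by move=> E; rewrite -mulrA !fpd_fXM E; ring.
Qed.

Lemma fpdXn i f e : fpd i (f ^+ e.+1) = e.+1%:R * f ^+ e * fpd i f.
Proof.
elim: e => [|e IH]; first by rewrite expr1 expr0 !mul1r.
by rewrite exprS fpdM IH [e.+2%:R]mulrS !exprS; ring.
Qed.

Lemma fpd_nat i e : fpd i e%:R = 0.
Proof. by elim: e => [|e IH]; rewrite ?fpd0 // mulrS fpdD IH fpd1 addr0. Qed.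

End PartialDerivative.

Lemma fpd_fsubst (R : comNzRingType) n k (j : 'I_k) (f : fps n R)
    (g : 'I_n -> fps k R) : (forall i, g i 0%MM = 0) ->
  fpd j (fsubst f g) = \sum_i fsubst (fpd i f) g * fpd j (g i).
Proof.
move=> g0; pose Phi f := fpd j (fsubst f g).
rewrite -[LHS]/(Phi f); move: f.
apply: (fps_ext (e := 1)) => [f' h'|f' h'|d f' h'|d f' h'|c|i f'];
  rewrite /Phi.
- by rewrite fsubstD fpdD.
- by rewrite -big_split /=; apply: eq_bigr => i _; rewrite fpdD fsubstD mulrDl.
- by rewrite addn1 => E; apply: eqdeg_fpd; apply: eqdeg_fsubst.
- rewrite addn1 => E; elim/big_ind2: _ => // [*|i _]; first exact: eqdegD.
  by apply: eqdegM => //; apply: eqdeg_fsubst; apply: eqdeg_fpd.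
- rewrite fsubstC // fpdC big1 // => i _.
  by rewrite fpdC fsubst0 mul0r.
move=> E; rewrite fsubst_fXM // fpdM E.
under [RHS]eq_bigr => l _ do
  rewrite fpd_fXM fsubstD !fsubstM // fsubst_nat // fsubstX // mulrDl.
rewrite big_split /= [X in _ = X + _](bigD1 i) //= eqxx mul1r.
rewrite [X in _ = _ + X + _]big1 ?addr0 => [|l li]; last by rewrite (negPf li) !mul0r.
rewrite [fpd j _ * _]mulrC mulr_sumr; congr (_ + _).
by apply: eq_bigr => l _; rewrite mulrA.
Qed.

Section OneTwoVariables.
Variable S : comNzRingType.

Lemma coef_fX0 n (i : 'I_n) : fX S i 0%MM = 0.
Proof. by rewrite /= eq_sym mnm1_eq0. Qed.

Section Fcomp.
Variables (k : nat) (g : fps k S).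
Implicit Types f h : fps 1 S.

Lemma fcompD f h : fcomp (f + h) g = fcomp f g + fcomp h g.
Proof. exact: fsubstD. Qed.

Lemma fcompN f : fcomp (- f) g = - fcomp f g.
Proof. exact: fsubstN. Qed.

Hypothesis g0 : g 0%MM = 0.

Lemma fcompM f h : fcomp (f * h) g = fcomp f g * fcomp h g.
Proof. exact: fsubstM. Qed.

Lemma fcompXn f e : fcomp (f ^+ e) g = fcomp f g ^+ e.
Proof. exact: fsubstXn. Qed.

Lemma fcompC c : fcomp (fC 1 c) g = fC k c.
Proof. exact: fsubstC. Qed.

Lemma fcomp1 : fcomp 1 g = 1 :> fps k S. Proof. exact: fsubst1. Qed.

Lemma fcomp_nat e : fcomp e%:R g = e%:R :> fps k S. Proof. exact: fsubst_nat. Qed.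

Lemma fcompX i : fcomp (fX S i) g = g.
Proof. exact: fsubstX. Qed.

Lemma fcomp_at0 f : fcomp f g 0%MM = f 0%MM.
Proof. exact: fsubst_at0. Qed.

Lemma fpd_fcomp j f : fpd j (fcomp f g) = fcomp (fpd ord0 f) g * fpd j g.
Proof. by rewrite /fcomp fpd_fsubst // big_ord1. Qed.

Lemma fsubst_fcomp l f (h : 'I_k -> fps l S) : (forall i, h i 0%MM = 0) ->
  fsubst (fcomp f g) h = fcomp f (fsubst g h).
Proof. by move=> h0; rewrite /fcomp fsubst_fsubst. Qed.

Definition fcompE := (fcompD, fcompN, fcompXn, fcompM, fcomp1, fcompC,
  fcomp_nat, fcompX).

End Fcomp.

Lemma fcomp_id (f : fps 1 S) : fcomp f (fX S ord0) = f.
Proof.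
by rewrite -[RHS]fsubst_id; apply: eq_fsubst => i; rewrite (ord1 i).
Qed.

Section Fsubst2.
Variables (k : nat) (g h : fps k S).
Implicit Types F G : fps 2 S.

Let gh := (fun i : 'I_2 => [:: g; h]`_i).

Lemma fsubst2D F G : fsubst2 (F + G) g h = fsubst2 F g h + fsubst2 G g h.
Proof. exact: fsubstD. Qed.

Lemma fsubst2N F : fsubst2 (- F) g h = - fsubst2 F g h.
Proof. exact: fsubstN. Qed.

Hypotheses (g0 : g 0%MM = 0) (h0 : h 0%MM = 0).

Lemma fsubst2_arg0 (i : 'I_2) : [:: g; h]`_i 0%MM = 0.
Proof. by case: i => [[|[|]]]. Qed.

Let H0 := fsubst2_arg0.

Lemma fsubst2M F G : fsubst2 (F * G) g h = fsubst2 F g h * fsubst2 G g h.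
Proof. exact: fsubstM. Qed.

Lemma fsubst2Xn F e : fsubst2 (F ^+ e) g h = fsubst2 F g h ^+ e.
Proof. exact: fsubstXn. Qed.

Lemma fsubst2C c : fsubst2 (fC 2 c) g h = fC k c.
Proof. exact: fsubstC. Qed.

Lemma fsubst21 : fsubst2 1 g h = 1 :> fps k S. Proof. exact: fsubst1. Qed.

Lemma fsubst2_nat e : fsubst2 e%:R g h = e%:R :> fps k S.
Proof. exact: fsubst_nat. Qed.

Lemma fsubst2X0 : fsubst2 (fX S ord0) g h = g. Proof. exact: fsubstX. Qed.

Lemma fsubst2X1 : fsubst2 (fX S ord_max) g h = h. Proof. exact: fsubstX. Qed.

Lemma fsubst2_at0 F : fsubst2 F g h 0%MM = F 0%MM.
Proof. exact: fsubst_at0. Qed.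

Lemma fsubst2_fcomp (f : fps 1 S) G : G 0%MM = 0 ->
  fsubst2 (fcomp f G) g h = fcomp f (fsubst2 G g h).
Proof. by move=> G0; rewrite /fsubst2 fsubst_fcomp. Qed.

Lemma fpd_fsubst2 j F : fpd j (fsubst2 F g h) =
  fsubst2 (fpd ord0 F) g h * fpd j g + fsubst2 (fpd ord_max F) g h * fpd j h.
Proof.
rewrite /fsubst2 fpd_fsubst // !big_ord_recl big_ord0 addr0 /=.
by rewrite (_ : lift ord0 ord0 = ord_max :> 'I_2) //; apply: val_inj.
Qed.

Lemma fsubst_fsubst2 l F (p : 'I_k -> fps l S) : (forall i, p i 0%MM = 0) ->
  fsubst (fsubst2 F g h) p = fsubst2 F (fsubst g p) (fsubst h p).
Proof.
move=> p0; rewrite /fsubst2 fsubst_fsubst //.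
by apply: eq_fsubst => -[[|[|]]].
Qed.

Definition fsubst2E := (fsubst2D, fsubst2N, fsubst2Xn, fsubst2M, fsubst21,
  fsubst2C, fsubst2_nat, fsubst2X0, fsubst2X1).

End Fsubst2.

Lemma fsubst2_id (F : fps 2 S) : fsubst2 F (fX S ord0) (fX S ord_max) = F.
Proof.
rewrite -[RHS]fsubst_id; apply: eq_fsubst => -[[|[|]]] //= p; congr fX; exact: val_inj.
Qed.

End OneTwoVariables.

Definition fpd_rules := (fpdD, fpdN, fpdXn, fpdM, fpdX, fpd1, fpdC, fpd_nat).

(* h is a strict non zero divisor of order k: the lowest form of h f is at    *)
(* degree k + (the order of f).                                               *)
Section Regular.
Variables (R : comNzRingType) (n : nat).
Implicit Types f g h : fps n R.

Definition sreg k h := forall d f, eqdeg (k + d) (h * f) 0 -> eqdeg d f 0.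

Lemma sregM k l h h' : sreg k h -> sreg l h' -> sreg (k + l) (h * h').
Proof.
move=> H H' d f hf; apply/H'/H.
by rewrite addnA mulrA.
Qed.

Lemma sregX k h e : sreg k h -> sreg (e * k) (h ^+ e).
Proof.
move=> H; elim: e => [|e IH]; first by move=> d f; rewrite mul1r.
by rewrite exprS mulSn; apply: sregM.
Qed.

(** Only the form of degree k matters. If f vanishes below degree d, then (h' - h) f vanishes below
    k + 1 + d, so h f does as soon as h' f does, and d can be increased. *)
Lemma sreg_eqdeg k h h' : sreg k h -> eqdeg k.+1 h' h -> sreg k h'.
Proof.
move=> H /eqdegB hh d; elim: d => [f _ m|d IH f hf]; first by rewrite ltn0.
have fd : eqdeg d f 0 by apply: IH; apply: eqdegW hf; rewrite leq_add2l.
apply: H; have -> : h * f = h' * f - (h' - h) * f by ring.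
apply: eqdeg0D => //; apply: eqdeg0N; rewrite addnS -addSn; exact: eqdeg0M.
Qed.

Lemma sreg_eq0 k h f : sreg k h -> h * f = 0 -> f = 0.
Proof. by move=> H hf; apply: eqdeg_eq => d; apply: H; rewrite hf. Qed.

Lemma sreg_mulI k h f g : sreg k h -> h * f = h * g -> f = g.
Proof.
move=> H hfg; apply/eqP; rewrite -subr_eq0; apply/eqP.
by apply: (sreg_eq0 H); rewrite mulrBr hfg subrr.
Qed.

Lemma sreg_fX i : sreg 1 (fX R i).
Proof.
move=> d f H m md; have := H (U_(i) + m)%MM.
rewrite mdegD mdeg1 ltn_add2l => /(_ md).
by rewrite coef_fXM mnmDE mnm1E eqxx addmC addmK.
Qed.

(** The coefficient of the product at [U_(i) + m] is f at m plus c times f at a monomial of the same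
    degree with a smaller exponent of [j]; hence the induction on that exponent. *)
Lemma sreg_fX_lin i j c : i != j -> sreg 1 (fX R i + fC n c * fX R j).
Proof.
move=> ij d f H m; elim: {m}(m j) {-2}m (leqnn (m j)) => [|e IH] m mj md;
  have := H (U_(i) + m)%MM; rewrite mdegD mdeg1 ltn_add2l => /(_ md);
  rewrite mulrDl fcoefD -mulrA coef_fC_mul !coef_fXM !mnmDE !mnm1E eqxx;
  rewrite (negPf ij) add0n [(U_(i) + m)%MM]addmC addmK.
  by move: mj; rewrite leqn0 => /eqP ->; rewrite mulr0 addr0.
case: ifPn => [m0|_]; last by rewrite mulr0 addr0.
have le : (U_(j) <= m)%MM by rewrite lep1mP -lt0n.
rewrite addmC -addmBA // (IH (U_(i) + (m - U_(j)))%MM) ?mulr0 ?addr0 //.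
  by rewrite mnmDE mnmBE !mnm1E eqxx (negPf ij) add0n leq_subLR add1n.
by rewrite mdegD mdeg1 -(mdeg1 j) addnC -mdegD submK.
Qed.

End Regular.

(** * Rational coefficients: square roots, primitives, vanishing of derivatives *)

Section RatAlgebra.
Variable S : comAlgType rat.

Lemma mulrn_ratalg_eq0 (x : S) e : x *+ e.+1 = 0 -> x = 0.
Proof.
move=> x0; rewrite -[x]scale1r -(@mulVf _ (e.+1%:R : rat)) ?pnatr_eq0 //.
by rewrite -scalerA scaler_nat x0 scaler0.
Qed.

Section AnyVariables.
Variable n : nat.
Implicit Types f g h : fps n S.

Lemma sreg_nat e : sreg 0 (e.+1%:R : fps n S).
Proof.
move=> d f H m md; apply: (@mulrn_ratalg_eq0 _ e).
have <- : (e.+1%:R * f) m = f m *+ e.+1; last by rewrite H.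
have fn i : (f *+ i) m = f m *+ i.
  by elim: i => [|i IH]; rewrite ?mulr0n // !mulrS fcoefD IH.
by rewrite mulr_natl fn.
Qed.

Lemma sreg_natM e k h : sreg k h -> sreg k (e.+1%:R * h).
Proof. by move=> H; rewrite -[k]add0n; apply: sregM => //; exact: (@sreg_nat e). Qed.

Lemma sreg_unit f : f 0%MM = 1 -> sreg 0 f.
Proof.
move=> f1; apply: (sreg_eqdeg (@sreg_nat 0)) => m.
by rewrite ltnS leqn0 mdeg_eq0 => /eqP ->; rewrite fcoef1 eqxx.
Qed.

(* f and g have the same leading form l, so f + g has leading form 2 l.       *)
Lemma sqr_inj k (l f g : fps n S) : sreg k l ->
  eqdeg k.+1 f l -> eqdeg k.+1 g l -> f ^+ 2 = g ^+ 2 -> f = g.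
Proof.
move=> ll fl gl fg; have H : sreg k (f + g).
  apply: (sreg_eqdeg (@sreg_natM 1 _ _ ll)).
  by rewrite [2%:R * l]mulr_natl mulr2n; apply: eqdegD.
apply/eqP; rewrite -subr_eq0; apply/eqP; apply: (sreg_eq0 H).
have -> : (f + g) * (f - g) = f ^+ 2 - g ^+ 2 by ring.
by rewrite fg subrr.
Qed.

Lemma eqdeg1_at0 f c : f 0%MM = c -> eqdeg 1 f (fC n c).
Proof. by move=> fc m; rewrite ltnS leqn0 mdeg_eq0 => /eqP -> /=; rewrite eqxx. Qed.

Lemma fsqrt_uniq f g : g 0%MM = 1 -> g ^+ 2 = f -> fsqrt f = g.
Proof.
move=> g1 gf; have f1 : f 0%MM = 1 by rewrite -gf Defs.coef0X g1 expr1n.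
have [h1 hf] := fsqrtP f1; apply: (@sqr_inj 0 1); rewrite ?hf ?gf //.
- by apply: sreg_unit; rewrite fcoef1 eqxx.
- exact: eqdeg1_at0.
- exact: eqdeg1_at0.
Qed.

Lemma fpd_inj f g : (forall i, fpd i f = fpd i g) -> f 0%MM = g 0%MM -> f = g.
Proof.
move=> fg f0; apply: fpsP => m.
case: (pickP (fun i => 0 < m i)%N) => [i mi|no]; last first.
  suff -> : m = 0%MM by [].
  by apply/mnmP => i; rewrite mnm0E; have := no i; rewrite lt0n => /negbFE /eqP.
have le : (U_(i) <= m)%MM by rewrite lep1mP -lt0n.
have := congr1 (fun h : fps n S => h (m - U_(i))%MM) (fg i).
rewrite !fpdE addmC submK // => /eqP; rewrite -subr_eq0 -mulrnBl => /eqP.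
by move/mulrn_ratalg_eq0/eqP; rewrite subr_eq0 => /eqP.
Qed.

End AnyVariables.

Implicit Types f g : fps 1 S.

Lemma fderivE f : fderiv f = fpd ord0 f.
Proof.
apply: fpsP => m; rewrite fpdE /=; congr (f _ *+ _).
by rewrite [in RHS](monE m) /mon mulmS.
Qed.

Lemma fpd_fint f : fpd ord0 (fint f) = f.
Proof.
apply: fpsP => m; rewrite fpdE /= mnmDE mnm1E /= add0n.
by rewrite -scaler_nat scalerA divff ?pnatr_eq0 // scale1r -monE.
Qed.

Lemma fint_at0 f : fint f 0%MM = 0.
Proof. by rewrite /= mnm0E. Qed.

Lemma fint_uniq f g : g 0%MM = 0 -> fpd ord0 g = f -> g = fint f.
Proof.
move=> g0 gf; apply: fpd_inj; last by rewrite fint_at0.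
by move=> i; rewrite (ord1 i) fpd_fint.
Qed.

Lemma eqdeg2_fint f : f 0%MM = 1 -> eqdeg 2 (fint f) (fX S ord0).
Proof.
move=> f1 m; rewrite mdeg_ord0 /=.
case E : (m ord0) => [|[|]] // _; rewrite (monE m) E /mon.
  by rewrite mulm0n eq_sym mnm1_eq0.
by rewrite mulm0n f1 invr1 scale1r mulm1n eqxx.
Qed.

End RatAlgebra.

Section Inverse.
Variables (R : comNzRingType) (n : nat).
Implicit Types f g : fps n R.

Lemma finv_uniq f g : f * g = 1 -> Defs.finv f = g.
Proof.
move=> fg; rewrite -[Defs.finv f]mulr1 -fg mulrA [Defs.finv f * f]mulrC.
suff -> : f * Defs.finv f = 1 by rewrite mul1r.
by apply: (@xgetPex _ 0 [set h : fps n R | f * h = 1]); exists g.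
Qed.

End Inverse.

Lemma fcomp_finv (R : comNzRingType) k (f : fps 1 R) (g : fps k R) :
  g 0%MM = 0 -> f 0%MM = 1 -> fcomp (Defs.finv f) g = Defs.finv (fcomp f g).
Proof.
move=> g0 f1; symmetry; apply: finv_uniq.
by rewrite -fcompM // finvP // fcomp1.
Qed.

Lemma fcomp_fsqrt (S : comAlgType rat) k (f : fps 1 S) (g : fps k S) :
  g 0%MM = 0 -> f 0%MM = 1 -> fcomp (fsqrt f) g = fsqrt (fcomp f g).
Proof.
move=> g0 f1; have [q1 q2] := fsqrtP f1; symmetry; apply: fsqrt_uniq.
  by rewrite fcomp_at0.
by rewrite -fcompXn // q2.
Qed.

(** * Cancelling a series tangent to the identity *)

Section Composition.
Variables (R : comNzRingType).

(** For i >= 2, a^i - b^i is a - b times a sum without constant term, so composing with a series of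
    order at least 2 gains one degree of agreement. *)
Lemma eqdeg_fcomp_lead k d (h : fps 1 R) (a b : fps k R) :
    a 0%MM = 0 -> b 0%MM = 0 -> eqdeg 2 h 0 -> eqdeg d a b ->
  eqdeg d.+1 (fcomp h a) (fcomp h b).
Proof.
move=> a0 b0 h2 ab m md.
have H i : eqdeg d.+1 (a ^+ i.+2) (b ^+ i.+2).
  apply/eqdegB; rewrite subrXX -addn1; apply: eqdeg0M; first exact/eqdegB.
  elim/big_ind: _ => // [x y|j _]; first exact: eqdeg0D.
  case: j => [[|j] jl] /=; first by rewrite ?subn1 ?subn0 /= expr0 mulr1 exprS; apply/eqdeg0Mr/eqdeg01.
  by rewrite [b ^+ _]exprS; apply/eqdeg0Ml/eqdeg0Mr/eqdeg01.
rewrite /fcomp !fsubstE; apply: eq_bigr => e _; rewrite !big_ord1.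
case: (ltnP (mdeg e) 2) => [lt|]; first by rewrite h2 // !mul0r.
by rewrite mdeg_ord0; case: (bmnm e ord0 : nat) => [|[|i]] // _; rewrite H.
Qed.

(** If a and b agree modulo degree d, then a - b is determined one degree further by g(a) - g(b) =
    0, the higher terms of g agreeing already. *)
Lemma fcomp_inj k (g : fps 1 R) (a b : fps k R) :
    eqdeg 2 g (fX R ord0) -> a 0%MM = 0 -> b 0%MM = 0 ->
  fcomp g a = fcomp g b -> a = b.
Proof.
move=> g2 a0 b0 gab; apply: eqdeg_eq; elim=> [|d IH]; first by move=> m.
have /eqdegB := eqdeg_fcomp_lead a0 b0 (proj2 (eqdegB _ _ _) g2) IH.
rewrite !(fcompD, fcompN) !fcompX // gab => H; apply/eqdegB.
have -> : a - b = - (fcomp g b - a - (fcomp g b - b)) by ring.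
exact: eqdeg0N.
Qed.

Lemma eqdeg_fcompX k (g : fps 1 R) (a : fps k R) d :
  a 0%MM = 0 -> eqdeg d g (fX R ord0) -> eqdeg d (fcomp g a) a.
Proof.
move=> a0 gd; rewrite -[X in eqdeg _ _ X](fcompX a0 ord0).
exact: eqdeg_fsubst.
Qed.

(** A right inverse suffices: g(s(g)) = g, and g on the left can be cancelled. *)
Lemma comp_inverseP (g s : fps 1 R) : g 0%MM = 0 -> s 0%MM = 0 ->
  eqdeg 2 g (fX R ord0) -> fcomp g s = fX R ord0 -> comp_inverse g s.
Proof.
move=> g0 s0 g2 gs; split=> //.
apply: (fcomp_inj g2); rewrite ?coef_fX0 ?fcomp_at0 //.
by rewrite -[LHS](@fsubst_fcomp _ _ _ s0 _ g) // -[fsubst _ _]/(fcomp _ g) gs fcompX // fcomp_id.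
Qed.

End Composition.

Section DivX.
Variable R : comNzRingType.
Implicit Types f : fps 1 R.

Lemma fC0 n : fC n (0 : R) = 0.
Proof. by apply: fpsP => m; rewrite /= mul0rn. Qed.

Lemma fps1_divX f : exists h, f = fC 1 (f 0%MM) + fX R ord0 * h.
Proof.
exists (FPS (fun m => f (U_(ord0) + m)%MM)); apply: fpsP => m.
rewrite fcoefD coef_fXM /= -mdeg_eq0 mdeg_ord0; case: ifPn => [m0|].
  by rewrite addmC submK ?lep1mP -?lt0n // (gtn_eqF m0) add0r.
rewrite -eqn0Ngt => /eqP m0; rewrite m0 eqxx addr0; congr (f _).
by rewrite (monE m) m0 /mon mulm0n.
Qed.

Lemma fcomp_0 k f : fcomp f 0 = fC k (f 0%MM).
Proof.
have [h {1}->] := fps1_divX f; rewrite fcompD fcompC //.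
by rewrite fcompM // fcompX // mul0r addr0.
Qed.

Lemma eqdeg_divX d f : eqdeg d.+1 f 0 -> exists2 h, f = fX R ord0 * h & eqdeg d h 0.
Proof.
move=> f0; have [h] := fps1_divX f; rewrite f0 ?mdeg0 // fC0 add0r => Ef.
by exists h => //; apply: (@sreg_fX _ _ ord0); rewrite -Ef add1n.
Qed.

End DivX.

(** * Change of coefficients *)

Section Fmap.
Variables (R T : comNzRingType) (phi : {rmorphism R -> T}).

Section Any.
Variable n : nat.
Implicit Types f g : fps n R.

Lemma fmapD f g : fmap phi (f + g) = fmap phi f + fmap phi g.
Proof. by apply: fpsP => m; rewrite /= rmorphD. Qed.

Lemma fmapN f : fmap phi (- f) = - fmap phi f.
Proof. by apply: fpsP => m; rewrite /= rmorphN. Qed.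

Lemma fmapM f g : fmap phi (f * g) = fmap phi f * fmap phi g.
Proof.
apply: fpsP => m; rewrite fcoefM -[LHS]/(phi ((f * g) m)) fcoefM rmorph_sum.
by apply: eq_bigr => k _; rewrite rmorphM.
Qed.

Lemma fmapC c : fmap phi (fC n c) = fC n (phi c).
Proof. by apply: fpsP => m; rewrite /= rmorphMn. Qed.

Lemma fmap1 : fmap phi (1 : fps n R) = 1.
Proof. by rewrite [LHS]fmapC rmorph1. Qed.

Lemma fmap0 : fmap phi (0 : fps n R) = 0.
Proof. by apply: fpsP => m; rewrite /= rmorph0. Qed.

Lemma fmapX (i : 'I_n) : fmap phi (fX R i) = fX T i.
Proof. by apply: fpsP => m; rewrite /= rmorph_nat. Qed.

Lemma fmapXn f e : fmap phi (f ^+ e) = fmap phi f ^+ e.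
Proof. by elim: e => [|e IH]; rewrite ?fmap1 // !exprS fmapM IH. Qed.

Lemma fmap_nat e : fmap phi (e%:R : fps n R) = e%:R.
Proof. by elim: e => [|e IH]; rewrite ?fmap0 // !mulrS fmapD fmap1 IH. Qed.

Lemma fmap_fpd i f : fmap phi (fpd i f) = fpd i (fmap phi f).
Proof. by apply: fpsP => m; rewrite /= rmorphMn. Qed.

Lemma fmap_eqdeg d f g : eqdeg d f g -> eqdeg d (fmap phi f) (fmap phi g).
Proof. by move=> fg m md; rewrite /= fg. Qed.

Lemma fmap_finv f : f 0%MM = 1 -> fmap phi (Defs.finv f) = Defs.finv (fmap phi f).
Proof. by move=> f1; symmetry; apply: finv_uniq; rewrite -fmapM finvP // fmap1. Qed.

End Any.

Lemma fmap_fsubst n k (f : fps n R) (g : 'I_n -> fps k R) :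
  fmap phi (fsubst f g) = fsubst (fmap phi f) (fun i => fmap phi (g i)).
Proof.
apply: fpsP => m; rewrite fsubstE -[LHS]/(phi (fsubst f g m)) fsubstE rmorph_sum.
apply: eq_bigr => d _; rewrite rmorphM; congr (_ * _).
rewrite -[LHS]/(fmap phi _ m); congr (fcoef _ m).
elim/big_rec2: _ => [|i x y _ <-]; first exact: fmap1.
by rewrite fmapM fmapXn.
Qed.

Lemma fmap_fcomp k (f : fps 1 R) (g : fps k R) :
  fmap phi (fcomp f g) = fcomp (fmap phi f) (fmap phi g).
Proof. exact: fmap_fsubst. Qed.

End Fmap.

Definition fmapE := (fmapD, fmapN, fmapXn, fmapM, fmap1, fmapC, fmapX, fmap_nat).

Lemma fmap_fsqrt (S T : comAlgType rat) (phi : {rmorphism S -> T}) n (f : fps n S) :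
  f 0%MM = 1 -> fmap phi (fsqrt f) = fsqrt (fmap phi f).
Proof.
move=> f1; have [q1 q2] := fsqrtP f1; symmetry; apply: fsqrt_uniq.
  by rewrite /= q1 rmorph1.
by rewrite -fmapXn q2.
Qed.

Lemma fmap_fint (S T : comAlgType rat) (phi : {rmorphism S -> T}) (f : fps 1 S) :
  fmap phi (fint f) = fint (fmap phi f).
Proof.
apply: fint_uniq; last by rewrite -fmap_fpd fpd_fint.
by rewrite -[LHS]/(phi (fint f 0%MM)) fint_at0 rmorph0.
Qed.

(** * The derivation attached to a logarithm *)

#[local] Hint Extern 0 (fcoef (fX _ _) _ = _) => exact: coef_fX0 : core.

Section InvariantDerivation.
Variable S : comAlgType rat.
Local Notation t := (fX S (ord0 : 'I_1)).
Local Notation u := (fX S (ord0 : 'I_2)).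
Local Notation v := (fX S (ord_max : 'I_2)).
Implicit Types (F G H : fps 2 S) (q g : fps 1 S).

Lemma coef_restr0 H m : fsubst2 H t 0 m = H (U_(ord0) *+ m ord0)%MM.
Proof.
pose Psi H := FPS (fun m : 'X_{1..1} => H (U_(ord0) *+ m ord0)%MM).
rewrite -[RHS]/(Psi H m); congr (fcoef _ m); move: H.
have dU k : mdeg (U_(ord0 : 'I_2) *+ k)%MM = k by rewrite mdegMn mdeg1 mul1n.
apply: (fps_ext (e := 0)) => [F G|//|d F G|d F G|c|i F]; rewrite ?addn0 /Psi.
- exact: fsubst2D.
- exact: eqdeg_fsubst.
- by move=> FG k kd; apply: FG; rewrite dU -mdeg_ord0.
- rewrite fsubst2C //; apply: fpsP => k /=.
  by rewrite -!mdeg_eq0 dU mdeg_ord0.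
move=> E; rewrite fsubst2M // E.
have [-> | ->] : i = ord0 \/ i = ord_max.
  by case: i => [[|[|]]] // p; [left|right]; apply: val_inj.
  rewrite fsubst2X0 //; apply: fpsP => k.
  transitivity (if (0 < k ord0)%N then
      F (U_(ord0) *+ (k - U_(ord0))%MM ord0)%MM else 0); first by rewrite coef_fXM.
  transitivity ((u * F) (U_(ord0) *+ k ord0)%MM); last by [].
  rewrite coef_fXM mulmnE mnm1E eqxx mul1n.
  case: ifP => // k0; congr (F _); apply/mnmP => j.
  by rewrite !(mnmBE, mulmnE, mnm1E) eqxx; case: (ord0 == j); rewrite ?mul1n.
rewrite fsubst2X1 // mul0r; apply: fpsP => k.
transitivity ((v * F) (U_(ord0) *+ k ord0)%MM); last by [].
by rewrite coef_fXM mulmnE mnm1E.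
Qed.

Definition fder2 q H := fcomp q u * fpd ord0 H - fcomp q v * fpd ord_max H.

Lemma fder2D q F G : fder2 q (F + G) = fder2 q F + fder2 q G.
Proof. by rewrite /fder2 !fpdD; ring. Qed.

Lemma fder2N q F : fder2 q (- F) = - fder2 q F.
Proof. by rewrite /fder2 !fpdN; ring. Qed.

Lemma fder2M q F G : fder2 q (F * G) = fder2 q F * G + F * fder2 q G.
Proof. by rewrite /fder2 !fpdM; ring. Qed.

Lemma fder2Xn q F e : fder2 q (F ^+ e.+1) = e.+1%:R * F ^+ e * fder2 q F.
Proof. by rewrite /fder2 !fpdXn; ring. Qed.

Lemma fder2C q c : fder2 q (fC 2 c) = 0.
Proof. by rewrite /fder2 !fpdC !mulr0 subrr. Qed.

Lemma fder2_fcomp q g F : F 0%MM = 0 ->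
  fder2 q (fcomp g F) = fcomp (fpd ord0 g) F * fder2 q F.
Proof. by move=> F0; rewrite /fder2 !fpd_fcomp //; ring. Qed.

Lemma fder2_u q : fder2 q u = fcomp q u.
Proof. by rewrite /fder2 !fpdX /= mulr1 mulr0 subr0. Qed.

Lemma fder2_v q : fder2 q v = - fcomp q v.
Proof. by rewrite /fder2 !fpdX /= mulr1 mulr0 sub0r. Qed.

Definition fder2E := (fder2D, fder2N, fder2Xn, fder2M, fder2_u, fder2_v).

(** Uniqueness for a Cauchy problem: the equation expresses the coefficients of v^(j+1) in H through
    those of v^i with i <= j, and those of v^0 vanish. *)
Lemma fpd_ord_max_eq0 k H : fpd ord_max H = k * fpd ord0 H -> fsubst2 H t 0 = 0 -> H = 0.
Proof.
move=> Ek H0.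
apply: fpsP => m; elim: {m}(m ord_max).+1 {-2}m (ltnSn (m ord_max)) => // j IH m.
rewrite ltnS leq_eqVlt => /orP[/eqP mj|]; last exact: IH.
case: j => [|j] in IH mj *.
  have -> : m = (U_(ord0) *+ m ord0)%MM.
    apply/mnmP => -[[|[|]]] // p; rewrite mulmnE mnm1E.
      by rewrite (_ : Ordinal p = ord0) ?mul1n //; apply: val_inj.
    by rewrite (_ : Ordinal p = ord_max) //; apply: val_inj.
  by have := coef_restr0 H (mon (m ord0)); rewrite H0 mulmnE mnm1E eqxx mul1n.
have le : (U_(ord_max) <= m)%MM by rewrite lep1mP mj.
have := congr1 (fun h : fps 2 S => h (m - U_(ord_max))%MM) Ek.
rewrite fpdE addmC submK // fcoefM big1 => [/mulrn_ratalg_eq0 //|l _].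
rewrite fpdE IH ?mul0rn ?mulr0 // mnmDE mnm1E add0n !mnmBE mnm1E eqxx mj.
by rewrite (leq_ltn_trans (leq_subr _ _)) // subn1.
Qed.

Lemma fder2_eq0 q H : q 0%MM = 1 -> fder2 q H = 0 -> fsubst2 H t 0 = 0 -> H = 0.
Proof.
move=> q1 /eqP; rewrite subr_eq0 => /eqP dH.
apply: (@fpd_ord_max_eq0 (Defs.finv (fcomp q v) * fcomp q u)).
rewrite -mulrA dH mulrA [Defs.finv _ * _]mulrC finvP ?mul1r //.
by rewrite fcomp_at0.
Qed.

(** With g' = 1/q, the derivation sends g(u) to 1, g(v) to -1 and g(F) to 0. So it kills g(F) - g(u)
    - g(v), which vanishes at v = 0. *)
Lemma fgl_log_fder2 q F : q 0%MM = 1 -> F 0%MM = 0 -> fsubst2 F t 0 = t ->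
  fder2 q F = 0 -> fgl_log F (fint (Defs.finv q)).
Proof.
move=> q1 F0 Ft dF; have i1 := finv0 q1; split; first exact: eqdeg2_fint.
set g := fint _; apply/eqP; rewrite -subr_eq0; apply/eqP; apply: (fder2_eq0 q1).
  rewrite !fder2E !fder2_fcomp // dF fder2_u fder2_v fpd_fint.
  rewrite mulrN -!fcompM // [Defs.finv q * q]mulrC finvP // !fcomp1 //.
  by rewrite mulr0 subrr subr0.
rewrite fsubst2D fsubst2N fsubst2D !fsubst2_fcomp // Ft fsubst2X0 // fsubst2X1 //.
by rewrite fcomp_0 fint_at0 fC0 addr0 subrr.
Qed.

Lemma fder2_fgl_log q g F : q 0%MM = 1 -> F 0%MM = 0 -> fpd ord0 g * q = 1 ->
  fgl_log F g -> fder2 q F = 0.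
Proof.
move=> q1 F0 gq [g2 gF].
have g1 : fpd ord0 g 0%MM = 1.
  have := congr1 (fun h : fps 1 S => h 0%MM) gq.
  by rewrite Defs.coef0M q1 mulr1 fcoef1 eqxx.
apply: (sreg_eq0 (sreg_unit (f := fcomp (fpd ord0 g) F) _)).
  by rewrite fcomp_at0.
rewrite -fder2_fcomp // gF !fder2E !fder2_fcomp // fder2_u fder2_v mulrN -!fcompM //.
by rewrite gq !fcomp1 // subrr.
Qed.

End InvariantDerivation.

(** * Logarithms and the Weierstrass function *)

Section Logarithms.
Variable R : comNzRingType.
Local Notation t := (fX R (ord0 : 'I_1)).
Local Notation u := (fX R (ord0 : 'I_2)).
Local Notation v := (fX R (ord_max : 'I_2)).
Implicit Types (F G : fps 2 R) (g : fps 1 R).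

Lemma fgl_log_at0 F g : fgl_log F g -> g 0%MM = 0.
Proof. by move=> [g2 _]; rewrite g2 ?mdeg0 // coef_fX0. Qed.

Lemma fgl_log_fsubst2 F g k (a b : fps k R) :
    fgl_log F g -> F 0%MM = 0 -> a 0%MM = 0 -> b 0%MM = 0 ->
  fcomp g (fsubst2 F a b) = fcomp g a + fcomp g b.
Proof.
move=> [_ gF] F0 a0 b0; rewrite -fsubst2_fcomp // gF fsubst2D.
by rewrite !fsubst2_fcomp // fsubst2X0 // fsubst2X1.
Qed.

(** Composition with g turns each axiom into the corresponding law of addition, and g can be
    cancelled. *)
Lemma fgl_log_is_fgl F g : fgl_log F g -> F 0%MM = 0 -> is_fgl F.
Proof.
move=> gF F0; have g0 := fgl_log_at0 gF; have [g2 _] := gF.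
have z k : fcomp g 0 = 0 :> fps k R by rewrite fcomp_0 g0 fC0.
split; apply: (fcomp_inj g2); rewrite ?fsubst2_at0 ?coef_fX0 // ?fsubst2_at0 //;
  rewrite ?(fgl_log_fsubst2 gF) ?fsubst2_at0 //.
- by rewrite z addr0.
- by rewrite z add0r.
- by rewrite addrC gF.2.
- by rewrite addrA.
Qed.

Lemma fgl_log_inj F G g : fgl_log F g -> fgl_log G g ->
  F 0%MM = 0 -> G 0%MM = 0 -> F = G.
Proof.
by move=> [g2 gF] [_ gG] F0 G0; apply: (fcomp_inj g2); rewrite ?gF ?gG.
Qed.

Lemma is_fgl_at0 F : is_fgl F -> F 0%MM = 0.
Proof.
case=> /(congr1 (fun h : fps 1 R => h 0%MM)) F0 _ _ _.
by move: F0; rewrite fsubst2_at0 // coef_fX0.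
Qed.

(* Differentiating g(F(u, v)) = g(u) + g(v) in v at v = 0.                    *)
Lemma fpd_fgl_log F g : fgl_log F g -> F 0%MM = 0 -> fsubst2 F t 0 = t ->
  fpd ord0 g * fsubst2 (fpd ord_max F) t 0 = 1.
Proof.
move=> [g2 gF] F0 Ft.
have /(congr1 (fun H : fps 2 R => fsubst2 (fpd ord_max H) t 0)) := gF.
rewrite fpdD !fpd_fcomp // !fpdX /= mulr0 add0r mulr1 fsubst2M //.
rewrite !fsubst2_fcomp // Ft fsubst2X1 // fcomp_id => ->.
rewrite fcomp_0 fpdE g2 ?addm0 ?mdeg1 //= eqxx mnm0E mulr1n.
by apply: fpsP.
Qed.

End Logarithms.

(** By [fpd_fgl_log] both derivatives are the inverse of dF/dv(u, 0). *)
Lemma fgl_log_uniq (S : comAlgType rat) (F : fps 2 S) g h :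
  fgl_log F g -> fgl_log F h -> F 0%MM = 0 ->
  fsubst2 F (fX S (ord0 : 'I_1)) 0 = fX S ord0 -> g = h.
Proof.
move=> gF hF F0 Ft; apply: fpd_inj => [i|]; last by rewrite (fgl_log_at0 gF) (fgl_log_at0 hF).
rewrite (ord1 i); have := fpd_fgl_log gF F0 Ft; have := fpd_fgl_log hF F0 Ft.
move: (fsubst2 _ _ _) => w hw gw.
by rewrite -[LHS]mulr1 -hw mulrCA gw mulr1.
Qed.

Section Weierstrass.
Variable S : comAlgType rat.
Local Notation t := (fX S (ord0 : 'I_1)).
Implicit Types W : fps 1 S.

Lemma serP_at0 (a1 a2 a3 : S) : serP a1 a2 a3 0%MM = 1.
Proof.
rewrite /serP !(fcoefD, Defs.coef0X, Defs.coef0M) coef_fX0 fcoef1 eqxx.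
by rewrite !expr0n /= !mulr0 !addr0.
Qed.

Lemma serQ_serP (a1 a2 a3 : S) : serQ a1 a2 a3 = serP (- a1) a2 (- a3).
Proof.
have CN c : fC 1 (- c : S) = - fC 1 c by apply: fpsP => m; rewrite /= mulNrn.
by rewrite /serQ /serP !CN !mulNr.
Qed.

Lemma natr_scale e q (x : S) : e%:R * (q *: x) = (e%:R * q) *: x.
Proof. by rewrite mulr_natl -scaler_nat scalerA. Qed.

Lemma natmul_fps_inj n (x y : fps n S) e : e.+1%:R * x = e.+1%:R * y -> x = y.
Proof. exact: (sreg_mulI (@sreg_nat _ _ e)). Qed.

Lemma fCD n (a b : S) : fC n (a + b) = fC n a + fC n b.
Proof. by apply: fpsP => m; rewrite /= mulrnDl. Qed.
Lemma fCN n (a : S) : fC n (- a) = - fC n a.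
Proof. by apply: fpsP => m; rewrite /= mulNrn. Qed.
Lemma fCM n (a b : S) : fC n (a * b) = fC n a * fC n b.
Proof. by apply: fpsP => m; rewrite coef_fCM /= mulrnAr. Qed.
Lemma fCXn n (a : S) e : fC n (a ^+ e) = fC n a ^+ e.
Proof. by elim: e => [|e IH]; rewrite ?expr0 // !exprS fCM IH. Qed.
Lemma fC_nat n e : fC n (e%:R : S) = e%:R.
Proof. by elim: e => [|e IH]; rewrite ?fC0 // !mulrS fCD IH. Qed.

(* With V = wp + c in place of wp, s = V^(-1/2) satisfies (s')^2 = P(s).      *)
Lemma fpd_inv_sqrt (a1 a2 a3 : S) W : is_wp (inv_g2 a1 a2) (inv_g3 a1 a2 a3) W ->
  let s := t * Defs.finv (fsqrt (W + fC 1 (- ((1 / 3%:R : rat) *: a1)) * t ^+ 2)) in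
  fpd ord0 s ^+ 2 = fcomp (serP a1 a2 a3) s.
Proof.
move=> [W4]; rewrite fderivE; set c := fC 1 (- _); set V := W + c * t ^+ 2 => EW.
(* With b = a1/3 no fraction remains, and the final identity is within reach of [ring]. *)
have [b [Eb Ea1 Eg2 Eg3]] : exists b : S, [/\ (1 / 3%:R : rat) *: a1 = b,
    a1 = 3%:R * b, inv_g2 a1 a2 = 4%:R * (3%:R * b ^+ 2 - a2) &
    inv_g3 a1 a2 a3 = 4%:R * (b * a2 - 2%:R * b ^+ 3 - a3)].
  exists ((1 / 3%:R : rat) *: a1); split=> //.
  - by rewrite natr_scale -[LHS]scale1r; congr (_ *: _); apply/eqP.
  - rewrite /inv_g2 !exprZn (natr_scale 3).
    by congr (_ * (_ *: _ - _)); apply/eqP.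
  - rewrite /inv_g3 -scalerAl exprZn (natr_scale 2).
    by congr (_ * (_ - _ *: _ - _)); apply/eqP.
have Ec : c = - fC 1 b by rewrite /c Eb fCN.
have V1 : V 0%MM = 1.
  rewrite /V fcoefD W4 ?mdeg0 // fcoef1 eqxx Defs.coef0M Defs.coef0X coef_fX0.
  by rewrite expr0n mulr0 addr0.
have [q1 q2] := fsqrtP V1; set k := Defs.finv _.
have kV : k ^+ 2 * V = 1.
  by rewrite -q2 -exprMn mulrC finvP // expr1n.
have s0 : (t * k) 0%MM = 0 by rewrite Defs.coef0M coef_fX0 mul0r.
rewrite /= /serP !(fcompE s0) fpdM fpdX eqxx mul1r.
(* Differentiate k^2 V = 1 and cancel the unit k. *)
have dk : 2%:R * V * fpd ord0 k = - k * fpd ord0 V.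
  have := congr1 (fpd ord0) kV; rewrite fpdM fpdXn fpd1 expr1 => E.
  have k1 : k 0%MM = 1 by apply: finv0.
  apply: (sreg_mulI (sreg_unit k1)); apply/eqP; rewrite -subr_eq0 -E.
  by apply/eqP; ring.
(* The shift by c t^2 contributes 2 c t^2 to both terms: adding a constant to wp does not change
   wp'. *)
have dV : t * fpd ord0 V - 2%:R * V = t * fpd ord0 W - 2%:R * W.
  by rewrite /V fpdD fpdM fpdXn fpdX fpdC eqxx /=; ring.
have {}dV : (t * fpd ord0 V - 2%:R * V) ^+ 2 =
    4%:R * (V - c * t ^+ 2) ^+ 3 - fC 1 (inv_g2 a1 a2) * t ^+ 4 * (V - c * t ^+ 2)
    - fC 1 (inv_g3 a1 a2 a3) * t ^+ 6.
  by rewrite dV EW /V; ring.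
have ds : 2%:R * V * (k + t * fpd ord0 k) = - k * (t * fpd ord0 V - 2%:R * V).
  by rewrite mulrDr mulrCA dk; ring.
(* The goal is multiplied by 4, the factor written as the successor of 3. *)
apply: (@natmul_fps_inj _ _ _ 3).
transitivity ((k ^+ 2 * (2%:R * V * (k + t * fpd ord0 k))) ^+ 2).
  have -> : k ^+ 2 * (2%:R * V * (k + t * fpd ord0 k))
          = k ^+ 2 * V * (2%:R * (k + t * fpd ord0 k)) by ring.
  by rewrite kV; ring.
rewrite ds; transitivity (k ^+ 6 * (t * fpd ord0 V - 2%:R * V) ^+ 2); first by ring.
rewrite {}dV; transitivity (4%:R * (k ^+ 2 * V - c * (t * k) ^+ 2) ^+ 3
    - fC 1 (inv_g2 a1 a2) * (t * k) ^+ 4 * (k ^+ 2 * V - c * (t * k) ^+ 2)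
    - fC 1 (inv_g3 a1 a2 a3) * (t * k) ^+ 6); first by ring.
rewrite kV Ec Eg2 Eg3 Ea1 !(fCD, fCN, fCM, fCXn, fC_nat); ring.
Qed.

Lemma wp_at0 (g2 g3 c : S) W : is_wp g2 g3 W -> (W + fC 1 c * t ^+ 2) 0%MM = 1.
Proof.
move=> [W4 _]; rewrite fcoefD W4 ?mdeg0 // fcoef1 eqxx Defs.coef0M Defs.coef0X coef_fX0.
by rewrite expr0n mulr0 addr0.
Qed.

(** Since s' has constant term 1, s'^2 = P(s) gives s' = sqrt(P(s)), so the derivative of I(s) is
    1. *)
Lemma comp_inverse_wp (a1 a2 a3 : S) W : is_wp (inv_g2 a1 a2) (inv_g3 a1 a2 a3) W ->
  comp_inverse (serI a1 a2 a3)
    (t * Defs.finv (fsqrt (W + fC 1 (- ((1 / 3%:R : rat) *: a1)) * t ^+ 2))).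
Proof.
move=> EW; have ds := fpd_inv_sqrt EW; move: ds => /=.
have [V1 _] := fsqrtP (wp_at0 (- ((1 / 3%:R : rat) *: a1)) EW).
set k := Defs.finv _ => ds; have k1 : k 0%MM = 1 by apply: finv0.
have s0 : (t * k) 0%MM = 0 by rewrite Defs.coef0M coef_fX0 mul0r.
have P1 := serP_at0 a1 a2 a3; have [p1 p2] := fsqrtP P1.
have i1 := finv0 p1; have I0 := fint_at0 (Defs.finv (fsqrt (serP a1 a2 a3))).
apply: comp_inverseP => //; first exact: eqdeg2_fint.
have {}ds : fpd ord0 (t * k) = fcomp (fsqrt (serP a1 a2 a3)) (t * k).
  rewrite fcomp_fsqrt //; symmetry; apply: fsqrt_uniq => //.
  by rewrite fpdM fpdX eqxx mul1r fcoefD k1 Defs.coef0M coef_fX0 mul0r addr0.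
apply: fpd_inj => [i|]; last by rewrite fcomp_at0 // I0 coef_fX0.
rewrite (ord1 i) fpd_fcomp // fpd_fint ds -fcompM // mulrC finvP // fcomp1 //.
by rewrite fpdX eqxx.
Qed.

Lemma comp_inverse_uniq (R : comNzRingType) (g f h : fps 1 R) :
  comp_inverse g f -> comp_inverse g h -> f = h.
Proof.
move=> [g0 f0 gf fg] [_ h0 gh hg].
have := @fsubst_fcomp _ _ _ g0 _ f (fun=> h) (fun=> h0).
rewrite fg -[fsubst g _]/(fcomp g h) gh fcomp_id => <-.
by rewrite -[LHS]/(fcomp _ h) fcompX.
Qed.

(** Any pair of invariants arises with a1 = 0, and then W^(-1/2), hence W, is read off from the
    compositional inverse of the integral I. *)
Lemma is_wp_uniq (g2 g3 : S) W W' : is_wp g2 g3 W -> is_wp g2 g3 W' -> W = W'.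
Proof.
have [a2 Ea2] : exists a2, inv_g2 0 a2 = g2.
  exists (- ((1 / 4%:R : rat) *: g2)).
  rewrite /inv_g2 expr0n scaler0 sub0r opprK natr_scale.
  by rewrite -[RHS]scale1r; congr (_ *: _); apply/eqP.
have [a3 Ea3] : exists a3, inv_g3 0 a2 a3 = g3.
  exists (- ((1 / 4%:R : rat) *: g3)).
  rewrite /inv_g3 mul0r expr0n !scaler0 subrr sub0r opprK natr_scale.
  by rewrite -[RHS]scale1r; congr (_ *: _); apply/eqP.
rewrite -Ea2 -Ea3 => EW EW'.
have := comp_inverse_uniq (comp_inverse_wp EW) (comp_inverse_wp EW').
move/(sreg_mulI (@sreg_fX _ _ ord0)).
have := wp_at0 (- ((1 / 3%:R : rat) *: 0)) EW.
have := wp_at0 (- ((1 / 3%:R : rat) *: 0)) EW'.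
rewrite scaler0 oppr0 fC0 mul0r !addr0 => W1' W1 E.
have [[q1 q2] [q1' q2']] := (fsqrtP W1, fsqrtP W1').
rewrite -q2 -q2'; congr (_ ^+ 2).
by rewrite -[LHS]mulr1 -(finvP q1') mulrCA -E finvP // mulr1.
Qed.

Lemma comp_inverse_serI (a1 a2 a3 : S) : comp_inverse (serI a1 a2 a3)
  (inv_sqrt_wp (inv_g2 a1 a2) (inv_g3 a1 a2 a3) (- ((1 / 3%:R : rat) *: a1))).
Proof. exact/comp_inverse_wp/u2wpP. Qed.

Lemma inv_sqrt_wpX (g2 g3 c : S) : inv_sqrt_wp g2 g3 c ^+ 2 = inv_wp g2 g3 c.
Proof.
rewrite /inv_sqrt_wp /inv_wp exprMn; congr (_ * _); symmetry; apply: finv_uniq.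
have [q1 q2] := fsqrtP (wp_at0 c (u2wpP g2 g3)).
by rewrite -[X in X * _]q2 -exprMn finvP // expr1n.
Qed.

(** The quotient m/n has zero derivative. *)
Lemma proportional (n m : fps 1 S) : n 0%MM = 1 ->
  fpd ord0 m * n = m * fpd ord0 n -> m = fC 1 (m 0%MM) * n.
Proof.
move=> n1 mn; have ni := finvP n1; set i := Defs.finv n in ni *.
suff Em : m * i = fC 1 (m 0%MM) by rewrite -Em -mulrA [i * n]mulrC ni mulr1.
apply: fpd_inj => [j|]; last first.
  by rewrite Defs.coef0M /i finv0 // mulr1 /= eqxx.
rewrite (ord1 j) fpdC; apply: (sreg_eq0 (@sregX _ _ _ _ 2 (sreg_unit n1))).
have := congr1 (fpd ord0) ni; rewrite fpd1 !fpdM => di.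
transitivity (n * (n * i) * fpd ord0 m - m * (n * i) * fpd ord0 n
  + m * n * (fpd ord0 n * i + n * fpd ord0 i)); first by ring.
by rewrite di ni !mulr1 mulr0 addr0 [n * _]mulrC mn subrr.
Qed.

Lemma sigma_uniq (W s r : fps 1 S) : W 0%MM = 1 -> eqdeg 5 s t -> eqdeg 5 r t ->
  wp_is_dlog2 W s -> wp_is_dlog2 W r -> s = r.
Proof.
(* For s = t k the equation is (W - 1) k^2 = t^2 (k'^2 - k k''), so k'/k is   *)
(* determined up to a constant.                                              *)
have lead f : eqdeg 5 f t -> exists2 k : fps 1 S, f = t * k & eqdeg 4 k 1.
  move=> /eqdegB /eqdeg_divX [h Eh h4]; exists (1 + h).
    by rewrite mulrDr mulr1 -Eh; ring.
  by move=> m md; rewrite fcoefD h4 // addr0.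
have at0 (k : fps 1 S) : eqdeg 4 k 1 -> k 0%MM = 1 /\ fpd ord0 k 0%MM = 0.
  move=> k4; split; first by rewrite k4 ?mdeg0 // fcoef1 eqxx.
  by rewrite fpdE k4 ?addm0 ?mdeg1 // fcoef1 mnm1_eq0 mul0rn.
have eqn (k : fps 1 S) : wp_is_dlog2 W (t * k) ->
    (W - 1) * k ^+ 2 = t ^+ 2 * (fpd ord0 k ^+ 2 - k * fpd ord0 (fpd ord0 k)).
  rewrite /wp_is_dlog2 !fderivE !(fpd_rules, eqxx) /= => E.
  apply: (sreg_mulI (@sregX _ _ _ _ 2 (@sreg_fX S 1 ord0))).
  transitivity (W * (t * k) ^+ 2 - (t * k) ^+ 2); first by ring.
  by rewrite E; ring.
move=> W1 /lead [k Es k4] /lead [l Er l4]; rewrite {}Es {}Er => /eqn Ek /eqn El.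
have [[k1 k'1] [l1 l'1]] := (at0 _ k4, at0 _ l4).
have {}Ek : l ^+ 2 * (fpd ord0 k ^+ 2 - k * fpd ord0 (fpd ord0 k)) =
    k ^+ 2 * (fpd ord0 l ^+ 2 - l * fpd ord0 (fpd ord0 l)).
  apply: (sreg_mulI (@sregX _ _ _ _ 2 (@sreg_fX S 1 ord0))).
  by rewrite mulrCA -Ek [RHS]mulrCA -El; ring.
(* The Wronskian is proportional to k l by [Ek], and it vanishes at 0 because k and l are 1 modulo
   degree 4. *)
congr (_ * _); have m0 : fpd ord0 k * l - k * fpd ord0 l = 0.
  rewrite (@proportional (k * l) (fpd ord0 k * l - k * fpd ord0 l)).
  - by rewrite fcoefB !Defs.coef0M k'1 l'1 mul0r mulr0 subrr fC0 mul0r.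
  - by rewrite Defs.coef0M k1 l1 mulr1.
  move/eqP: Ek; rewrite -subr_eq0 => /eqP Ek; apply/eqP; rewrite -subr_eq0 -oppr_eq0 -Ek.
  by rewrite !fpdB !fpdM; apply/eqP; ring.
rewrite (@proportional l k) // ?k1 ?mul1r //.
by apply/eqP; rewrite -subr_eq0 m0.
Qed.

End Weierstrass.

(** * The addition theorem *)

Section TwoVariableRegular.
Variable S : comAlgType rat.
Local Notation u := (fX S (ord0 : 'I_2)).
Local Notation v := (fX S (ord_max : 'I_2)).

Lemma sreg_addX : sreg 1 (u + v).
Proof.
have -> : u + v = u + fC 2 1 * v by rewrite [fC 2 1 * v]mul1r.
exact: sreg_fX_lin.
Qed.

Lemma sreg_subX : sreg 1 (u - v).
Proof.
have -> : u - v = u + fC 2 (- 1) * v.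
  by rewrite fCN mulNr [fC 2 1 * v]mul1r.
exact: sreg_fX_lin.
Qed.

Lemma sreg_subX2 : sreg 2 (u ^+ 2 - v ^+ 2).
Proof.
have -> : u ^+ 2 - v ^+ 2 = (u - v) * (u + v) by ring.
exact: (sregM sreg_subX sreg_addX).
Qed.

Lemma eqdeg_restr0 d (F : fps 2 S) : eqdeg d F (u + v) ->
  eqdeg d (fsubst2 F (fX S (ord0 : 'I_1)) 0) (fX S ord0).
Proof.
move=> /(@eqdeg_fsubst _ _ _ (fun i : 'I_2 => [:: fX S (ord0 : 'I_1); 0]`_i)).
rewrite -[fsubst (u + v) _]/(fsubst2 (u + v) _ _) fsubst2D fsubst2X0 //.
by rewrite fsubst2X1 // addr0.
Qed.

End TwoVariableRegular.

(* Euler's addition theorem: the derivation sqrt(Q(u)) d/du - sqrt(Q(v)) d/dv *)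
(* kills F^-2 = N / w^2.                                                      *)
Lemma fder2_euler (S : comAlgType rat) (q : fps 1 S) (b1 b2 b3 : S)
    (p r F : fps 2 S) :
  let u := fX S (ord0 : 'I_2) in
  let v := fX S (ord_max : 'I_2) in
  let A1 := fC 2 b1 in let A2 := fC 2 b2 in let A3 := fC 2 b3 in
  let D := u * r - v * p in
  let w := u ^+ 2 - v ^+ 2 in
  let N := D ^+ 2 + A3 * u ^+ 2 * v ^+ 2 * w ^+ 2 in
  fder2 q u = p -> fder2 q v = - r ->
  p ^+ 2 = 1 - A1 * u ^+ 2 + A2 * u ^+ 4 - A3 * u ^+ 6 ->
  r ^+ 2 = 1 - A1 * v ^+ 2 + A2 * v ^+ 4 - A3 * v ^+ 6 ->
  2%:R * fder2 q p = - 2%:R * A1 * u + 4%:R * A2 * u ^+ 3 - 6%:R * A3 * u ^+ 5 ->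
  2%:R * fder2 q r = 2%:R * A1 * v - 4%:R * A2 * v ^+ 3 + 6%:R * A3 * v ^+ 5 ->
  F ^+ 2 * N = w ^+ 2 -> fder2 q F = 0.
Proof.
move=> u v A1 A2 A3 D w N du dv p2 r2 dp dr FN.
have ww : sreg 2 w by apply: sreg_subX2.
have dA3 : fder2 q A3 = 0 by apply: fder2C.
(* From here on only the stated relations are used, with u, v and the coefficients as indeterminates
   for [ring]. *)
clearbody u v A1 A2 A3.
have dD : 2%:R * fder2 q D = 4%:R * p * r - v * (2%:R * fder2 q p) + u * (2%:R * fder2 q r).
  by rewrite /D fder2D fder2N !fder2M du dv; ring.
have dw : fder2 q w = 2%:R * (u * p + v * r) by rewrite /w fder2D fder2N !fder2Xn du dv; ring.
(* This says that N / w^2 is killed, with denominators cleared. *)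
have dN : fder2 q N * w = 2%:R * N * fder2 q w.
  have dK : fder2 q (A3 * u ^+ 2 * v ^+ 2 * w ^+ 2) =
      A3 * (2%:R * u * p * v ^+ 2 * w ^+ 2 - 2%:R * u ^+ 2 * v * r * w ^+ 2
            + u ^+ 2 * v ^+ 2 * (2%:R * w * fder2 q w)).
    by rewrite !(fder2Xn, fder2M) dA3 du dv; ring.
  have -> : fder2 q N = D * (2%:R * fder2 q D) + fder2 q (A3 * u ^+ 2 * v ^+ 2 * w ^+ 2).
    by rewrite /N fder2D fder2Xn; ring.
  rewrite dK dD dp dr dw.
  apply/eqP; rewrite -subr_eq0; apply/eqP.
  (* The difference of the two sides as an explicit combination of the relations p^2 = Q(u) and r^2
     = Q(v). *)
  transitivity ((4%:R * u * p * w - 4%:R * (u ^+ 3 * p + u ^+ 2 * v * r - 2%:R * u * v ^+ 2 * p))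
      * (r ^+ 2 - (1 - A1 * v ^+ 2 + A2 * v ^+ 4 - A3 * v ^+ 6))
    + (- 4%:R * v * r * w - 4%:R * (- 2%:R * u ^+ 2 * v * r + u * v ^+ 2 * p + v ^+ 3 * r))
      * (p ^+ 2 - (1 - A1 * u ^+ 2 + A2 * u ^+ 4 - A3 * u ^+ 6))).
    by rewrite /N /D /w; ring.
  by rewrite -p2 -r2 2!subrr 2!mulr0 addr0.
have /(congr1 (fder2 q)) := FN; rewrite fder2M !fder2Xn !expr1 => E.
apply: (sreg_eq0 (@sreg_natM _ _ 1 _ _ (@sregX _ _ _ _ 3 ww))).
transitivity (2%:R * w * w ^+ 2 * fder2 q F); first by ring.
rewrite -FN.
transitivity (F * w * (2%:R * F * fder2 q F * N + F ^+ 2 * fder2 q N)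
  - F ^+ 3 * (fder2 q N * w)); first by ring.
rewrite E dN; transitivity (2%:R * F * fder2 q w * (w ^+ 2 - F ^+ 2 * N)); first by ring.
by rewrite FN subrr mulr0.
Qed.

(** * The explicit law, its logarithm and its exponential *)

Section BcLaw.
Variables (S : comAlgType rat) (a1 a2 a3 : S).
Local Notation t := (fX S (ord0 : 'I_1)).
Local Notation u := (fX S (ord0 : 'I_2)).
Local Notation v := (fX S (ord_max : 'I_2)).
Local Notation q := (fsqrt (serQ a1 a2 a3)).
Local Notation p := (fcomp q u).
Local Notation r := (fcomp q v).

Lemma fsqrt_serQP : q 0%MM = 1 /\ q ^+ 2 = serQ a1 a2 a3.
Proof. exact/fsqrtP/serQ0. Qed.

Lemma sqr_fcomp_q k (x : fps k S) : x 0%MM = 0 -> fcomp q x ^+ 2 =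
  1 - fC k a1 * x ^+ 2 + fC k a2 * x ^+ 4 - fC k a3 * x ^+ 6.
Proof. by move=> x0; rewrite -fcompXn // fsqrt_serQP.2 /serQ !(fcompE x0). Qed.

Lemma fpd_serQ : fpd ord0 (serQ a1 a2 a3) =
  - 2%:R * fC 1 a1 * t + 4%:R * fC 1 a2 * t ^+ 3 - 6%:R * fC 1 a3 * t ^+ 5.
Proof. by rewrite /serQ !fpd_rules eqxx /=; ring. Qed.

Lemma fder2_fcomp_q (x : fps 2 S) : x 0%MM = 0 -> 2%:R * (fcomp q x * fder2 q (fcomp q x)) =
  (- 2%:R * fC 2 a1 * x + 4%:R * fC 2 a2 * x ^+ 3 - 6%:R * fC 2 a3 * x ^+ 5) * fder2 q x.
Proof.
move=> x0; rewrite fder2_fcomp //.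
have := congr1 (fun h => fcomp (fpd ord0 h) x) fsqrt_serQP.2.
rewrite fpdXn fpd_serQ expr1 !(fcompE x0) => <-; ring.
Qed.

Lemma F_Bc_at0 : F_Bc a1 a2 a3 0%MM = 0.
Proof.
have [F2 _] := F_BcP a1 a2 a3.
by rewrite F2 ?mdeg0 // fcoefD !coef_fX0 addr0.
Qed.

(** At v = 0 the defining equation only gives F^2 = t^2; the branch u + v + .. fixes the sign. *)
Lemma F_Bc_restr0 : fsubst2 (F_Bc a1 a2 a3) t 0 = t.
Proof.
have [F2] := F_BcP a1 a2 a3; have [q1 _] := fsqrt_serQP.
move/(congr1 (fun H : fps 2 S => fsubst2 H t 0)); rewrite !(fsubst2E _ _) //.
rewrite !fsubst2_fcomp // fsubst2X0 // fsubst2X1 // fcomp_0 q1 mul0r subr0 expr0n /=.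
rewrite mulr0 mul0r addr0 [fC _ _]/(1 : fps 1 S) mulr1 subr0.
rewrite exprSr exprSr expr0 mul1r => E.
have {}E : fsubst2 (F_Bc a1 a2 a3) t 0 ^+ 2 = t ^+ 2.
  apply: (sreg_mulI (@sregX _ _ _ _ 2 (@sreg_fX S 1 ord0))).
  by rewrite mulrC expr2 E; ring.
apply: (sqr_inj (@sreg_fX S 1 ord0)) => //; exact: eqdeg_restr0.
Qed.

Lemma fder2_F_Bc : fder2 q (F_Bc a1 a2 a3) = 0.
Proof.
have [u0 v0] : u 0%MM = 0 /\ v 0%MM = 0 by split.
have q1 := fsqrt_serQP.1; have [_ FN] := F_BcP a1 a2 a3.
apply: (fder2_euler (fder2_u q) (fder2_v q) _ _ _ _ FN).
- exact: sqr_fcomp_q.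
- exact: sqr_fcomp_q.
- apply: (sreg_mulI (sreg_unit (f := p) _)); first by rewrite fcomp_at0.
  by rewrite mulrCA fder2_fcomp_q // fder2_u mulrC.
- apply: (sreg_mulI (sreg_unit (f := r) _)); first by rewrite fcomp_at0.
  by rewrite mulrCA fder2_fcomp_q // fder2_v; ring.
Qed.

Lemma fgl_log_F_Bc : fgl_log (F_Bc a1 a2 a3) (g_Bc a1 a2 a3).
Proof.
apply: fgl_log_fder2; [exact: fsqrt_serQP.1 | exact: F_Bc_at0 | exact: F_Bc_restr0 |].
exact: fder2_F_Bc.
Qed.

Lemma is_fgl_F_Bc : is_fgl (F_Bc a1 a2 a3).
Proof. exact: fgl_log_is_fgl fgl_log_F_Bc F_Bc_at0. Qed.

(** Negating a1 and a3 turns P into Q, keeps g2 and negates g3; so this is the inversion of I at the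
    parameters (-a1, a2, -a3). *)
Lemma fgl_exp_F_Bc : fgl_exp (F_Bc a1 a2 a3) (f_Bc a1 a2 a3).
Proof.
exists (g_Bc a1 a2 a3); first exact: fgl_log_F_Bc.
have := comp_inverse_serI (- a1) a2 (- a3); rewrite /serI -serQ_serP.
have -> : inv_g2 (- a1) a2 = inv_g2 a1 a2 by rewrite /inv_g2 sqrrN.
suff -> : inv_g3 (- a1) a2 (- a3) = - inv_g3 a1 a2 a3 by rewrite scalerN opprK.
have a13 : (- a1) ^+ 3 = - a1 ^+ 3 by ring.
rewrite /inv_g3 mulNr a13 !scalerN.
by move: (_ *: (a1 * a2)) (_ *: a1 ^+ 3) => x y; ring.
Qed.

End BcLaw.

(** * The Buchstaber polynomial *)

Section BuchstaberRoots.

Lemma rmorph_buchstaber (T U : comNzRingType) (phi : {rmorphism T -> U})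
    (a1 a2 a3 z x y : T) :
  phi (buchstaber a1 a2 a3 z x y) =
  buchstaber (phi a1) (phi a2) (phi a3) (phi z) (phi x) (phi y).
Proof.
rewrite /buchstaber.
by rewrite !(rmorphD, rmorphN, rmorphXn, rmorphM, rmorph1, rmorph_nat).
Qed.

(* The coefficients of the Buchstaber polynomial as a quadratic in z; the     *)
(* constant one is (x - y)^2.                                                 *)
Definition bc2 (T : comNzRingType) (a1 a2 a3 x y : T) :=
  (1 - a2 * x * y) ^+ 2 - 4%:R * a3 * x * y * (x + y + a1 * x * y).
Definition bc1 (T : comNzRingType) (a1 a2 a3 x y : T) :=
  2%:R * (x + y) * (1 - a2 * x * y)
  - 4%:R * (x + y + a1 * x * y + a3 * x ^+ 2 * y ^+ 2).

Variables (S : comAlgType rat) (a1 a2 a3 : S).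
Local Notation t := (fX S (ord0 : 'I_1)).
Local Notation u := (fX S (ord0 : 'I_2)).
Local Notation v := (fX S (ord_max : 'I_2)).
Local Notation A1 n := (fC n a1).
Local Notation A2 n := (fC n a2).
Local Notation A3 n := (fC n a3).

Let Gbuch_rel0 :
  bc2 (A1 2) (A2 2) (A3 2) u v * (Gbuch a1 a2 a3).1 = - bc1 (A1 2) (A2 2) (A3 2) u v /\
  bc2 (A1 2) (A2 2) (A3 2) u v * (Gbuch a1 a2 a3).2 = (u - v) ^+ 2.
Proof.
have [L L0 EL] := GbuchP a1 a2 a3.
have {}EL z : buchstaber (A1 2) (A2 2) (A3 2) z u v =
    L * (z ^+ 2 - (Gbuch a1 a2 a3).1 * z + (Gbuch a1 a2 a3).2).
  have := congr1 (horner_eval z) EL; rewrite rmorph_buchstaber.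
  rewrite !(rmorphD, rmorphN, rmorphXn, rmorphM) /= /horner_eval.
  by rewrite !hornerC !hornerX.
move: (Gbuch a1 a2 a3) EL => -[P1 P2] /= EL.
move: (A1 2) (A2 2) (A3 2) EL => B1 B2 B3 EL.
(* The values at z = 0, 1 and -1 determine the three coefficients of the quadratic. *)
have E2 : L * P2 = (u - v) ^+ 2.
  transitivity (L * (0 ^+ 2 - P1 * 0 + P2)); first by ring.
  by rewrite -EL /buchstaber; ring.
have E3 : L = bc2 B1 B2 B3 u v.
  apply: (@natmul_fps_inj _ _ _ _ 1).
  transitivity (L * (1 ^+ 2 - P1 * 1 + P2) + L * ((-1) ^+ 2 - P1 * (-1) + P2)
    - 2%:R * (L * P2)); first by ring.
  by rewrite -!EL E2 /buchstaber /bc2; ring.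
rewrite -E3; split=> //.
transitivity (L + L * P2 - L * (1 ^+ 2 - P1 * 1 + P2)); first by ring.
by rewrite -EL E2 E3 /buchstaber /bc2 /bc1; ring.
Qed.

Lemma Gbuch_rel k (x y : fps k S) : x 0%MM = 0 -> y 0%MM = 0 ->
  bc2 (A1 k) (A2 k) (A3 k) x y * fsubst2 (Gbuch a1 a2 a3).1 x y =
    - bc1 (A1 k) (A2 k) (A3 k) x y /\
  bc2 (A1 k) (A2 k) (A3 k) x y * fsubst2 (Gbuch a1 a2 a3).2 x y = (x - y) ^+ 2.
Proof.
move=> x0 y0; have [E1 E2] := Gbuch_rel0.
have e2 : fsubst2 (bc2 (A1 2) (A2 2) (A3 2) u v) x y = bc2 (A1 k) (A2 k) (A3 k) x y.
  by rewrite /bc2 !(fsubst2E x0 y0).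
have e1 : fsubst2 (bc1 (A1 2) (A2 2) (A3 2) u v) x y = bc1 (A1 k) (A2 k) (A3 k) x y.
  by rewrite /bc1 !(fsubst2E x0 y0).
rewrite -e2 -e1 -!(fsubst2M x0 y0) E1 E2; split; first exact: fsubst2N.
by rewrite !(fsubst2E x0 y0).
Qed.

Lemma bc2_at0 k (B1 B2 B3 x y : fps k S) : x 0%MM = 0 -> y 0%MM = 0 ->
  bc2 B1 B2 B3 x y 0%MM = 1.
Proof.
move=> x0 y0; rewrite /bc2 !(fcoefD, fcoefN, Defs.coef0X, Defs.coef0M) x0 y0 fcoef1 eqxx.
by rewrite !(mulr0, mul0r, subr0) ?expr1n ?mulr1.
Qed.

Lemma Gbuch_uniq k (x y s m : fps k S) : x 0%MM = 0 -> y 0%MM = 0 ->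
    bc2 (A1 k) (A2 k) (A3 k) x y * s = - bc1 (A1 k) (A2 k) (A3 k) x y ->
    bc2 (A1 k) (A2 k) (A3 k) x y * m = (x - y) ^+ 2 ->
  fsubst2 (Gbuch a1 a2 a3).1 x y = s /\ fsubst2 (Gbuch a1 a2 a3).2 x y = m.
Proof.
move=> x0 y0 Es Em; have [E1 E2] := Gbuch_rel x0 y0.
have H := sreg_unit (bc2_at0 (A1 k) (A2 k) (A3 k) x0 y0).
by split; apply: (sreg_mulI H); rewrite ?Es ?Em.
Qed.

Local Notation q := (fsqrt (serQ a1 a2 a3)).
Local Notation F := (F_Bc a1 a2 a3).

Lemma fcomp_q_even k (x : fps k S) : x 0%MM = 0 -> fcomp q (- x) = fcomp q x.
Proof.
move=> x0; have Nx0 : (- x) 0%MM = 0 by rewrite fcoefN x0 oppr0.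
rewrite !fcomp_fsqrt ?serQ0 //; congr fsqrt.
by rewrite /serQ !(fcompE x0) !(fcompE Nx0); ring.
Qed.

(** With w = u^2 - v^2 the two squares are w^2/N1 and w^2/N2, where N2 is N1 with v replaced by -v;
    as q is even, only the cross term of D^2 changes sign. By p^2 = Q(u) and r^2 = Q(v), N1 + N2 and
    N1 N2 are polynomials in u^2 and v^2, namely -c1 and w^2 c2. *)
Lemma F_Bc_roots :
  let z1 := F ^+ 2 in let z2 := fsubst2 F u (- v) ^+ 2 in
  let c2 := bc2 (- A1 2) (A2 2) (- A3 2) (u ^+ 2) (v ^+ 2) in
  c2 * (z1 + z2) = - bc1 (- A1 2) (A2 2) (- A3 2) (u ^+ 2) (v ^+ 2) /\
  c2 * (z1 * z2) = (u ^+ 2 - v ^+ 2) ^+ 2.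
Proof.
have [_ FN] := F_BcP a1 a2 a3; have [u0 v0] : u 0%MM = 0 /\ v 0%MM = 0 by split.
have Nv0 : (- v) 0%MM = 0 by rewrite fcoefN v0 oppr0.
have := congr1 (fun H => fsubst2 H u (- v)) FN.
rewrite /= !(fsubst2D, fsubst2N, fsubst2Xn u0 Nv0, fsubst2M u0 Nv0, fsubst2C u0 Nv0,
  fsubst2X0 u0 Nv0, fsubst2X1 u0 Nv0).
rewrite (fsubst2_fcomp u0 Nv0 q u0) (fsubst2_fcomp u0 Nv0 q v0).
rewrite (fsubst2X0 u0 Nv0) (fsubst2X1 u0 Nv0) (fcomp_q_even v0).
have := sqr_fcomp_q a1 a2 a3 v0; have := sqr_fcomp_q a1 a2 a3 u0.
have := @sreg_subX2 S; move: (fcomp q u) (fcomp q v) FN => p r.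
move: (F_Bc a1 a2 a3) => H; move: (A1 2) (A2 2) (A3 2) => B1 B2 B3.
move: u v => x y HN ww p2 r2; move: (fsubst2 H x (- y)) => G.
set w := x ^+ 2 - y ^+ 2 in ww *; rewrite sqrrN -/w => GN.
rewrite -[RHS]/(w ^+ 2) in HN.
set N1 := (_ ^+ 2 + _) in HN; set N2 := (_ ^+ 2 + _) in GN.
have ND : N1 + N2 = - bc1 (- B1) B2 (- B3) (x ^+ 2) (y ^+ 2).
  transitivity (2%:R * (x ^+ 2 * r ^+ 2 + y ^+ 2 * p ^+ 2 + B3 * x ^+ 2 * y ^+ 2 * w ^+ 2)).
    by rewrite /N1 /N2 /w; ring.
  by rewrite p2 r2 /bc1 /w; ring.
have NM : N1 * N2 = w ^+ 2 * bc2 (- B1) B2 (- B3) (x ^+ 2) (y ^+ 2).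
  transitivity ((x ^+ 2 * r ^+ 2 + y ^+ 2 * p ^+ 2 + B3 * x ^+ 2 * y ^+ 2 * w ^+ 2) ^+ 2
    - 4%:R * x ^+ 2 * y ^+ 2 * p ^+ 2 * r ^+ 2).
    by rewrite /N1 /N2 /w; ring.
  by rewrite p2 r2 /bc2 /w; ring.
rewrite /=; set c2 := bc2 _ _ _ _ _ in NM *; clearbody N1 N2 w c2.
split; apply: (sreg_mulI (@sregX _ _ _ _ 2 ww)).
  rewrite mulrA -NM -ND; transitivity (H ^+ 2 * N1 * N2 + G ^+ 2 * N2 * N1); first by ring.
  by rewrite HN GN; ring.
rewrite mulrA -NM; transitivity (H ^+ 2 * N1 * (G ^+ 2 * N2)); first by ring.
by rewrite HN GN.
Qed.

End BuchstaberRoots.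

(** * Formal groups with inverse -u *)

Section LogarithmExists.
Variable S : comAlgType rat.
Local Notation t := (fX S (ord0 : 'I_1)).
Local Notation u := (fX S (ord0 : 'I_2)).
Local Notation v := (fX S (ord_max : 'I_2)).
Implicit Types (F : fps 2 S) (g : fps 1 S).

(* Associativity differentiated in the third variable w at w = 0.             *)
Lemma fgl_invariant F : is_fgl F ->
  let om := fsubst2 (fpd ord_max F) t 0 in
  om 0%MM = 1 /\ fcomp om F = fpd ord_max F * fcomp om v.
Proof.
move=> fF; have F0 := is_fgl_at0 fF; case: fF => Fu Fv _ FA om; split.
  have := congr1 (fun h : fps 1 S => fpd ord0 h 0%MM) Fv.
  rewrite fpd_fsubst2 // fpd0 fpdX eqxx mulr0 add0r mulr1 fsubst2_at0 //.
  by rewrite /om fsubst2_at0 // fcoef1 eqxx.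
set a := fX S _ in FA; set b := fX S (Ordinal _) in FA; set c := fX S (Ordinal _) in FA.
have [a0 b0 c0] : [/\ a 0%MM = 0, b 0%MM = 0 & c 0%MM = 0] by split; apply: coef_fX0.
have ab0 : fsubst2 F a b 0%MM = 0 by rewrite fsubst2_at0.
have bc0 : fsubst2 F b c 0%MM = 0 by rewrite fsubst2_at0.
have := congr1 (fpd (@Ordinal 3 2 isT)) FA.
rewrite !fpd_fsubst2 // !fpdX /= !mulr0 !addr0 !mulr0 !add0r !mulr1.
pose s (i : 'I_3) : fps 2 S := [:: u; v; 0]`_i.
have s0 i : s i 0%MM = 0.
  case: i => [[|[|[|//]]]] p //; exact: coef_fX0.
move/(congr1 (fun h => fsubst h s)); rewrite fsubstM // !fsubst_fsubst2 //.
rewrite /a /b /c !fsubstX // /s /= fsubst2_id.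
have z (G : fps 2 S) (x : fps 2 S) : x 0%MM = 0 ->
    fsubst2 G x 0 = fcomp (fsubst2 G t 0) x.
  move=> x0; rewrite /fcomp fsubst_fsubst2 // fsubst0.
  by rewrite -[fsubst t _]/(fcomp t x) fcompX.
by rewrite !z // -/om Fu fcompX // fsubst2_id.
Qed.

(** The logarithm is the integral of du / om(u), where om(u) = dF/dv(u, 0). By [fgl_invariant], g(F)
    - g(u) - g(v) has zero derivative in v, and it vanishes at v = 0. *)
Lemma fgl_log_exists F : is_fgl F -> exists g, fgl_log F g.
Proof.
move=> fF; have F0 := is_fgl_at0 fF; have [Fu _ _ _] := fF.
have [] := fgl_invariant fF; set om := fsubst2 _ _ _ => om1 omF.
have i1 := finv0 om1; exists (fint (Defs.finv om)); split; first exact: eqdeg2_fint.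
set g := fint _; apply/eqP; rewrite -subr_eq0; apply/eqP.
apply: (@fpd_ord_max_eq0 _ 0).
  rewrite mul0r fpdB fpdD !fpd_fcomp // !fpdX /= mulr0 mulr1 add0r fpd_fint.
  rewrite !fcomp_finv // omF.
  have e0 : fcomp om v 0%MM = 1 by rewrite fcomp_at0.
  have f0 : (fpd ord_max F * fcomp om v) 0%MM = 1 by rewrite -omF fcomp_at0.
  apply: (sreg_eq0 (sreg_unit e0)); rewrite mulrBr finvP //.
  apply/eqP; rewrite subr_eq0; apply/eqP; rewrite -[RHS](finvP f0).
  by move: (Defs.finv _) => w; ring.
rewrite fsubst2D fsubst2N fsubst2D !fsubst2_fcomp // Fu fsubst2X0 // fsubst2X1 //.
by rewrite fcomp_0 fint_at0 fC0 addr0 subrr.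
Qed.

Lemma fgl_log_eqdeg2 F g : fgl_log F g -> F 0%MM = 0 -> eqdeg 2 F (u + v).
Proof.
move=> [g2 gF] F0; apply: eqdeg_trans (eqdeg_sym (eqdeg_fcompX F0 g2)) _.
by rewrite gF; apply: eqdegD; apply: eqdeg_fcompX.
Qed.

Section OddLogarithm.
Variables (F : fps 2 S) (g : fps 1 S).
Hypotheses (gF : fgl_log F g) (F0 : F 0%MM = 0) (Fodd : fsubst2 F t (- t) = 0).

Let coefN0 k (x : fps k S) : x 0%MM = 0 -> (- x) 0%MM = 0.
Proof. by move=> x0; rewrite fcoefN x0 oppr0. Qed.

Lemma fgl_log_odd k (x : fps k S) : x 0%MM = 0 -> fcomp g (- x) = - fcomp g x.
Proof.
move=> x0; have Nt0 := coefN0 (coef_fX0 S (ord0 : 'I_1)).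
have E : fcomp g (- t) = - g.
  have := fgl_log_fsubst2 gF F0 (coef_fX0 S (ord0 : 'I_1)) Nt0.
  rewrite Fodd fcomp_0 (fgl_log_at0 gF) fC0 fcomp_id => /eqP.
  by rewrite eq_sym addrC addr_eq0 => /eqP.
rewrite -fcompN -E; symmetry; rewrite [LHS](@fsubst_fcomp _ _ _ Nt0) //.
by rewrite -[fsubst (- t) _]/(fcomp (- t) x) fcompN fcompX.
Qed.

Lemma fgl_odd k (x y : fps k S) : x 0%MM = 0 -> y 0%MM = 0 ->
  fsubst2 F (- x) (- y) = - fsubst2 F x y.
Proof.
move=> x0 y0; have [Nx0 Ny0] := (coefN0 x0, coefN0 y0); have [g2 _] := gF.
have xy0 : fsubst2 F x y 0%MM = 0 by rewrite fsubst2_at0.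
apply: (fcomp_inj g2); rewrite ?fsubst2_at0 ?coefN0 //.
rewrite (fgl_log_fsubst2 gF) // !fgl_log_odd // (fgl_log_fsubst2 gF) //.
by rewrite opprD.
Qed.

Lemma fgl_inverse_uniq i : fgl_inverse F i -> i = - t.
Proof.
move=> [i0 Fi]; have [g2 _] := gF; apply: (fcomp_inj g2); rewrite ?coefN0 //.
have := fgl_log_fsubst2 gF F0 (coef_fX0 S (ord0 : 'I_1)) i0.
rewrite Fi fcomp_0 (fgl_log_at0 gF) fC0 fgl_log_odd // => /eqP.
by rewrite eq_sym addrC addr_eq0 => /eqP.
Qed.

(** Here F(-u, -v) = -F(u, v), so x = -u^2, y = -v^2, and the two values are -F(u, v)^2 and -F(u,
    -v)^2. *)
Lemma modulus_square_odd P : modulus_square F P <->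
  fsubst2 P.1 (- u ^+ 2) (- v ^+ 2) = - (F ^+ 2 + fsubst2 F u (- v) ^+ 2) /\
  fsubst2 P.2 (- u ^+ 2) (- v ^+ 2) = F ^+ 2 * fsubst2 F u (- v) ^+ 2.
Proof.
have [u0 v0] : u 0%MM = 0 /\ v 0%MM = 0 by split; apply: coef_fX0.
have E i : i = - t -> [/\ u * fcomp i u = - u ^+ 2, v * fcomp i v = - v ^+ 2,
    F * fsubst2 F (fcomp i u) (fcomp i v) = - F ^+ 2 &
    fsubst2 F u (fcomp i v) * fsubst2 F (fcomp i u) v = - fsubst2 F u (- v) ^+ 2].
  move=> ->; rewrite !fcompN (fcompX u0) (fcompX v0) (fgl_odd u0 v0) fsubst2_id.
  split; rewrite ?mulrN -?expr2 //.
  by rewrite -[v in fsubst2 F (- u) v]opprK (fgl_odd u0 (coefN0 v0)) mulrN.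
split=> [[i /fgl_inverse_uniq /E [e1 e2 e3 e4]] | [H1 H2]].
  by cbv zeta; rewrite e1 e2 e3 e4 -opprD mulrNN.
exists (- t); first by split=> //; apply: coefN0.
have [e1 e2 e3 e4] := E _ erefl.
by cbv zeta; rewrite e1 e2 e3 e4 H1 H2 -opprD mulrNN.
Qed.

End OddLogarithm.

Lemma F_Bc_odd (a1 a2 a3 : S) : fsubst2 (F_Bc a1 a2 a3) t (- t) = 0.
Proof.
have gF := fgl_log_F_Bc a1 a2 a3; have [g2 _] := gF; have F0 := F_Bc_at0 a1 a2 a3.
have t0 : t 0%MM = 0 by apply: coef_fX0.
have Nt0 : (- t) 0%MM = 0 by rewrite fcoefN t0 oppr0.
apply: (fcomp_inj g2); rewrite ?fsubst2_at0 // (fgl_log_fsubst2 gF) //.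
rewrite fcomp_0 (fgl_log_at0 gF) fC0; apply: fpd_inj => [i|]; last first.
  by rewrite fcoefD !fcomp_at0 // (fgl_log_at0 gF) addr0.
have [q1 _] := fsqrt_serQP a1 a2 a3.
rewrite (ord1 i) fpd0 fpdD !fpd_fcomp // fpd_fint fpdN fpdX eqxx mulrN !mulr1.
by rewrite !fcomp_finv // fcomp_q_even // subrr.
Qed.

(** Reconciles the modulus square, which lives at (-u^2, -v^2), with [F_Bc_roots], which works at
    (u^2, v^2) with a1 and a3 negated. *)
Lemma bc2N (T : comNzRingType) (a1 a2 a3 x y : T) :
  bc2 a1 a2 a3 (- x) (- y) = bc2 (- a1) a2 (- a3) x y.
Proof. by rewrite /bc2; ring. Qed.

Lemma bc1N (T : comNzRingType) (a1 a2 a3 x y : T) :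
  bc1 a1 a2 a3 (- x) (- y) = - bc1 (- a1) a2 (- a3) x y.
Proof. by rewrite /bc1; ring. Qed.

Lemma modulus_square_F_Bc (a1 a2 a3 : S) :
  modulus_square (F_Bc a1 a2 a3) (Gbuch a1 a2 a3).
Proof.
apply/(modulus_square_odd (fgl_log_F_Bc a1 a2 a3) (F_Bc_at0 _ _ _) (F_Bc_odd _ _ _)).
have [/= E1 E2] := F_Bc_roots a1 a2 a3.
have x0 (i : 'I_2) : (- fX S i ^+ 2) 0%MM = 0.
  by rewrite fcoefN Defs.coef0X coef_fX0 expr0n oppr0.
apply: Gbuch_uniq; rewrite ?x0 // bc2N; first by rewrite mulrN E1 bc1N.
by rewrite E2; ring.
Qed.

Lemma eqdeg_sqr n d (f h : fps n S) : f 0%MM = 0 -> h 0%MM = 0 ->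
  eqdeg d f h -> eqdeg d.+1 (f ^+ 2) (h ^+ 2).
Proof.
move=> f0 h0 /eqdegB fh; apply/eqdegB; rewrite subr_sqr -addn1; apply: eqdeg0M => //.
by apply/eqdeg01; rewrite fcoefD f0 h0 addr0.
Qed.

Lemma sreg_uv e : sreg 2 (e.+1%:R * (u * v)).
Proof. by apply: sreg_natM; apply: (sregM (@sreg_fX S 2 ord0) (@sreg_fX S 2 ord_max)). Qed.

(* z1 is a root of (z - G(u, v)^2) (z - G(u, -v)^2), and z1 - G(u, -v)^2 is   *)
(* regular, having leading form 4 u v.                                        *)
Lemma root_uniq (G z1 z2 : fps 2 S) : G 0%MM = 0 -> eqdeg 2 G (u + v) ->
  eqdeg 3 z1 ((u + v) ^+ 2) -> z1 + z2 = G ^+ 2 + fsubst2 G u (- v) ^+ 2 ->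
  z1 * z2 = G ^+ 2 * fsubst2 G u (- v) ^+ 2 -> z1 = G ^+ 2.
Proof.
move=> G0 G2 F3 Es Em; have [u0 v0] : u 0%MM = 0 /\ v 0%MM = 0 by split; apply: coef_fX0.
have Nv0 : (- v) 0%MM = 0 by rewrite fcoefN v0 oppr0.
have H3 : eqdeg 3 (fsubst2 G u (- v) ^+ 2) ((u - v) ^+ 2).
  apply: eqdeg_sqr; rewrite ?fsubst2_at0 ?fcoefD ?u0 ?Nv0 ?addr0 //.
  have := @eqdeg_fsubst _ _ _ (fun i : 'I_2 => [:: u; - v]`_i) _ _ _ G2.
  by rewrite -[fsubst (u + v) _]/(fsubst2 (u + v) u (- v)) fsubst2D fsubst2X0 // fsubst2X1.
move: (fsubst2 G u (- v)) H3 Es Em => H H3 Es Em.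
have reg : sreg 2 (z1 - H ^+ 2).
  apply: (sreg_eqdeg (@sreg_uv 3)).
  have -> : 4%:R * (u * v) = (u + v) ^+ 2 - (u - v) ^+ 2 by ring.
  by apply: eqdegD => //; apply: eqdegN.
apply: (sreg_mulI reg); apply/eqP; rewrite -subr_eq0; apply/eqP.
transitivity (z1 * (z1 - (G ^+ 2 + H ^+ 2)) + G ^+ 2 * H ^+ 2); first by ring.
by rewrite -Es -Em; ring.
Qed.

(** Both laws have the same sum and product of values, so [root_uniq] gives equal squares, and the
    common leading form u + v fixes the sign. *)
Lemma modulus_square_eq_F_Bc F (b1 b2 b3 : S) : is_fgl F ->
  fgl_inverse F (- t) -> modulus_square F (Gbuch b1 b2 b3) -> F = F_Bc b1 b2 b3.
Proof.
move=> fF [_ Fodd]; have F0 := is_fgl_at0 fF; have [g gF] := fgl_log_exists fF.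
case/(modulus_square_odd gF F0 Fodd) => E1 E2.
have G0 := F_Bc_at0 b1 b2 b3.
have /(modulus_square_odd (fgl_log_F_Bc b1 b2 b3) G0 (F_Bc_odd _ _ _)) [] :=
  modulus_square_F_Bc b1 b2 b3; rewrite E1 E2 => /oppr_inj Es Em.
have F2 := fgl_log_eqdeg2 gF F0; have G2 := fgl_log_eqdeg2 (fgl_log_F_Bc b1 b2 b3) G0.
apply: (sqr_inj (@sreg_addX S)) => //.
apply: (root_uniq G0 G2 _ Es Em).
by apply: eqdeg_sqr => //; rewrite fcoefD !coef_fX0 addr0.
Qed.

End LogarithmExists.

(** * Universality *)

Section Naturality.
Variables (S T : comAlgType rat) (phi : {lrmorphism S -> T}).

Lemma fmap_fgl_log F g : fgl_log F g -> fgl_log (fmap phi F) (fmap phi g).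
Proof.
move=> [g2 gF]; split; first by rewrite -(fmapX phi); apply: fmap_eqdeg.
by rewrite -fmap_fcomp gF fmapD !fmap_fcomp !fmapX.
Qed.

Lemma fmap_serQ a1 a2 a3 : fmap phi (serQ a1 a2 a3) = serQ (phi a1) (phi a2) (phi a3).
Proof. by rewrite /serQ !fmapE. Qed.

Lemma fmap_g_Bc a1 a2 a3 : fmap phi (g_Bc a1 a2 a3) = g_Bc (phi a1) (phi a2) (phi a3).
Proof.
have [q1 _] := fsqrt_serQP a1 a2 a3.
by rewrite /g_Bc fmap_fint fmap_finv // fmap_fsqrt ?serQ0 // fmap_serQ.
Qed.

(** [F_Bc] is chosen by [xget], so naturality rests on uniqueness: the two sides have the same
    logarithm. *)
Lemma fmap_F_Bc a1 a2 a3 : fmap phi (F_Bc a1 a2 a3) = F_Bc (phi a1) (phi a2) (phi a3).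
Proof.
have := fmap_fgl_log (fgl_log_F_Bc a1 a2 a3); rewrite fmap_g_Bc => gF.
apply: (fgl_log_inj gF (fgl_log_F_Bc _ _ _)); last exact: F_Bc_at0.
by rewrite -[LHS]/(phi (F_Bc a1 a2 a3 0%MM)) F_Bc_at0 rmorph0.
Qed.

Lemma fmap_fderiv (f : fps 1 S) : fmap phi (fderiv f) = fderiv (fmap phi f).
Proof. by rewrite !fderivE fmap_fpd. Qed.

Lemma fmap_u2wp g2 g3 : fmap phi (u2wp g2 g3) = u2wp (phi g2) (phi g3).
Proof.
apply: is_wp_uniq (u2wpP _ _); have [W4 EW] := u2wpP g2 g3.
split; first by rewrite -(fmap1 phi); apply: fmap_eqdeg.
have := congr1 (fmap phi) EW; rewrite !fmapE fmap_fderiv.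
exact.
Qed.

Lemma fmap_sigma g2 g3 : fmap phi (sigma g2 g3) = sigma (phi g2) (phi g3).
Proof.
have [s5 Es] := sigmaP g2 g3; have [r5 Er] := sigmaP (phi g2) (phi g3).
apply: (sigma_uniq _ _ r5 _ Er).
- have [W4 _] := u2wpP (phi g2) (phi g3).
  by rewrite W4 ?mdeg0 // fcoef1 eqxx.
- by rewrite -(fmapX phi); apply: fmap_eqdeg.
have := congr1 (fmap phi) Es; rewrite /wp_is_dlog2 !fmapE !fmap_fderiv fmap_u2wp.
exact.
Qed.

Lemma rmorph_inv_g2 a1 a2 : phi (inv_g2 a1 a2) = inv_g2 (phi a1) (phi a2).
Proof.
have Z q x : phi (q *: x) = q *: phi x by rewrite linearZ.
by rewrite /inv_g2 rmorphM rmorph_nat rmorphB /= Z rmorphXn.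
Qed.

Lemma rmorph_inv_g3 a1 a2 a3 : phi (inv_g3 a1 a2 a3) = inv_g3 (phi a1) (phi a2) (phi a3).
Proof.
have Z q x : phi (q *: x) = q *: phi x by rewrite linearZ.
by rewrite /inv_g3 rmorphM rmorph_nat !rmorphB /= !Z rmorphM rmorphXn.
Qed.

End Naturality.

Section Universality.
Variable S : comAlgType rat.
Local Notation t := (fX S (ord0 : 'I_1)).

Lemma serQ_inj (a1 a2 a3 b1 b2 b3 : S) : serQ a1 a2 a3 = serQ b1 b2 b3 ->
  [/\ a1 = b1, a2 = b2 & a3 = b3].
Proof.
have cX k m : (t ^+ k : fps 1 S) (mon m) = (m == k)%:R.
  rewrite coef_fXn; congr (nat_of_bool _)%:R; apply/eqP/eqP => [|->] //.
  by move/(congr1 (@mdeg 1)); rewrite !mdegMn mdeg1 !mul1n.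
have c1 m : (1 : fps 1 S) (mon m) = (m == 0)%:R by rewrite -(expr0 t) cX.
move=> E; have {}E m := congr1 (fun f : fps 1 S => f (mon m)) E.
have := E 2; have := E 4; have := E 6.
rewrite /serQ !(fcoefD, fcoefN, coef_fCM, cX, c1) /=.
rewrite !(mulr0, mulr1, oppr0, addr0, add0r, subr0) => /oppr_inj -> -> /oppr_inj ->.
by [].
Qed.

(** The law determines its logarithm g, and Q = (g')^(-2). *)
Lemma F_Bc_inj (a1 a2 a3 b1 b2 b3 : S) : F_Bc a1 a2 a3 = F_Bc b1 b2 b3 ->
  [/\ a1 = b1, a2 = b2 & a3 = b3].
Proof.
move=> E; apply: serQ_inj.
have gF := fgl_log_F_Bc a1 a2 a3; have := fgl_log_F_Bc b1 b2 b3; rewrite -E => hF.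
have := fgl_log_uniq gF hF (F_Bc_at0 _ _ _) (F_Bc_restr0 _ _ _).
move/(congr1 (fpd ord0)); rewrite /g_Bc !fpd_fint => Ei.
have [q1 q2] := fsqrt_serQP a1 a2 a3; have [r1 r2] := fsqrt_serQP b1 b2 b3.
rewrite -q2 -r2; congr (_ ^+ 2); rewrite -[LHS]mulr1 -(finvP r1) mulrCA -Ei finvP //.
by rewrite mulr1.
Qed.

Definition Qa_eval (b : 'I_3 -> S) : Qa -> S := mmap (in_alg S) b.

HB.instance Definition _ b := GRing.RMorphism.copy (Qa_eval b) (mmap (in_alg S) b).

Fact Qa_eval_scalable b : scalable (Qa_eval b).
Proof. by move=> c p; rewrite /Qa_eval mmapZ /= mulr_algl. Qed.

HB.instance Definition _ b :=
  GRing.isScalable.Build rat Qa S *:%R (Qa_eval b) (Qa_eval_scalable b).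

Lemma Qa_evalX b i : Qa_eval b 'X_i = b i.
Proof. by rewrite /Qa_eval mmapX mmap1U. Qed.

Lemma Qa_lrmorph_ext (phi psi : {lrmorphism Qa -> S}) :
  phi pa1 = psi pa1 -> phi pa2 = psi pa2 -> phi pa3 = psi pa3 -> phi =1 psi.
Proof.
move=> E1 E2 E3 p; rewrite (mpolyE p) !linear_sum; apply: eq_bigr => m _.
rewrite !linearZ /= mpolyXE_id !rmorph_prod; congr (_ *: _).
apply: eq_bigr => i _; rewrite !rmorphXn; congr (_ ^+ _).
by case: i => [[|[|[|]]]] // j; rewrite (bool_irrelevance j isT).
Qed.

Lemma F_Bc_universal F : is_fgl F -> fgl_inverse F (- t) ->
    (exists b1 b2 b3 : S, modulus_square F (Gbuch b1 b2 b3)) ->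
  exists2 phi : {lrmorphism Qa -> S}, fmap phi (F_Bc pa1 pa2 pa3) = F &
    forall psi : {lrmorphism Qa -> S}, fmap psi (F_Bc pa1 pa2 pa3) = F -> psi =1 phi.
Proof.
move=> fF iF [b1 [b2 [b3 mF]]]; rewrite (modulus_square_eq_F_Bc fF iF mF).
pose b (i : 'I_3) := [:: b1; b2; b3]`_i.
pose phi : {lrmorphism Qa -> S} := Qa_eval b.
have [p1 p2 p3] : [/\ phi pa1 = b1, phi pa2 = b2 & phi pa3 = b3].
  by rewrite /phi /= /pa1 /pa2 /pa3 !Qa_evalX.
exists phi => [|psi]; first by rewrite fmap_F_Bc p1 p2 p3.
by rewrite fmap_F_Bc => /F_Bc_inj [e1 e2 e3]; apply: Qa_lrmorph_ext; rewrite ?p1 ?p2 ?p3.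
Qed.

End Universality.

(** * The two-valued logarithm *)

Section EvenSeries.
Variable S : comAlgType rat.
Local Notation t := (fX S (ord0 : 'I_1)).
Implicit Types h B : fps 1 S.

Lemma fcompA (R : comNzRingType) k (f g : fps 1 R) (x : fps k R) :
  g 0%MM = 0 -> x 0%MM = 0 -> fcomp (fcomp f g) x = fcomp f (fcomp g x).
Proof. by move=> g0 x0; apply: (@fsubst_fcomp _ _ _ g0). Qed.

(** One formula for both substitutions needed below, t^2 and -t. *)
Lemma coef_fcomp_monomial h c k m : fcomp h (fC 1 c * t ^+ k.+1) m =
  if (k.+1 %| m ord0)%N then h (mon (m ord0 %/ k.+1)) * c ^+ (m ord0 %/ k.+1) else 0.
Proof.
rewrite /fcomp fsubstE.
under eq_bigr => d _ do rewrite big_ord1 exprMn -fCXn -exprM coef_fCM coef_fXn.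
have mE (d : 'X_{1..1}) : (m == U_(ord0) *+ (k.+1 * d ord0))%MM = (m ord0 == k.+1 * d ord0)%N.
  by apply/eqP/eqP => [->|E]; rewrite ?mulmnE ?mnm1E ?mul1n // (monE m) E.
case: ifPn => [/dvdnP [j Ej]|nd]; last first.
  apply: big1 => d _; rewrite mE; case: eqP => [E|_]; last by rewrite !mulr0.
  by rewrite E dvdn_mulr in nd.
have jE : (m ord0 %/ k.+1)%N = j by rewrite Ej mulnK.
have lt : (mdeg (mon j) < (mdeg m).+1)%N by rewrite mdeg_mon mdeg_ord0 Ej ltnS leq_pmulr.
rewrite (bigD1 (BMultinom lt)) //= mE mulmnE mnm1E mul1n jE Ej mulnC eqxx mulr1.
rewrite [X in _ + X]big1 ?addr0 // => d; rewrite bmeqP /= => dj.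
rewrite mE Ej; case: eqP => [|_]; last by rewrite !mulr0.
rewrite mulnC => /eqP; rewrite eqn_pmul2l // => /eqP E.
by rewrite (monE d) -E eqxx in dj.
Qed.

Lemma coef_fcomp_X2 h m : fcomp h (t ^+ 2) m =
  if odd (m ord0) then 0 else h (mon (m ord0)./2).
Proof.
have -> : t ^+ 2 = fC 1 1 * t ^+ 2 by rewrite [fC 1 1 * _]mul1r.
by rewrite coef_fcomp_monomial dvdn2 divn2 expr1n mulr1; case: odd.
Qed.

Lemma fcomp_X2_inj h h' : fcomp h (t ^+ 2) = fcomp h' (t ^+ 2) -> h = h'.
Proof.
move=> E; apply: fpsP => m; have := congr1 (fun f : fps 1 S => f (mon (m ord0).*2)) E.
by rewrite !coef_fcomp_X2 mulmnE mnm1E mul1n odd_double doubleK -monE.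
Qed.

Lemma even_fcomp_X2 h : fcomp h (- t) = h -> exists B, fcomp B (t ^+ 2) = h.
Proof.
have -> : - t = fC 1 (- 1) * t ^+ 1 by rewrite fCN mulNr [fC 1 1 * _]mul1r.
move=> E; exists (FPS (fun m => h (mon (m ord0).*2))); apply: fpsP => m.
rewrite coef_fcomp_X2 /= mulmnE mnm1E mul1n; case: ifPn => [om|]; last first.
  by move=> /even_halfK ->; rewrite -monE.
symmetry; apply: (@mulrn_ratalg_eq0 _ _ 1); rewrite mulr2n -{1}E.
by rewrite coef_fcomp_monomial dvd1n divn1 -monE -signr_odd om mulrN1 addNr.
Qed.

End EvenSeries.

Section TwoValuedLogarithm.
Variables (S : comAlgType rat) (a1 a2 a3 : S).
Local Notation t := (fX S (ord0 : 'I_1)).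
Local Notation u := (fX S (ord0 : 'I_2)).
Local Notation v := (fX S (ord_max : 'I_2)).
Local Notation I := (serI a1 a2 a3).
Local Notation F := (F_Bc (- a1) a2 (- a3)).
Local Notation s := (inv_sqrt_wp (inv_g2 a1 a2) (inv_g3 a1 a2 a3) (- ((1 / 3%:R : rat) *: a1))).

Let t0 : t 0%MM = 0. Proof. exact: coef_fX0. Qed.
Let u0 : u 0%MM = 0. Proof. exact: coef_fX0. Qed.
Let v0 : v 0%MM = 0. Proof. exact: coef_fX0. Qed.
Let N0 k (x : fps k S) : x 0%MM = 0 -> (- x) 0%MM = 0.
Proof. by move=> x0; rewrite fcoefN x0 oppr0. Qed.
Let X0 k (x : fps k S) : x 0%MM = 0 -> (x ^+ 2) 0%MM = 0.
Proof. by move=> x0; rewrite Defs.coef0X x0 expr0n. Qed.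
Let F0 : F 0%MM = 0. Proof. exact: F_Bc_at0. Qed.

(** The signs in [F] are chosen so that its logarithm is I, the integral with P instead of Q. *)
Lemma fgl_log_serI : fgl_log F I.
Proof. by have := fgl_log_F_Bc (- a1) a2 (- a3); rewrite /g_Bc serQ_serP !opprK. Qed.

Let FuNv0 : fsubst2 F u (- v) 0%MM = 0. Proof. by rewrite fsubst2_at0 ?N0. Qed.

Lemma serI_odd : fcomp I (- t) = - I.
Proof. by rewrite (fgl_log_odd fgl_log_serI F0 (F_Bc_odd _ _ _) t0) fcomp_id. Qed.

Lemma inv_sqrt_wp_odd : fcomp s (- t) = - s.
Proof.
have [I0 s0 Is _] := comp_inverse_serI a1 a2 a3; have [I2 _] := fgl_log_serI.
have Nt0 := N0 t0; apply: (fcomp_inj I2); rewrite ?fcomp_at0 ?N0 //.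
rewrite (fgl_log_odd fgl_log_serI F0 (F_Bc_odd _ _ _) s0) Is.
by rewrite -fcompA // Is fcompX.
Qed.

Lemma Gbuch_F_Bc :
  fsubst2 (Gbuch a1 a2 a3).1 (u ^+ 2) (v ^+ 2) = F ^+ 2 + fsubst2 F u (- v) ^+ 2 /\
  fsubst2 (Gbuch a1 a2 a3).2 (u ^+ 2) (v ^+ 2) = F ^+ 2 * fsubst2 F u (- v) ^+ 2.
Proof.
have [/= E1 E2] := F_Bc_roots (- a1) a2 (- a3); rewrite !fCN !opprK in E1 E2.
by apply: Gbuch_uniq; rewrite ?X0.
Qed.

Lemma Gbuch_eqdeg3 : eqdeg 3 (Gbuch a1 a2 a3).2 ((u - v) ^+ 2).
Proof.
have [_ E] := Gbuch_rel a1 a2 a3 u0 v0; rewrite fsubst2_id in E.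
have c1 := bc2_at0 (fC 2 a1) (fC 2 a2) (fC 2 a3) u0 v0.
move: (bc2 _ _ _ _ _) c1 E => c c1 E.
apply/eqdegB; apply: (sreg_unit c1); rewrite add0n.
have -> : c * ((Gbuch a1 a2 a3).2 - (u - v) ^+ 2) = (u - v) ^+ 2 * (1 - c).
  by rewrite mulrBr E; ring.
apply: (@eqdeg0M _ _ 2 1); last by apply/eqdeg01; rewrite fcoefB c1 fcoef1 eqxx subrr.
apply: (@eqdeg0X _ _ _ 1 2).
by apply/eqdeg01; rewrite fcoefB u0 v0 subrr.
Qed.

Section Logarithm.
Variable B : fps 1 S.
Hypothesis BI : fcomp B (t ^+ 2) = I ^+ 2.

Lemma tv_log_eqdeg2 : eqdeg 2 B t.
Proof.
have [I2 _] := fgl_log_serI; have I0 := fgl_log_at0 fgl_log_serI.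
have I3 := eqdeg_sqr I0 t0 I2; rewrite -BI in I3.
move=> m md; have := I3 (mon (m ord0).*2).
have -> : (mdeg (mon (m ord0).*2) < 3)%N.
  by rewrite mdeg_mon -(ltn_double _ 2) // -mdeg_ord0 in md *; case: (mdeg m) md => [|[|]].
move=> /(_ isT); rewrite coef_fcomp_X2 mulmnE mnm1E mul1n odd_double doubleK -monE => ->.
rewrite -[t in RHS]expr1 !coef_fXn; congr (nat_of_bool _)%:R.
apply/eqP/eqP => [/(congr1 (fun m : 'X_{1..1} => m ord0))|->].
  rewrite !mulmnE mnm1E !mul1n => E.
  by rewrite (monE m) (double_inj (E : (m ord0).*2 = 1.*2)).
by rewrite mulmnE mnm1E.
Qed.

(** Since B(x^2) = I(x)^2, the values F(u, v)^2 and F(u, -v)^2 are sent to (I(u) + I(v))^2 and (I(u)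
    - I(v))^2, with sqrt B(s^2) = I(s). *)
Lemma tv_log_serI : tv_log (Gbuch a1 a2 a3) B.
Proof.
have gI := fgl_log_serI; have [I2 IF] := gI; have Nv0 := N0 v0.
split; [exact: Gbuch_eqdeg3 | exact: tv_log_eqdeg2 |].
have BX k (x : fps k S) : x 0%MM = 0 -> fcomp B (x ^+ 2) = fcomp I x ^+ 2.
  move=> x0; have := congr1 (fun f => fcomp f x) BI.
  by rewrite fcompA ?X0 // !fcompXn // fcompX.
have [E1 E2] := Gbuch_F_Bc.
exists I, (F ^+ 2), (fsubst2 F u (- v) ^+ 2); split.
- by rewrite BX // fcomp_id.
- by rewrite !X0.
- by rewrite E1 E2.
- by rewrite BX // IF.
rewrite BX // (fgl_log_fsubst2 gI) //; congr (_ ^+ 2).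
by rewrite (fgl_log_odd gI F0 (F_Bc_odd _ _ _) v0).
Qed.

(** From B'(z1) = (r(u) + r(v))^2, z1 has leading form (u + v)^2, so [root_uniq] gives z1 = F^2.
    Then r(F)^2 = (r(u) + r(v))^2 makes r a logarithm of F, that is, r = I. *)
Lemma tv_log_uniq B' : tv_log (Gbuch a1 a2 a3) B' -> B' = B.
Proof.
case=> _ B'2 [r [z1 [z2 [[r2 rB] [z10 _] [Es Em] Ez _]]]].
have gI := fgl_log_serI; have F2 := fgl_log_eqdeg2 gI F0.
have r0 : r 0%MM = 0 by rewrite r2 ?mdeg0 // coef_fX0.
have ruv2 : eqdeg 2 (fcomp r u + fcomp r v) (u + v).
  by apply: eqdegD; apply: eqdeg_fcompX.
have uv0 : (u + v) 0%MM = 0 by rewrite fcoefD u0 v0 addr0.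
have ruv0 : (fcomp r u + fcomp r v) 0%MM = 0 by rewrite fcoefD !fcomp_at0 // r0 addr0.
have uv3 := eqdeg_sqr ruv0 uv0 ruv2.
have z3 : eqdeg 3 z1 ((u + v) ^+ 2).
  have [h Eh h1] := eqdeg_divX (proj2 (eqdegB _ _ _) B'2).
  have [k Ek _] := eqdeg_divX h1.
  (* Used twice: it first shows that z1 has order at least 2, hence z1^2 order at least 4, and then
     identifies the part of degree 2. *)
  have z1E : z1 = (fcomp r u + fcomp r v) ^+ 2 - z1 ^+ 2 * fcomp k z1.
    have EB : B' = t + t * (t * k) by rewrite -Ek -Eh; ring.
    by rewrite -Ez EB !(fcompE z10); ring.
  have uv2 : eqdeg 2 ((u + v) ^+ 2) 0 by apply: (@eqdeg0X _ _ _ 1 2); apply/eqdeg01.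
  have z12 : eqdeg 2 z1 0.
    have zz : eqdeg 2 (z1 ^+ 2) 0 by apply: (@eqdeg0X _ _ _ 1 2); apply/eqdeg01.
    rewrite z1E; apply: eqdeg0D; last by apply/eqdeg0N/eqdeg0Mr.
    by apply: eqdeg_trans uv2; apply: eqdegW uv3.
  have z4 : eqdeg 3 (z1 ^+ 2) 0 by apply: eqdegW (@eqdeg0X _ _ _ 2 2 z12).
  rewrite z1E -[X in eqdeg _ _ X]addr0; apply: eqdegD => //.
  by apply/eqdeg0N/eqdeg0Mr.
have [E1 E2] := Gbuch_F_Bc; rewrite E1 in Es; rewrite E2 in Em.
have EF := root_uniq F0 F2 z3 Es Em.
have rF : fgl_log F r.
  split=> //; apply: (sqr_inj (@sreg_addX S)) => //.
    exact: eqdeg_trans (eqdeg_fcompX F0 r2) F2.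
  rewrite -Ez EF; have := congr1 (fun f => fcomp f F) rB.
  by rewrite fcompA ?X0 // !fcompXn // fcompX // => ->.
apply: fcomp_X2_inj; rewrite BI -rB; congr (_ ^+ 2).
exact: (fgl_log_uniq rF gI F0 (F_Bc_restr0 _ _ _)).
Qed.

Lemma tv_exp_serI : exists2 E, comp_inverse B E &
  fcomp E (t ^+ 2) = inv_wp (inv_g2 a1 a2) (inv_g3 a1 a2 a3) (- ((1 / 3%:R : rat) *: a1)).
Proof.
have [I0 s0 Is _] := comp_inverse_serI a1 a2 a3.
have [E EE] : exists E, fcomp E (t ^+ 2) = s ^+ 2.
  apply: even_fcomp_X2; rewrite fcompXn ?N0 // inv_sqrt_wp_odd; exact: sqrrN.
have E0 : E 0%MM = 0.
  by rewrite -(@fcomp_at0 _ _ (t ^+ 2) E) EE X0.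
exists E; last by rewrite EE inv_sqrt_wpX.
have B2 := tv_log_eqdeg2; have B0 : B 0%MM = 0 by rewrite B2 ?mdeg0.
apply: comp_inverseP => //; apply: fcomp_X2_inj.
rewrite fcompA ?X0 // EE fcompX ?X0 //.
have := congr1 (fun f => fcomp f s) BI; rewrite fcompA ?X0 // !fcompXn // fcompX // Is.
by [].
Qed.

End Logarithm.

Lemma tv_log_exists : exists B, fcomp B (t ^+ 2) = I ^+ 2.
Proof. by apply: even_fcomp_X2; rewrite fcompXn ?N0 // serI_odd; apply: sqrrN. Qed.

End TwoValuedLogarithm.

(** * The intersection with the class of Krichever laws *)

Section KricheverIntersection.
Variable S : comAlgType rat.
Local Notation t := (fX S (ord0 : 'I_1)).
Local Notation u := (fX S (ord0 : 'I_2)).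
Local Notation v := (fX S (ord_max : 'I_2)).
Local Notation ev H := (fsubst2 H t 0).
Implicit Types (F G : fps 2 S) (l : fps 1 S).

Let t0 : t 0%MM = 0. Proof. exact: coef_fX0. Qed.
Let u0 : u 0%MM = 0. Proof. exact: coef_fX0. Qed.
Let v0 : v 0%MM = 0. Proof. exact: coef_fX0. Qed.
Let z0 : (0 : fps 1 S) 0%MM = 0. Proof. by []. Qed.

Lemma ev_u : ev u = t. Proof. exact: fsubst2X0. Qed.
Lemma ev_v : ev v = 0. Proof. exact: fsubst2X1. Qed.
Lemma ev_fcomp_u l : ev (fcomp l u) = l.
Proof. by rewrite fsubst2_fcomp // ev_u fcomp_id. Qed.
Lemma ev_fcomp_v l : ev (fcomp l v) = fC 1 (l 0%MM).
Proof. by rewrite fsubst2_fcomp // ev_v fcomp_0. Qed.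

Lemma fpdv_fcomp_u l : fpd ord_max (fcomp l u) = 0.
Proof. by rewrite fpd_fcomp // fpdX mulr0. Qed.
Lemma fpdv_fcomp_v l : fpd ord_max (fcomp l v) = fcomp (fpd ord0 l) v.
Proof. by rewrite fpd_fcomp // fpdX eqxx mulr1. Qed.
Lemma fpdv_u : fpd ord_max u = 0. Proof. by rewrite fpdX. Qed.
Lemma fpdv_v : fpd ord_max v = 1. Proof. by rewrite fpdX eqxx. Qed.

Lemma fpd_comm n (i j : 'I_n) (f : fps n S) : fpd i (fpd j f) = fpd j (fpd i f).
Proof.
apply: fpsP => m; rewrite !fpdE !mnmDE !mnm1E addmA [(U_(j) + _)%MM]addmC -addmA.
have [->//|_] := eqVneq i j.
by rewrite !add0n -!mulrnA mulnC.
Qed.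

Let ev0 : ev 0 = 0. Proof. exact: fsubst0. Qed.
Let ev1 : ev 1 = 1. Proof. exact: fsubst21. Qed.
Let fC1 : fC 1 (1 : S) = 1. Proof. by []. Qed.

Definition ev_rules := (fsubst2D t 0, fsubst2N t 0, fsubst2Xn t0 z0, fsubst2M t0 z0,
  ev_fcomp_u, ev_fcomp_v, ev_u, ev_v, ev0, ev1).

Definition fpdv_rules := (fpdD, fpdN, fpdXn, fpdM, fpdv_fcomp_u, fpdv_fcomp_v, fpdv_u,
  fpdv_v, @fpd0 S, fpd1).

(** Leaves to [ring] the deduction of an equation from a known one. *)
Lemma eq_from_subr (V : zmodType) (x y z w : V) : x = y -> z - w = x - y -> z = w.
Proof.
by move=> ->; rewrite subrr => /eqP; rewrite subr_eq0 => /eqP.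
Qed.

(** The derivative in v at v = 0 gives l2 = om + const t, and a linear term of l2 cancels in the
    denominator. *)
Lemma calF_den F l1 l2 : ev F = t -> calF_form l1 l2 F ->
  let om := ev (fpd ord_max F) in
  u * fcomp l2 v - v * fcomp l2 u = u * fcomp om v - v * fcomp om u.
Proof.
move=> Fu [l10 l20 E] om.
have := congr1 (fun H => ev (fpd ord_max H)) E.
rewrite !fpdv_rules !ev_rules -/om Fu l10 l20 fC1.
move: (fpd ord0 l2 _) (fpd ord0 l1 _) => c b Ev.
have {Ev} -> : l2 = om + t * (fC 1 c - fC 1 b).
  apply: (sreg_mulI (@sreg_fX S 1 ord0)); apply: (eq_from_subr (esym Ev)); ring.
rewrite !(fcompE u0) !(fcompE v0); ring.
Qed.

(** The second derivative in v at v = 0 is linear in l1; the unknown constant c only affects the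
    term t^2, which cancels in the numerator. *)
Lemma calF_num F l1 (om : fps 1 S) : om 0%MM = 1 -> ev F = t -> fder2 om F = 0 ->
  om = ev (fpd ord_max F) ->
  F * (u * fcomp om v - v * fcomp om u) = u ^+ 2 * fcomp l1 v - v ^+ 2 * fcomp l1 u ->
  l1 0%MM = 1 ->
  exists c, 2%:R * l1 = 2%:R * om ^+ 2 - t * om * fpd ord0 om
    - fC 1 (fpd ord0 om 0%MM) * t * om + fC 1 c * t ^+ 2.
Proof.
move=> om1 Fu dF Eom E l10.
have Euv : ev (fpd ord_max (fpd ord0 F)) = fpd ord0 om.
  by rewrite Eom fpd_comm fpd_fsubst2 // fpd0 mulr0 addr0 fpdX eqxx mulr1.
(* The second derivative of F in v comes from differentiating [fder2 om F = 0] once in v. *)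
have Evv : ev (fpd ord_max (fpd ord_max F)) =
    om * fpd ord0 om - fC 1 (fpd ord0 om 0%MM) * om.
  have := congr1 (fun H => ev (fpd ord_max H)) dF.
  rewrite /fder2 !fpdv_rules !ev_rules Euv -Eom om1 fC1.
  by move=> Ev; apply: (eq_from_subr (esym Ev)); ring.
have dvv (G H : fps 2 S) : ev (fpd ord_max (fpd ord_max (G * H))) =
    ev (fpd ord_max (fpd ord_max G)) * ev H
    + 2%:R * ev (fpd ord_max G) * ev (fpd ord_max H)
    + ev G * ev (fpd ord_max (fpd ord_max H)).
  by rewrite !(fpdM, fpdD) !(fsubst2D, fsubst2M t0 z0); ring.
have := congr1 (fun H => ev (fpd ord_max (fpd ord_max H))) E; rewrite dvv Evv -Eom Fu.
set D := u * _ - _; have dD : fpd ord_max D = u * fcomp (fpd ord0 om) v - fcomp om u.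
  by rewrite /D !fpdv_rules; ring.
have -> : ev D = t by rewrite /D !ev_rules om1 fC1; ring.
rewrite dD; have -> : fpd ord_max (u * fcomp (fpd ord0 om) v - fcomp om u) =
    u * fcomp (fpd ord0 (fpd ord0 om)) v by rewrite !fpdv_rules; ring.
set M := u ^+ 2 * _ - _; have dM : fpd ord_max M =
    u ^+ 2 * fcomp (fpd ord0 l1) v - 2%:R * v * fcomp l1 u by rewrite /M !fpdv_rules; ring.
rewrite dM; have -> : fpd ord_max (u ^+ 2 * fcomp (fpd ord0 l1) v - 2%:R * v * fcomp l1 u) =
    u ^+ 2 * fcomp (fpd ord0 (fpd ord0 l1)) v - 2%:R * fcomp l1 u.
  by rewrite !fpdv_rules; ring.
rewrite !ev_rules; move: (fpd ord0 (fpd ord0 om) 0%MM) (fpd ord0 (fpd ord0 l1) 0%MM)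
  (fpd ord0 om 0%MM) => w2 b2 w1 Ev.
exists (b2 - w2); rewrite fCD fCN; apply: (eq_from_subr Ev); ring.
Qed.

Lemma ev_fpdv_F_Bc (a1 a2 a3 : S) :
  ev (fpd ord_max (F_Bc a1 a2 a3)) = fsqrt (serQ a1 a2 a3).
Proof.
have := fpd_fgl_log (fgl_log_F_Bc a1 a2 a3) (F_Bc_at0 _ _ _) (F_Bc_restr0 _ _ _).
have [q1 _] := fsqrt_serQP a1 a2 a3; rewrite /g_Bc fpd_fint => E.
by rewrite -[LHS]mul1r -(finvP q1) -mulrA E mulr1.
Qed.

(** With om^2 = Q, [calF_num] gives 4 l1 = 4 + c t^2 + 2 a3 t^6. Comparing F D = u^2 l1(v) - v^2
    l1(u) with F^2 N = w^2 yields m^2 N = 4 D^2, and at v = -u, where N = D^2, this leaves a3 (2 -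
    a3 t^6) = 0 up to regular factors. *)
Lemma calF_F_Bc (a1 a2 a3 : S) l1 l2 : calF_form l1 l2 (F_Bc a1 a2 a3) ->
  a3 = 0 /\ exists c, 4%:R * l1 = 4%:R + fC 1 c * t ^+ 2.
Proof.
move=> H; have Fu := F_Bc_restr0 a1 a2 a3; have := calF_den Fu H.
rewrite /= ev_fpdv_F_Bc; case: H => l10 _ FM Eden; rewrite Eden in FM.
have [q1 q2] := fsqrt_serQP a1 a2 a3.
have [c Ec] := calF_num q1 Fu (fder2_F_Bc a1 a2 a3) (esym (ev_fpdv_F_Bc _ _ _)) FM l10.
have dq := congr1 (fpd ord0) q2; rewrite fpdXn expr1 fpd_serQ in dq.
(* 2 q q' = Q' is divisible by t. *)
have w1 : fpd ord0 (fsqrt (serQ a1 a2 a3)) 0%MM = 0.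
  move: dq; set q := fsqrt _ in q1 *; set q' := fpd ord0 q => dq.
  have {}dq : q * q' + q * q' =
      t * (- 2%:R * fC 1 a1 + 4%:R * fC 1 a2 * t ^+ 2 - 6%:R * fC 1 a3 * t ^+ 4).
    by apply: (eq_from_subr dq); ring.
  have := congr1 (fun f : fps 1 S => f 0%MM) dq.
  by rewrite fcoefD !Defs.coef0M q1 coef_fX0 mul1r mul0r -mulr2n => /mulrn_ratalg_eq0.
rewrite w1 fC0 !mul0r subr0 in Ec.
have {c Ec} [c Ec] : exists c, 4%:R * l1 = 4%:R + fC 1 c * t ^+ 2 + 2%:R * fC 1 a3 * t ^+ 6.
  exists (2%:R * c - 2%:R * a1); rewrite fCD fCN !fCM !fC_nat.
  transitivity (2%:R * (2%:R * l1)); first by ring.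
  rewrite Ec q2; transitivity (4%:R * serQ a1 a2 a3
    - t * (2%:R * fsqrt (serQ a1 a2 a3) * fpd ord0 (fsqrt (serQ a1 a2 a3)))
    + 2%:R * fC 1 c * t ^+ 2); first by ring.
  by rewrite dq /serQ; ring.
suff a30 : a3 = 0.
  by split=> //; exists c; rewrite Ec a30 fC0 mulr0 mul0r addr0.
have lu := congr1 (fun f => fcomp f u) Ec; have lv := congr1 (fun f => fcomp f v) Ec.
rewrite !(fcompE u0) in lu; rewrite !(fcompE v0) in lv.
have [_ FN] := F_BcP a1 a2 a3; pose w := u ^+ 2 - v ^+ 2.
pose m := 2%:R - fC 2 a3 * u ^+ 2 * v ^+ 2 * (u ^+ 2 + v ^+ 2).
set D := u * _ - _ in FM FN; rewrite -/w in FN; set N := D ^+ 2 + _ in FN.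
(* The term c t^2 of 4 l1 drops out, and u^2 v^6 - u^6 v^2 = -u^2 v^2 (u^2 + v^2) w. *)
have FDm : 2%:R * (F_Bc a1 a2 a3 * D) = w * m.
  apply: (@natmul_fps_inj _ _ _ _ 1); rewrite FM.
  transitivity (u ^+ 2 * (4%:R * fcomp l1 v) - v ^+ 2 * (4%:R * fcomp l1 u)); first by ring.
  by rewrite lu lv /w /m; ring.
have {FN} mN : m ^+ 2 * N = 4%:R * D ^+ 2.
  apply: (sreg_mulI (@sregX _ _ _ _ 2 (@sreg_subX2 S))); rewrite -/w.
  transitivity ((w * m) ^+ 2 * N); first by ring.
  rewrite -FDm; transitivity (4%:R * D ^+ 2 * (F_Bc a1 a2 a3 ^+ 2 * N)); first by ring.
  by rewrite FN; ring.
have Nt0 : (- t) 0%MM = 0 by rewrite fcoefN t0 oppr0.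
(* On the antidiagonal v = - u the factor u^2 - v^2 of N vanishes.            *)
pose ad H := fsubst2 H t (- t); pose q := fsqrt (serQ a1 a2 a3).
have adu : ad u = t by apply: fsubst2X0.
have adv : ad v = - t by apply: fsubst2X1.
have adqu : ad (fcomp q u) = q by rewrite /ad fsubst2_fcomp // -/(ad u) adu fcomp_id.
have adqv : ad (fcomp q v) = q.
  by rewrite /ad fsubst2_fcomp // -/(ad v) adv fcomp_q_even // fcomp_id.
have aD G H : ad (G + H) = ad G + ad H by apply: fsubst2D.
have aN H : ad (- H) = - ad H by apply: fsubst2N.
have aM G H : ad (G * H) = ad G * ad H by apply: fsubst2M.
have aX H e : ad (H ^+ e) = ad H ^+ e by apply: fsubst2Xn.
have aC c' : ad (fC 2 c') = fC 1 c' by apply: fsubst2C.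
have an e : ad e%:R = e%:R by apply: fsubst2_nat.
have adw : ad w = 0 by rewrite /w !(aD, aN, aX) adu adv; ring.
have adD : ad D = 2%:R * (t * q).
  by rewrite /D !(aD, aN, aX, aM) adu adv adqu adqv; ring.
have adm : ad m = 2%:R - 2%:R * (fC 1 a3 * t ^+ 6).
  by rewrite /m aD an aN !(aX, aM, aD) aC adu adv; ring.
have adN : ad N = ad D ^+ 2 by rewrite /N aD aM !aX adw expr0n mulr0 addr0.
have := congr1 ad mN; rewrite !(aX, aM) adN an adD adm => Ead.
have {Ead} Z : (4%:R * 4%:R) * ((t * q) ^+ 2 * ((2%:R - fC 1 a3 * t ^+ 6) * (t ^+ 6 * fC 1 a3))) = 0.
  by apply: (eq_from_subr (esym Ead)); ring.
move/(sreg_eq0 (sregM (@sreg_nat _ _ 3) (@sreg_nat _ _ 3))): Z.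
move/(sreg_eq0 (@sregX _ _ _ _ 2 (sregM (@sreg_fX S 1 ord0) (sreg_unit q1)))).
have r2 : sreg 0 (2%:R - fC 1 a3 * t ^+ 6).
  apply: (sreg_eqdeg (@sreg_nat S 1 1)); apply/eqdegB/eqdeg01.
  by rewrite !fcoefB Defs.coef0M Defs.coef0X coef_fX0 expr0n mulr0 subr0 subrr.
move/(sreg_eq0 r2)/(sreg_eq0 (@sregX _ _ _ _ 6 (@sreg_fX S 1 ord0))).
by move/(congr1 (fun f : fps 1 S => f 0%MM)); rewrite /= eqxx.
Qed.

(** For a3 = 0 the defining equation reads (F D)^2 = (u^2 - v^2)^2, and leading forms select the
    sign; so lambda_1 = 1 and lambda_2 = sqrt Q. *)
Lemma F_Bc_in_calF (a1 a2 : S) : in_calF (F_Bc a1 a2 0).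
Proof.
have [q1 _] := fsqrt_serQP a1 a2 0; have [F2 FN] := F_BcP a1 a2 0.
exists 1, (fsqrt (serQ a1 a2 0)); split=> //; first by rewrite fcoef1 eqxx.
have F0 := F_Bc_at0 a1 a2 0.
move: FN; rewrite !fC0 !mul0r addr0 !(fcomp1 u0, fcomp1 v0) !mulr1 -exprMn.
have p1 : fcomp (fsqrt (serQ a1 a2 0)) u 0%MM = 1 by rewrite fcomp_at0.
have r1 : fcomp (fsqrt (serQ a1 a2 0)) v 0%MM = 1 by rewrite fcomp_at0.
move: (fcomp _ u) (fcomp _ v) p1 r1 => p r p1 r1; move: (F_Bc a1 a2 0) F0 F2 => F F0 F2.
apply: (sqr_inj (@sreg_subX2 S)) => //.
have eX (x z : fps 2 S) : x 0%MM = 0 -> z 0%MM = 1 -> eqdeg 2 (x * z) x.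
  move=> x0 z1; apply/eqdegB; have -> : x * z - x = x * (z - 1) by ring.
  by apply: (@eqdeg0M _ _ 1 1); apply/eqdeg01; rewrite ?fcoefB ?z1 ?fcoef1 ?eqxx ?subrr.
have /eqdegB D2 : eqdeg 2 (u * r - v * p) (u - v).
  by apply: eqdegD; [apply: eX | apply: eqdegN; apply: eX].
move/eqdegB: F2 => F2; apply/eqdegB.
have -> : F * (u * r - v * p) - (u ^+ 2 - v ^+ 2) =
  (F - (u + v)) * (u * r - v * p) + (u + v) * (u * r - v * p - (u - v)) by ring.
apply: eqdeg0D; [apply: (@eqdeg0M _ _ 2 1) | apply: (@eqdeg0M _ _ 1 2)] => //;
  apply/eqdeg01; rewrite ?fcoefB ?fcoefD ?Defs.coef0M ?u0 ?v0 ?mul0r ?subrr ?addr0 //.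
Qed.

(** The derivation attached to om kills F; applied to F (u om(v) - v om(u)) = u^2 - v^2 it yields a
    functional equation for R = om^2. Its v-derivative at v = 0 is the Euler equation t R' + R''(0)
    t^2 + 4 = 4 R. *)
Lemma calF_ochanine F l2 : is_fgl F -> calF_form 1 l2 F ->
  exists a1 a2 : S, F = F_Bc a1 a2 0.
Proof.
move=> fF H; have F0 := is_fgl_at0 fF; have [Fu _ _ _] := fF.
have [g gF] := fgl_log_exists fF; have := calF_den Fu H.
have gom := fpd_fgl_log gF F0 Fu; have [om1 _] := fgl_invariant fF.
case: H => _ _; rewrite /= => FE Eden; rewrite Eden !(fcomp1 u0, fcomp1 v0) !mulr1 in FE.
have dF := fder2_fgl_log om1 F0 gom gF; move: (ev (fpd _ F)) gom om1 FE dF {Eden} => om gom om1 FE dF.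
pose R := om ^+ 2; have R1 : R 0%MM = 1 by rewrite Defs.coef0X om1 expr1n.
have key : (u ^+ 2 - v ^+ 2) * (u * fcomp (fpd ord0 R) v + v * fcomp (fpd ord0 R) u) =
    4%:R * u * v * (fcomp R u - fcomp R v).
  have := congr1 (fder2 om) FE.
  rewrite fder2M dF mul0r add0r !(fder2D, fder2N, fder2Xn) !fder2M !fder2_fcomp //.
  rewrite !fder2_u !fder2_v /R !fpdXn expr1 !(fcompXn u0, fcompXn v0) !(fcompM u0, fcompM v0).
  rewrite !(fcomp_nat u0, fcomp_nat v0) -FE.
  move: FE; move: (fcomp om u) (fcomp om v) (fcomp (fpd ord0 om) u) (fcomp (fpd ord0 om) v).
  move=> p r p1 r1 FE Ed.
  (* Multiply the differentiated equation by -2 (u r - v p) and add 4 p r times the original one,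
     which removes the p r terms. *)
  have {Ed} := congr2 (fun x z => - (2%:R * (u * r - v * p) * x) + 4%:R * p * r * z) Ed FE.
  by move/eq_from_subr; apply; ring.
have Rom : om ^+ 2 = R by [].
clearbody R; have {key} key : t * fpd ord0 R + fC 1 (fpd ord0 (fpd ord0 R) 0%MM) * t ^+ 2 + (1 + 1 + 1 + 1)
    = R + R + R + R.
  apply: (sreg_mulI (@sreg_fX S 1 ord0)).
  have := congr1 (fun H => ev (fpd ord_max H)) key.
  rewrite fpdM [fpd _ (_ * (fcomp R u - _))]fpdM !fpdv_rules !ev_rules R1 fC1.
  by move/eq_from_subr; apply; ring.
have cX k n : (t ^+ k : fps 1 S) (mon n) = (n == k)%:R.
  rewrite coef_fXn; congr (nat_of_bool _)%:R; apply/eqP/eqP => [|->] //.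
  by move/(congr1 (@mdeg 1)); rewrite !mdegMn mdeg1 !mul1n.
have c1 n : (1 : fps 1 S) (mon n) = (n == 0)%:R by rewrite -(expr0 t) cX.
have ctd n : (t * fpd ord0 R) (mon n) = R (mon n) *+ n.
  rewrite coef_fXM; have -> : mon n ord0 = n by rewrite mulmnE mnm1E mul1n.
  case: n => [|n]; first by rewrite mulr0n.
  rewrite {1}/mon mulmS addmC addmK fpdE -mulmS mulmnE mnm1E mul1n //.
(* Apart from n = 0 and n = 2 this is (n - 4) R_n = 0, so only the coefficients of degree 0, 2 and 4
   survive. *)
have cR n : R (mon n) *+ n + fpd ord0 (fpd ord0 R) 0%MM * (n == 2)%:R + (n == 0)%:R *+ 4
    = R (mon n) *+ 4.
  have := congr1 (fun f : fps 1 S => f (mon n)) key.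
  rewrite !fcoefD ctd coef_fCM cX c1; move: (R (mon n) *+ n) => y.
  by move/eq_from_subr; apply; ring.
have R_1 : R (mon 1) = 0.
  apply: (@mulrn_ratalg_eq0 _ _ 2); apply: (eq_from_subr (esym (cR 1))); rewrite /=; ring.
have R_3 : R (mon 3) = 0 by apply: (eq_from_subr (esym (cR 3))); rewrite /=; ring.
have R_5 n : R (mon n.+4.+1) = 0.
  apply: (@mulrn_ratalg_eq0 _ _ n); apply: (eq_from_subr (cR n.+4.+1)) => /=.
  rewrite -[n.+4.+1]/(4 + n.+1)%N mulrnDr; move: (_ *+ n.+1) => y; ring.
have ER : R = serQ (- R (mon 2)) (R (mon 4)) 0.
  apply: fpsP => m; rewrite (monE m); move: (m ord0) => n.
  rewrite /serQ !(fcoefD, fcoefN, coef_fCM, cX, c1) mul0r subr0 mulNr opprK.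
  have R0 : R (mon 0) = 1 by rewrite /mon mulm0n.
  case: n => [|[|[|[|[|n]]]]]; [rewrite R0 | rewrite R_1 | | rewrite R_3 | | rewrite R_5];
    move: (R (mon 2)) (R (mon 4)) => r2 r4 /=; ring.
exists (- R (mon 2)), (R (mon 4)).
apply: (fgl_log_inj gF) F0 (F_Bc_at0 _ _ _).
suff -> : g = g_Bc (- R (mon 2)) (R (mon 4)) 0 by exact: fgl_log_F_Bc.
apply: fint_uniq; first exact: fgl_log_at0 gF.
symmetry; apply: finv_uniq; rewrite -ER (fsqrt_uniq om1 Rom).
by rewrite mulrC.
Qed.

Lemma in_calF_F_Bc (a1 a2 a3 : S) : in_calF (F_Bc a1 a2 a3) <-> a3 = 0.
Proof.
split=> [[l1 [l2 /calF_F_Bc []]] // | ->]; exact: F_Bc_in_calF.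
Qed.

Lemma g_Bc_ochanine (a1 a2 : S) :
  fint (Defs.finv (fsqrt (1 - fC 1 a1 * t ^+ 2 + fC 1 a2 * t ^+ 4))) = g_Bc a1 a2 0.
Proof. by rewrite /g_Bc /serQ fC0 mul0r subr0. Qed.

Lemma calF_Bc_ochanine F : is_fgl F -> in_calF F /\ in_Bc F <-> is_ochanine F.
Proof.
move=> fF; split=> [[H [a1 [a2 [a3 EF]]]] | [a1 [a2]]].
  move: H; rewrite EF => /in_calF_F_Bc ->; exists a1, a2.
  rewrite g_Bc_ochanine; exact: fgl_log_F_Bc.
rewrite g_Bc_ochanine => gF.
have -> := fgl_log_inj gF (fgl_log_F_Bc a1 a2 0) (is_fgl_at0 fF) (F_Bc_at0 _ _ _).
by split; [exact: F_Bc_in_calF | exists a1, a2, 0].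
Qed.

(** F does not determine the coefficient of u^2 in lambda_1, so it is normalized to 0; then 4 l1 = 4
    + c t^2 from [calF_F_Bc] forces l1 = 1. *)
Lemma calF_Bc_l1 F l1 l2 : is_fgl F -> calF_form l1 l2 F -> l1 (mon 2) = 0 ->
  (in_Bc F <-> l1 = 1).
Proof.
move=> fF H l12; split=> [[a1 [a2 [a3 EF]]] | El1].
  rewrite EF in H; have [_ [c Ec]] := calF_F_Bc H.
  suff c0 : c = 0.
    by apply: (@natmul_fps_inj _ _ _ _ 3); rewrite Ec c0 fC0 mul0r addr0 mulr1.
  have {}Ec : l1 + l1 + l1 + l1 = 1 + 1 + 1 + 1 + fC 1 c * t ^+ 2.
    by apply: (eq_from_subr Ec); ring.
  have := congr1 (fun f : fps 1 S => f (mon 2)) Ec.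
  have c1 : (1 : fps 1 S) (mon 2) = 0.
    by rewrite fcoef1 -mdeg_eq0 mdeg_mon.
  have c2 : (t ^+ 2 : fps 1 S) (mon 2) = 1 by rewrite coef_fXn eqxx.
  by rewrite !fcoefD coef_fCM l12 c1 c2 !addr0 !add0r mulr1.
move: H; rewrite El1 => /(calF_ochanine fF) [a1 [a2 ->]].
by exists a1, a2, 0.
Qed.

End KricheverIntersection.

Theorem theorem3p1 :
  let t := fX Qa (ord0 : 'I_1) in
  let g2 := inv_g2 pa1 pa2 in
  let g3 := inv_g3 pa1 pa2 pa3 in
  let I := serI pa1 pa2 pa3 in
  let x_of_u := inv_wp g2 g3 (- ((1 / 3%:R : rat) *: pa1)) in
  let FB := F_Bc pa1 pa2 pa3 in
  [/\ (exists s : fps 1 Qa, comp_inverse I s /\ s ^+ 2 = x_of_u) /\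
      (forall (S : comAlgType rat) (phi : {lrmorphism Qa -> S}),
         phi g2 ^+ 3 - 27%:R * phi g3 ^+ 2 = 0 ->
         let sg := sigma (phi g2) (phi g3) in
         [/\ fmap phi (sigma g2 g3) = sg,
             wp_is_dlog2 (u2wp (phi g2) (phi g3)) sg &
             exists s : fps 1 S,
               comp_inverse (serI (phi pa1) (phi pa2) (phi pa3)) s /\
               s ^+ 2 = inv_wp (phi g2) (phi g3)
                               (- ((1 / 3%:R : rat) *: phi pa1))]),
      (exists B E : fps 1 Qa,
         [/\ fcomp B (t ^+ 2) = I ^+ 2,
             forall B', tv_log (Gbuch pa1 pa2 pa3) B' <-> B' = B,
             comp_inverse B E &
             fcomp E (t ^+ 2) = x_of_u]),
      [/\ is_F_Bc pa1 pa2 pa3 FB, is_fgl FB,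
          fgl_exp FB (f_Bc pa1 pa2 pa3) & fgl_log FB (g_Bc pa1 pa2 pa3)],
      [/\ fgl_inverse FB (- t), modulus_square FB (Gbuch pa1 pa2 pa3) &
          forall (S : comAlgType rat) (F : fps 2 S),
            is_fgl F -> fgl_inverse F (- fX S ord0) ->
            (exists b1 b2 b3 : S, modulus_square F (Gbuch b1 b2 b3)) ->
            exists2 phi : {lrmorphism Qa -> S}, fmap phi FB = F &
              forall psi : {lrmorphism Qa -> S}, fmap psi FB = F -> psi =1 phi]
    & forall S : comAlgType rat,
        [/\ forall F : fps 2 S, is_fgl F ->
              (in_calF F /\ in_Bc F <-> is_ochanine F),
            forall a1 a2 a3 : S, in_calF (F_Bc a1 a2 a3) <-> a3 = 0 &
            forall (F : fps 2 S) (l1 l2 : fps 1 S),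
              is_fgl F -> calF_form l1 l2 F -> l1 (mon 2) = 0 ->
              (in_Bc F <-> l1 = 1)]].
Proof.
move=> t g2 g3 I x_of_u FB; split.
- split=> [|S phi _ sg].
    exists (inv_sqrt_wp g2 g3 (- ((1 / 3%:R : rat) *: pa1))).
    by split; [exact: comp_inverse_serI | exact: inv_sqrt_wpX].
  split; [exact: fmap_sigma | exact: (sigmaP _ _).2 |].
  exists (inv_sqrt_wp (phi g2) (phi g3) (- ((1 / 3%:R : rat) *: phi pa1))).
  split; last exact: inv_sqrt_wpX.
  by rewrite /g2 /g3 rmorph_inv_g2 rmorph_inv_g3; apply: comp_inverse_serI.
- have [B BI] := tv_log_exists pa1 pa2 pa3; have [E BE EE] := tv_exp_serI BI.
  exists B, E; split=> // B'; split=> [|->]; first exact: tv_log_uniq.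
  exact: tv_log_serI.
- split; [exact: F_BcP | exact: is_fgl_F_Bc | exact: fgl_exp_F_Bc |].
  exact: fgl_log_F_Bc.
- split; [| exact: modulus_square_F_Bc |].
    split; last exact: F_Bc_odd.
    by rewrite fcoefN coef_fX0 oppr0.
  by move=> S F fF iF mF; apply: F_Bc_universal.
move=> S; split; [exact: calF_Bc_ochanine | exact: in_calF_F_Bc |].
exact: calF_Bc_l1.
Qed.
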